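(* Let $A$ be a polish space and let $(\mathbf{w}_n)_{n\geq 1}$ be a sequence of words over $A$ with $|\mathbf{w}_n|\rightarrow\infty$ as $n\rightarrow\infty$. The following two statements are equivalent: (i) $(\mathbf{w}_n)_{n\geq 1}$ is $\mathtt{RSS}$-convergent towards some limit $\boldsymbol{\mu}=(\mu_k)_{k\geq 1}\in\partial_{\mathtt{RSS}}A$. (ii) $(\rho_{\mathbf{w}_n})_{n\ge 1}$ converges weakly in $\mathcal{M}_1(A\times\mathbb{R})$ towards some $\rho\in\mathcal{C}(A)$. If (i) and (ii) hold, one has $$\rho = \lim_{k\rightarrow\infty}\mathtt{PosSam}(\mu_k)\quad\text{and}\quad \mu_k = \mathtt{IOS}(\rho,k)\ \text{ for each } k\ge 1,$$ and this establishes a homeomorphism between $\partial_{\mathtt{RSS}}A$ and $\mathcal{C}(A)$; that is, $\rho\mapsto(\mathtt{IOS}(\rho,k))_{k\ge1}$ is a homeomorphism from $\mathcal{C}(A)$ onto $\partial_{\mathtt{RSS}}A$ with inverse $(\mu_k)_{k\ge1}\mapsto\lim_{k\to\infty}\mathtt{PosSam}(\mu_k)$.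
   Context: $\mathcal{M}_1(S)$ is the set of Borel probability measures on a polish space $S$ with the weak topology; $\mathcal{L}(X)$ is the law of $X$; $\delta_x$ is the Dirac measure; $[n]=\{1,\dots,n\}$; $|\mathbf{w}|$ is the length of a word $\mathbf{w}$ (words over $A$ are elements of $\bigcup_{n\ge1}A^n$). For $\mathbf{w}\in A^n$ and $k\le n$: $\mathtt{RSS}(\mathbf{w},k):=\binom{n}{k}^{-1}\sum_{1\le j_1<\dots<j_k\le n}\delta_{(w_{j_1},\dots,w_{j_k})}\in\mathcal{M}_1(A^k)$ (law of a uniformly random subsequence of length $k$). A sequence of words $(\mathbf{w}_n)$ is $\mathtt{RSS}$-convergent if $|\mathbf{w}_n|\to\infty$ and for each $k$ the sequence $\mathtt{RSS}(\mathbf{w}_n,k)$ (defined for $n$ large) converges weakly in $\mathcal{M}_1(A^k)$; its limit is $\boldsymbol{\mu}=(\mu_k)_{k\ge1}$, $\mu_k=\lim_n\mathtt{RSS}(\mathbf{w}_n,k)$. The Martin boundary $\partial_{\mathtt{RSS}}A\subset\prod_{k\ge1}\mathcal{M}_1(A^k)$ is the set of all limits of $\mathtt{RSS}$-convergent sequences, with the subspace topology of the product topology. $\mathcal{C}(A):=\{\rho\in\mathcal{M}_1(A\times\mathbb{R}):\rho(A\times[0,t])=t\text{ for all }t\in[0,1]\}$, with the subspace topology from $\mathcal{M}_1(A\times\mathbb{R})$. For $\mathbf{w}=(w_1,\dots,w_n)\in A^n$: $\rho_{\mathbf{w}}:=\frac1n\sum_{j=1}^n\delta_{(w_j,j/n)}\in\mathcal{M}_1(A\times\mathbb{R})$.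 For $\mu\in\mathcal{M}_1(A^n)$: $\mathtt{PosSam}(\mu):=\int_{A^n}\rho_{\mathbf{v}}\,d\mu(\mathbf{v})\in\mathcal{M}_1(A\times\mathbb{R})$. For real $x_1,\dots,x_n$, let $\mathtt{ps}(x_1,\dots,x_n)$ be the permutation $\pi$ of $[n]$ with $x_{\pi(1)}\le\dots\le x_{\pi(n)}$ sorting stably (equal values keep the order of their indices), and for $y_i\in A$ let $\mathtt{ios}(y_1,\dots,y_n,x_1,\dots,x_n):=(y_{\pi(1)},\dots,y_{\pi(n)})$. For $\rho\in\mathcal{M}_1(A\times\mathbb{R})$ and $(Y_1,X_1),\dots,(Y_k,X_k)$ i.i.d. $\sim\rho$, $\mathtt{IOS}(\rho,k):=\mathcal{L}(\mathtt{ios}(Y_1,\dots,Y_k,X_1,\dots,X_k))\in\mathcal{M}_1(A^k)$. *)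

(* Defs.v *)
From HB Require Import structures.
From mathcomp Require Import all_boot all_order all_algebra perm.
From mathcomp Require Import all_classical all_reals all_analysis.
From mathcomp Require Import measurable_realfun.

Set Implicit Arguments.
Unset Strict Implicit.
Unset Printing Implicit Defensive.

Import Order.TTheory GRing.Theory Num.Theory.
Import numFieldNormedType.Exports.

Local Open Scope classical_set_scope.
Local Open Scope ring_scope.

Definition separable (T : topologicalType) :=
  exists2 D : set T, countable D & dense D.

Definition completely_metrizable (R : realType) (T : topologicalType) :=
  exists d : T -> T -> R,
    [/\ forall x y, d x y = 0 <-> x = y,
        forall x y, d x y = d y x,
        forall x y z, d x z <= d x y + d y z,
        forall (x : T) (U : set T),
          nbhs x U <-> exists2 e, 0 < e & [set y | d x y < e] `<=` U &
        forall u : nat -> T,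
          (forall e, 0 < e -> exists N, forall m n,
             (N <= m)%N -> (N <= n)%N -> d (u m) (u n) < e) ->
          exists l : T, u @ \oo --> l].

(* Polish spaces are pointed, hence nonempty, because the measurable types of *)
(* the library are; the topology is the only other structure.                 *)
HB.mixin Record isPolish (R : realType) T & Topological T := {
  polish_separable : separable T ;
  polish_complete : completely_metrizable R T }.

#[short(type="polishType")]
HB.structure Definition Polish (R : realType) :=
  {T of PointedTopological T & isPolish R T}.

Lemma polish_second_countable (R : realType) (A : polishType R) :
  @second_countable A.
Proof.
have [D cD dD] := @polish_separable R A.
have [d [d0 dC dT dn _]] := @polish_complete R A.
have dge0 x y : 0 <= d x y.
  have := dT x y x; rewrite (proj2 (d0 x x) erefl) (dC y x) -mulr2n.
  by rewrite pmulrn_lge0.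
pose b (p : A * nat) : set A := [set y | d p.1 y < p.2.+1%:R^-1].
have ob p : open (b p).
  rewrite openE => y /= by_; apply/dn; exists (p.2.+1%:R^-1 - d p.1 y).
    by rewrite subr_gt0.
  by move=> z /=; rewrite ltrBrDl; apply: le_lt_trans; exact: dT.
exists (b @` (D `*` [set: nat])).
  by apply: (sub_countable (card_image_le _ _)); exact: countableX.
split=> [_ [p _ <-]//|x U /dn[e e0 eU]].
have [n ne] : exists n : nat, n.+1%:R^-1 < e / 2.
  have [n _ /(_ n (leqnn n)) ne] :=
    near_infty_natSinv_lt (PosNum (divr_gt0 e0 (@ltr0Sn R 1))).
  by exists n.
have [y [/= yxn Dy]] : [set y | d x y < n.+1%:R^-1] `&` D !=set0.
  by apply: dD; [exists x; rewrite /= (proj2 (d0 x x) erefl) invr_gt0 ltr0n|exact: (ob (x, n))].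
exists (b (y, n)).
  by split; [exists (y, n)|rewrite /b/= dC].
move=> z /= yz; apply: eU => /=; rewrite (le_lt_trans (dT x y z))//.
by rewrite [ltRHS]splitr ltrD// (lt_trans _ ne).
Qed.

(* join of the topological and pointed structures, missing from the library   *)
HB.instance Definition _ (T U : ptopologicalType) := Pointed.on (T * U)%type.

Notation borel S := (g_sigma_algebraType (@open S)).

(* The library's measures are functions on all subsets, constrained only on   *)
(* the measurable ones. Forcing the value 0 off the Borel sets makes Leibniz  *)
(* equality the equality of measures (M1_ext), so that the weak topology on   *)
(* M1 R S is the usual one and not its pullback to a larger set.              *)
Record M1 (R : realType) (S : ptopologicalType) := MkM1 {
  M1_prob :> probability (borel S) R ;
  M1_out : forall B : set (borel S), ~ measurable B -> M1_prob B = 0%E }.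

Section M1_theory.
Context (R : realType) (S : ptopologicalType).

Lemma M1_ext (mu nu : M1 R S) :
  (forall B : set (borel S), measurable B -> mu B = nu B) -> mu = nu.
Proof.
move=> mn; have {mn} : mu = nu :> (set (borel S) -> \bar R).
  apply/funext => B; have [/mn//|mB] := pselect (measurable B).
  by rewrite !M1_out.
case: mu => [[mu [[m1 m1'] [m2] [m3] [m4] [m5] [m6] [m7]]] mo].
case: nu => [[nu [[n1 n1'] [n2] [n3] [n4] [n5] [n6] [n7]]] no] /= E.
rewrite -{nu}E in n1 n1' n2 n3 n4 n5 n6 n7 no *.
rewrite (Prop_irrelevance n1 m1) (Prop_irrelevance n1' m1').
rewrite (Prop_irrelevance n2 m2) (Prop_irrelevance n3 m3).
rewrite (Prop_irrelevance n4 m4) (Prop_irrelevance n5 m5).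
rewrite (Prop_irrelevance n6 m6) (Prop_irrelevance n7 m7) in no *.
by rewrite (Prop_irrelevance no mo).
Qed.

Section mk.
Variable mu : {measure set (borel S) -> \bar R}.
Hypothesis mu1 : mu setT = 1%E.

Definition restr_borel (B : set (borel S)) : \bar R :=
  if `[< measurable B >] then mu B else 0%E.

Lemma restr_borelE B : measurable B -> restr_borel B = mu B.
Proof. by move=> mB; rewrite /restr_borel asboolT. Qed.

Let restr0 : restr_borel set0 = 0%E.
Proof. by rewrite restr_borelE// measure0. Qed.

Let restr_ge0 B : (0 <= restr_borel B)%E.
Proof. by rewrite /restr_borel; case: ifP. Qed.

Let restr_sigma : semi_sigma_additive restr_borel.
Proof.
move=> F mF tF mUF; rewrite restr_borelE//.
under eq_cvg do under eq_bigr do rewrite restr_borelE//.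
exact: measure_semi_sigma_additive.
Qed.

HB.instance Definition _ := isMeasure.Build _ _ _ restr_borel
  restr0 restr_ge0 restr_sigma.

Let restrT : restr_borel setT = 1%E. Proof. by rewrite restr_borelE. Qed.

Let restr_probability : probability (borel S) R :=
  HB.pack restr_borel (Measure_isProbability.Build _ _ _ restr_borel restrT).

Let restr_out (B : set (borel S)) : ~ measurable B -> restr_probability B = 0%E.
Proof. by move=> nB; rewrite /= /restr_borel asboolF. Qed.

Definition mkM1 : M1 R S := MkM1 restr_out.

Lemma mkM1E (B : set (borel S)) : measurable B -> mkM1 B = mu B.
Proof. exact: restr_borelE. Qed.

End mk.

HB.instance Definition _ := gen_eqMixin (M1 R S).
HB.instance Definition _ := gen_choiceMixin (M1 R S).
HB.instance Definition _ :=
  isPointed.Build (M1 R S) (mkM1 (diracT R (point : borel S))).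

Definition Cb : set (S -> R) := [set f | continuous f /\ bounded_fun f].

(* weak topology: the coarsest one making mu |-> \int f dmu continuous for    *)
(* every bounded continuous f                                                 *)
Definition integrals (mu : M1 R S) : prod_topology (fun _ : Cb => R) :=
  fun f => \int[mu]_x (val f : S -> R) x.

HB.instance Definition _ :=
  Topological.copy (M1 R S) (initial_topology integrals).

End M1_theory.

Lemma prod_cvg (I : Type) (T : I -> topologicalType) (X : Type) (F : set_system X)
   (FF : Filter F) (h : X -> prod_topology T) (f : prod_topology T) :
   (forall i, h x i @[x --> F] --> f i) -> h @ F --> f.
Proof.
move=> H; apply/cvg_sup => c U [_ [[V oV <-] /= Vc] VU].
have := H _ V (open_nbhs_nbhs (conj oV Vc)).
by rewrite /fmap /=; apply: (@filterS _ F FF) => x Vx; apply: VU.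
Qed.

Lemma M1_cvgP (R : realType) (S : ptopologicalType)
    (F : set_system (M1 R S)) (FF : Filter F) (mu : M1 R S) :
  F --> mu <->
  forall f : S -> R, continuous f -> bounded_fun f ->
    (fun nu : M1 R S => \int[nu]_x f x) @ F --> \int[mu]_x f x.
Proof.
split=> [Fmu f cf bf|Ff].
  pose c : @Cb R S := SigSub (mem_set (conj cf bf) : f \in @Cb R S).
  have c1 : {for mu, continuous (@integrals R S)}.
    exact: (@initial_continuous (M1 R S) _ (@integrals R S)).
  have c2 : {for integrals mu, continuous (fun h : prod_topology (fun _ : @Cb R S => R) => h c)}.
    exact: (@proj_continuous (@Cb R S) (fun=> R) c).
  by have := cvg_comp _ _ Fmu (continuous_comp c1 c2); apply.
have H : (@integrals R S) @ F --> (integrals mu : prod_topology (fun _ : @Cb R S => R)).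
  apply: (@prod_cvg _ (fun=> R : topologicalType)) => c.
  by have [cf bf] := set_valP c; exact: Ff.
move=> U [_ [[V oV <-] /= Vmu] VU].
by apply: filterS VU _; apply: H; exact: open_nbhs_nbhs.
Qed.

Lemma continuous_borel_measurable (S T : ptopologicalType) (f : S -> T) :
  continuous f -> measurable_fun setT (f : borel S -> borel T).
Proof.
move=> /continuousP cf; apply: (@measurability _ _ (borel S) (borel T) setT f (@open T) erefl).
by move=> _ [U oU <-]; rewrite setTI; apply: sub_sigma_algebra; exact: cf.
Qed.

Lemma row_coord_continuous (T : topologicalType) n (i : 'I_n) :
  continuous (fun v : 'rV[T]_n => v 0 i).
Proof.
move=> v U vU; exists (fun _ j => [set y | j = i -> U y]).
  move=> a j; rewrite (ord1 a); have [->|ji] := eqVneq j i.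
    by apply: filterS vU => y ? _.
  by apply: nearW => y /= jiE; rewrite jiE eqxx in ji.
by move=> w /= /(_ 0 i); apply.
Qed.

Section dirac_mean.
Context (R : realType) (S : ptopologicalType) (I : finType).
Variables (N : nat) (P : pred I) (x : I -> S).

Definition dirac_mean (B : set (borel S)) : \bar R :=
  ((N%:R^-1)%:E * \sum_(i | P i) dirac (x i : borel S) B)%E.

Let dirac_mean0 : dirac_mean set0 = 0%E.
Proof. by rewrite /dirac_mean big1 ?mule0// => i _; rewrite measure0. Qed.

Let dirac_mean_ge0 B : (0 <= dirac_mean B)%E.
Proof. by rewrite mule_ge0 ?lee_fin ?invr_ge0// sume_ge0. Qed.

Let dirac_mean_sigma : semi_sigma_additive dirac_mean.
Proof.
move=> F mF tF mUF.
rewrite [X in X @ _ --> _](_ : _ = (fun n => (N%:R^-1)%:E *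
    \sum_(0 <= m < n) \sum_(i | P i) dirac (x i : borel S) (F m))%E); last first.
  apply/funext => n; rewrite ge0_sume_distrr// => m _.
  by rewrite sume_ge0.
rewrite /dirac_mean; apply: cvgeZl => //.
rewrite [X in _ --> X](_ : _ =
    (\sum_(0 <= m <oo) \sum_(i | P i) dirac (x i : borel S) (F m))%E).
  by apply: is_cvg_ereal_nneg_natsum => k _; exact: sume_ge0.
rewrite nneseries_sum//; apply: eq_bigr => /= i _.
exact: measure_semi_bigcup.
Qed.

HB.instance Definition _ := isMeasure.Build _ _ _ dirac_mean
  dirac_mean0 dirac_mean_ge0 dirac_mean_sigma.

Lemma dirac_meanT : (0 < N)%N -> #|P| = N -> dirac_mean setT = 1%E.
Proof.
move=> N0 PN; rewrite /dirac_mean.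
under eq_bigr do rewrite diracT.
rewrite sumEFin sumr_const -EFinM [#|_|]PN mulVf// pnatr_eq0.
by rewrite -lt0n.
Qed.

End dirac_mean.

Section words.
Context (R : realType) (A : ptopologicalType).

(* The words over A of length n.+1 are the elements of 'rV[A]_n.+1, which     *)
(* carries the product topology.                                              *)
Definition word := {n : nat & 'rV[A]_n.+1}.

Definition word_length (w : word) : nat := (tag w).+1.

Definition subword n (w : 'rV[A]_n) k (j : k.-tuple 'I_n) : 'rV[A]_k :=
  \row_i w 0 (tnth j i).

Definition increasing n k : pred (k.-tuple 'I_n) :=
  fun j => sorted ltn (map val j).

Lemma RSS_mass n (w : 'rV[A]_n) k : (k <= n)%N ->
  dirac_mean R 'C(n, k) (@increasing n k) (@subword n w k) setT = 1%E.
Proof.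
move=> kn; apply: dirac_meanT; first by rewrite bin_gt0.
by rewrite -card_ltn_sorted_tuples; apply: eq_card => j; rewrite inE.
Qed.

(* RSS w k is given by RSSE if k <= n, and has a junk value if n < k *)
Definition RSS n (w : 'rV[A]_n) k : M1 R 'rV[A]_k :=
  match pselect (k <= n)%N with
  | left kn => mkM1 (RSS_mass w kn)
  | right _ => point
  end.

Lemma RSSE n (w : 'rV[A]_n) k (B : set (borel 'rV[A]_k)) :
  (k <= n)%N -> measurable B ->
  RSS w k B = (('C(n, k)%:R^-1)%:E *
    \sum_(j : k.-tuple 'I_n | sorted ltn (map val j))
       (\d_(subword w j : borel 'rV[A]_k) B))%E.
Proof.
move=> kn mB; rewrite /RSS; case: pselect => [kn'|//].
by rewrite mkM1E.
Qed.

Definition position n (w : 'rV[A]_n.+1) (j : 'I_n.+1) : A * R :=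
  (w 0 j, j.+1%:R / n.+1%:R).

Lemma rho_mass n (w : 'rV[A]_n.+1) :
  dirac_mean R n.+1 predT (position w) setT = 1%E.
Proof. by apply: dirac_meanT => //; rewrite card_ord. Qed.

Definition rho_ n (w : 'rV[A]_n.+1) : M1 R (A * R)%type := mkM1 (rho_mass w).

Lemma rhoE n (w : 'rV[A]_n.+1) (B : set (borel (A * R)%type)) : measurable B ->
  rho_ w B = ((n.+1%:R^-1)%:E *
    \sum_(j < n.+1)
      (\d_(position w j : borel (A * R)%type) B))%E.
Proof. by move=> mB; rewrite /rho_ mkM1E. Qed.

Lemma measurable_rho n (B : set (borel (A * R)%type)) :
  measurable_fun setT (fun v : borel 'rV[A]_n.+1 => rho_ v B).
Proof.
have [mB|nB] := pselect (measurable B); last first.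
  rewrite (_ : (fun _ => _) = cst 0%E); first exact: measurable_cst.
  by apply/funext => v; rewrite M1_out.
rewrite (_ : (fun _ => _) = fun v => ((n.+1%:R^-1)%:E * \sum_(j < n.+1)
    (\d_(position v j : borel (A * R)%type) B))%E); last first.
  by apply/funext => v; rewrite rhoE.
apply: measurable_funeM; apply: emeasurable_sum => j.
apply: (@measurableT_comp _ _ _ _ _ _
  (fun p : borel (A * R)%type => \d_p B : \bar R)) => /=.
  exact: measurable_fun_dirac.
apply: (@continuous_borel_measurable 'rV[A]_n.+1 (A * R)%type
  (fun v => position v j)).
move=> v; apply: (@cvg_pair _ _ _ (nbhs v) (nbhs (v 0 j : A))
  (nbhs (j.+1%:R / n.+1%:R : R))); [exact: row_coord_continuous|exact: cvg_cst].
Qed.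

Section PosSam.
Context n (mu : M1 R 'rV[A]_n.+1).

Definition PosSam_fun (B : set (borel (A * R)%type)) : \bar R :=
  (\int[mu]_v rho_ v B)%E.

Let PosSam0 : PosSam_fun set0 = 0%E.
Proof. by apply: integral0_eq => v _; rewrite measure0. Qed.

Let PosSam_ge0 B : (0 <= PosSam_fun B)%E.
Proof. exact: integral_ge0. Qed.

Let PosSam_sigma : semi_sigma_additive PosSam_fun.
Proof.
move=> F mF tF mUF; rewrite [X in _ --> X](_ : _ =
    (\int[mu]_v \sum_(0 <= k <oo) rho_ v (F k))%E); last first.
  by apply: eq_integral => v _; rewrite measure_semi_bigcup.
rewrite integral_nneseries//; last by move=> k; exact: measurable_rho.
by apply: is_cvg_ereal_nneg_natsum => k _; exact: integral_ge0.
Qed.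

HB.instance Definition _ := isMeasure.Build _ _ _ PosSam_fun
  PosSam0 PosSam_ge0 PosSam_sigma.

Let PosSamT : PosSam_fun setT = 1%E.
Proof.
rewrite /PosSam_fun; under eq_integral do rewrite probability_setT.
rewrite integral_cst// mul1e; exact: probability_setT.
Qed.

Definition PosSam : M1 R (A * R)%type := mkM1 PosSamT.

End PosSam.

End words.

Section iid.
Context d (T : measurableType d) (R : realType).

Definition tcons k (p : T * k.-tuple T) : k.+1.-tuple T := [tuple of p.1 :: p.2].

Lemma measurable_tcons k : measurable_fun setT (@tcons k).
Proof. exact: measurable_cons. Qed.

HB.instance Definition _ k :=
  isMeasurableFun.Build _ _ _ _ (@tcons k) (@measurable_tcons k).

(* the k-fold product of P: the law of k independent variables of law P *)
Fixpoint iid (P : probability T R) k : probability (k.-tuple T) R :=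
  match k with
  | 0%N => \d_([tuple] : 0.-tuple T)
  | k'.+1 => distribution (P \x iid P k')%E (@tcons k')
  end.

End iid.

Section stable_sort.
Context (R : realType) (k : nat).
Implicit Types (le : rel 'I_k) (x : 'I_k -> R).

Let sorted_index le : 'I_k -> 'I_k := tnth (sort_tuple le (ord_tuple k)).

Let sorted_index_inj le : injective (sorted_index le).
Proof. by apply/tuple_uniqP; rewrite /= sort_uniq enum_uniq. Qed.

Definition sort_perm le : {perm 'I_k} := perm (@sorted_index_inj le).

(* The sort of the library is stable, see ps_stable. *)
Definition ps x : {perm 'I_k} := sort_perm (fun i j => x i <= x j).

Lemma ps_stable x (i j : 'I_k) : (i < j)%N ->
  x (ps x i) < x (ps x j) \/
  x (ps x i) = x (ps x j) /\ (ps x i < ps x j)%N.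
Proof.
move=> ij; rewrite !permE /sorted_index !(tnth_nth i)/=.
set s := sort _ _.
have ss : sorted (fun a b : 'I_k => (x a <= x b) && ((x b <= x a) ==> (a < b)%N)) s.
  apply: (@sort_stable _ _ (fun a b : 'I_k => (a < b)%N)).
  - by move=> a b; exact: le_total.
  - by move=> b a c; exact: ltn_trans.
  - by have := iota_ltn_sorted 0 k; rewrite -val_enum_ord sorted_map.
have tr : transitive (fun a b : 'I_k => (x a <= x b) && ((x b <= x a) ==> (a < b)%N)).
  move=> b a c /andP[ab /implyP ab'] /andP[bc /implyP bc'].
  rewrite (le_trans ab bc)/=; apply/implyP => ca.
  by rewrite (ltn_trans (ab' (le_trans bc ca)))// bc'// (le_trans ca).
have sz : size s = k by rewrite size_sort size_enum_ord.
have := sorted_ltn_nth tr i ss; move=> /(_ i j).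
rewrite !inE sz !ltn_ord => /(_ isT isT ij) /andP[].
rewrite le_eqVlt => /orP[/eqP e|e _]; last by left.
by rewrite e lexx => /= e'; right.
Qed.

End stable_sort.

Section ios.
Context (R : realType) (A : ptopologicalType) (k : nat).

Definition ios (y : 'I_k -> A) (x : 'I_k -> R) : 'rV[A]_k :=
  \row_i y (ps x i).

Definition ios_tuple (z : k.-tuple (borel (A * R)%type)) : borel 'rV[A]_k :=
  ios (fun i => (tnth z i).1) (fun i => (tnth z i).2).

End ios.

Lemma measurable_row d (T : measurableType d) (A : ptopologicalType) k
    (g : T -> 'rV[A]_k) : @second_countable A ->
  (forall i, measurable_fun setT ((fun t => g t 0 i) : T -> borel A)) ->
  measurable_fun setT (g : T -> borel 'rV[A]_k).
Proof.
move=> [B /countable_injP[f finj] [oB bB]] mg.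
apply: (@measurability _ _ T (borel 'rV[A]_k) setT g (@open _) erefl).
move=> _ [U oU <-]; rewrite setTI.
pose h n := \bigcup_(V in [set V | B V /\ f V = n]) V.
have hf V : B V -> h (f V) = V.
  move=> BV; apply/seteqP; split=> [x [W [BW]] /finj <-//|x Vx]; rewrite ?inE//.
  by exists V.
have oh n : open (h n) by apply: bigcup_open => V [/oB].
pose box (b : {ffun 'I_k -> nat}) := \bigcap_(i : 'I_k)
  ((fun v : 'rV[A]_k => v 0 i) @^-1` h (b i)).
pose F n : set 'rV[A]_k := if (unpickle n : option {ffun 'I_k -> nat}) is Some b
  then (if `[< box b `<=` U >] then box b else set0) else set0.
have -> : U = \bigcup_n F n.
  apply/seteqP; split=> [v Uv|v [n _]]; last first.
    by rewrite /F; case: unpickle => [b|//]; case: asboolP => // bU /bU.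
  have : nbhs v U by exact: open_nbhs_nbhs.
  move=> [P Pv PU].
  have /choice[V HV] : forall i : 'I_k, exists V, [/\ B V, V (v 0 i) & V `<=` P 0 i].
    by move=> i; have [V [BV Vv] VP] := bB _ _ (Pv 0 i); exists V.
  pose b := [ffun i => f (V i)].
  have bE i : h (b i) = V i by rewrite ffunE hf//; have [] := HV i.
  exists (pickle b) => //; rewrite /F pickleK asboolT.
    by move=> i _ /=; rewrite bE; have [] := HV i.
  move=> w wb; apply: PU => i j; rewrite (ord1 i).
  by have [_ _] := HV j; apply; rewrite -bE; exact: wb.
rewrite preimage_bigcup; apply: bigcupT_measurable => n; rewrite /F.
case: unpickle => [b|]; last by rewrite preimage_set0.
case: asboolP => _; last by rewrite preimage_set0.
rewrite preimage_bigcap; apply: fin_bigcap_measurable => // i _.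
rewrite -comp_preimage -[X in measurable X]setTI; apply: mg => //.
exact: sub_sigma_algebra.
Qed.

Section measurable_ios.
Context (R : realType) (A : polishType R) (k : nat).

Lemma measurable_ios : measurable_fun setT (@ios_tuple R A k).
Proof.
apply: measurable_row; first exact: polish_second_countable.
move=> i; rewrite -[setT]setTI => _ B mB; rewrite !setTI.
have mfst : measurable_fun setT (fst : borel (A * R)%type -> borel A).
  by apply: continuous_borel_measurable => p; exact: cvg_fst.
have msnd : measurable_fun setT (snd : borel (A * R)%type -> R).
  apply: (measurability _ (RGenOpens.measurableE R)) => _ [_ [a [b ->]] <-].
  rewrite setTI; apply: sub_sigma_algebra.
  have /continuousP : continuous (@snd A R) by move=> p; exact: cvg_snd.
  by apply; exact: interval_open.
pose x (z : k.-tuple (borel (A * R)%type)) j : R := (tnth z j).2.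
pose le (b : {ffun 'I_k * 'I_k -> bool}) : rel 'I_k := fun j l => b (j, l).
pose E (b : {ffun 'I_k * 'I_k -> bool}) := \bigcap_(p : 'I_k * 'I_k) [set z | (x z p.1 <= x z p.2) = b p].
rewrite (_ : _ @^-1` B = \bigcup_(b : {ffun 'I_k * 'I_k -> bool})
    (E b `&` [set z | B (tnth z (sort_perm (le b) i)).1])).
  apply: fin_bigcup_measurable => // b _; apply: measurableI.
    apply: fin_bigcap_measurable => // -[j l] _ /=.
    have mx j' : measurable_fun setT (x ^~ j').
      by apply: measurableT_comp => //; exact: measurable_tnth.
    have := measurable_fun_le measurableT (mx j) (mx l); rewrite setTI => m.
    case: (b (j, l)); first exact: m.
    rewrite (_ : [set _ | _] = ~` [set z | x z j <= x z l]).
      exact: measurableC.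
    by apply/seteqP; split=> z /= => [->//|/negP/negbTE].
  have m : measurable_fun setT (fst \o (fun z : k.-tuple (borel (A * R)%type) =>
      tnth z (sort_perm (le b) i)) : _ -> borel A).
    by apply: measurableT_comp => //; exact: measurable_tnth.
  by have := m measurableT _ mB; rewrite setTI.
have psE z b : E b z -> sort_perm (le b) = ps (x z).
  move=> Eb; congr sort_perm; apply/funext => j; apply/funext => l.
  by rewrite /le -(Eb (j, l)).
apply/seteqP; split=> [z /= Bz|z [b _ [/psE bE]] /=].
  exists [ffun p => x z p.1 <= x z p.2] => //.
  have Ez : E [ffun p => x z p.1 <= x z p.2] z by move=> p _; rewrite /= ffunE.
  by split=> //=; rewrite (psE _ _ Ez); move: Bz; rewrite /ios mxE.
by rewrite bE /ios mxE.
Qed.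

HB.instance Definition _ :=
  isMeasurableFun.Build _ _ _ _ (@ios_tuple R A k) measurable_ios.

Definition IOS (rho : M1 R (A * R)%type) : M1 R 'rV[A]_k :=
  mkM1 (probability_setT (distribution (iid rho k) (@ios_tuple R A k))).

End measurable_ios.

Section convergence.
Context (R : realType) (A : ptopologicalType).

(* (mu_k)_{k >= 1} is represented by k |-> mu_{k+1} *)
Definition law_family := prod_topology (fun k : nat => M1 R 'rV[A]_k.+1).

Definition RSS_converges (w : nat -> word A) (mu : law_family) : Prop :=
  (word_length (w n) @[n --> \oo] --> \oo) /\
  forall k, RSS R (tagged (w n)) k.+1 @[n --> \oo] --> mu k.

Definition martin_boundary : set law_family :=
  [set mu | exists w, RSS_converges w mu].

Definition C_space : set (M1 R (A * R)%type) :=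
  [set rho | forall t : R, 0 <= t <= 1 ->
     rho ([set: A] `*` `[0, t]%classic) = t%:E].

End convergence.

Arguments martin_boundary R A : clear implicits.
Arguments C_space R A : clear implicits.

(* Main.v *)
From HB Require Import structures.
Require Import Defs.
From mathcomp Require Import all_boot all_order all_algebra perm.
From mathcomp Require Import all_classical all_reals all_analysis.
From mathcomp Require Import measurable_realfun.
From mathcomp Require Import ring lra zify.

Set Implicit Arguments.
Unset Strict Implicit.
Unset Printing Implicit Defensive.

Import Order.TTheory GRing.Theory Num.Theory.
Import numFieldNormedType.Exports.

Local Open Scope classical_set_scope.
Local Open Scope ring_scope.

(** Weak convergence is tested on bounded Lipschitz functions throughout
    ([BL_cvg_M1], [BL_M1_ext]), for a metric chosen on the letters and extended to
    the products.

    From subsequences to empirical measures.  A random subsequence of length [k]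
    places each of its letters at its rank divided by [k], the word at its position
    divided by its length.  Both are close: for independent uniform positions the
    rank is a sum of centred variables with a second moment of order [k]
    ([second_moment]), and a random subsequence is a sample of independent
    positions conditioned on having no collision, an event that long words make
    negligible ([incr_avg_all_avg], [collision_le]).  Hence the integral of a
    Lipschitz function [f] against the empirical measure differs from its integral
    against [PosSam] of the law of the subsequence by a bound that depends only on
    [f], [k] and the length of the word ([rho_PosSam_RSS]).  So the integrals
    against the empirical measures are Cauchy, and their limits are uniformly
    close to the integrals against [PosSam (mu k)]: this gives the formula for
    [rho] ([PosSam_cvg]) and, as a uniform limit of continuous maps, the continuity
    of the inverse map ([rho_limit_cvg]).

    That the limiting functional is an integral is the Daniell-type theorem
    [daniell_representation].  Its hypothesis is continuity along sequences that
    decrease to [0] pointwise.  It holds because the supremum over the positions in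
    the unit interval decreases to [0] as well, by Dini's theorem, and is a
    function of the letter alone, which the limiting functional integrates against
    the law of one random letter ([Lim_dec]).  The limit has uniform positions
    because the positions of a word are equally spaced ([rho_limit_C_space]).

    From empirical measures to subsequences.  Sorting a sample by position is
    continuous off the ties, and under a law with uniform positions two positions
    are within [delta] of each other with probability of order [delta]
    ([C_space_close]); hence [IOS] is continuous at every such law ([IOS_cvg]).
    For a word, sampling letters from its empirical measure and sorting them gives
    a random subsequence as soon as the positions are distinct ([RSS_IOS_rho]).
    So the laws of the subsequences converge to those given by [IOS]
    ([RSS_cvg_IOS]).

    Finally every law with uniform positions is a limit of words
    ([C_space_words]), so that [IOS] takes its values in the boundary.  Finitely
    many test functions control a bounded Lipschitz ball up to a small error
    ([BL_finite_test]).  A word is built letter by letter, each letter being chosen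
    so that the sum of the squared deviations of those test functions grows by a
    bounded amount only, as it would on average for a letter drawn at random from
    the corresponding strip of the law ([greedy_approx]). *)

(** * Integrals of bounded measurable functions *)

Definition bmeas d (T : measurableType d) (R : realType) (f : T -> R) :=
  measurable_fun setT f /\ exists C, forall x, `|f x| <= C.

Section bounded_measurable.
Context d (T : measurableType d) (R : realType).
Implicit Types (f g : T -> R) (P : probability T R).

Lemma bmeas_integrable P f : bmeas f -> P.-integrable setT (EFin \o f).
Proof.
move=> [mf [C fC]]; apply: measurable_bounded_integrable => //.
  by rewrite -ge0_fin_numE// fin_num_measure.
exists C; split; first exact: num_real.
by move=> M CM x _; apply: le_trans (fC x) (ltW CM).
Qed.

Lemma bmeas_cst c : bmeas (fun _ : T => c : R).
Proof. by split; [exact: measurable_cst|exists `|c|]. Qed.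

Lemma bmeasD f g : bmeas f -> bmeas g -> bmeas (fun x => f x + g x).
Proof.
move=> [mf [C fC]] [mg [D gD]]; split; first exact: measurable_funD.
by exists (C + D) => x; rewrite (le_trans (ler_normD _ _))// lerD.
Qed.

Lemma bmeasM f g : bmeas f -> bmeas g -> bmeas (fun x => f x * g x).
Proof.
move=> [mf [C fC]] [mg [D gD]]; split; first exact: measurable_funM.
by exists (C * D) => x; rewrite normrM ler_pM.
Qed.

Lemma bmeasZ c f : bmeas f -> bmeas (fun x => c * f x).
Proof. by apply: bmeasM; exact: bmeas_cst. Qed.

Lemma bmeasB f g : bmeas f -> bmeas g -> bmeas (fun x => f x - g x).
Proof.
move=> bf bg; rewrite (_ : (fun x => _) = (fun x => f x + (-1) * g x)).
  by apply: bmeasD => //; exact: bmeasZ.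
by apply/funext => x; rewrite mulN1r.
Qed.

Lemma bmeas_norm f : bmeas f -> bmeas (fun x => `|f x|).
Proof.
move=> [mf [C fC]]; split; first exact: measurableT_comp.
by exists C => x; rewrite normr_id.
Qed.

Lemma bmeas_sum (I : Type) (r : seq I) (Q : pred I) (f : I -> T -> R) :
  (forall i, bmeas (f i)) -> bmeas (fun x => \sum_(i <- r | Q i) f i x).
Proof.
move=> bf; elim: r => [|i r IH].
  by under eq_fun do rewrite big_nil; exact: bmeas_cst.
under eq_fun do rewrite big_cons.
by case: (Q i) => //; exact: bmeasD.
Qed.

Lemma bmeas_comp d' (T' : measurableType d') (h : T' -> T) f :
  measurable_fun setT h -> bmeas f -> bmeas (fun x => f (h x)).
Proof.
move=> mh [mf [C fC]]; split; first exact: (measurableT_comp mf mh).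
by exists C => x; exact: fC.
Qed.

Lemma bmeas_indic (A : set T) : measurable A -> bmeas (\1_A : T -> R).
Proof.
move=> mA; split; first exact: measurable_indic.
by exists 1 => x; rewrite indicE; case: (_ \in _); rewrite ?normr1 ?normr0.
Qed.

Section fixed_probability.
Variable P : probability T R.
Local Notation E f := (\int[P]_x f x).

Lemma Rint_cst c : E (fun _ : T => c) = c.
Proof. by rewrite Rintegral_cst// [X in fine X](probability_setT P) mulr1. Qed.

Lemma RintD f g : bmeas f -> bmeas g ->
  \int[P]_x (f x + g x) = E f + E g.
Proof. by move=> bf bg; rewrite RintegralD//; exact: bmeas_integrable. Qed.

Lemma RintB f g : bmeas f -> bmeas g ->
  \int[P]_x (f x - g x) = E f - E g.
Proof. by move=> bf bg; rewrite RintegralB//; exact: bmeas_integrable. Qed.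

Lemma RintZ c f : bmeas f -> \int[P]_x (c * f x) = c * E f.
Proof. by move=> bf; rewrite RintegralZl//; exact: bmeas_integrable. Qed.

Lemma Rint_sum (I : Type) (r : seq I) (Q : pred I) (f : I -> T -> R) :
  (forall i, bmeas (f i)) ->
  \int[P]_x (\sum_(i <- r | Q i) f i x) = \sum_(i <- r | Q i) E (f i).
Proof.
move=> bf; elim: r => [|i r IH].
  by under eq_Rintegral do rewrite big_nil; rewrite big_nil Rint_cst.
under eq_Rintegral do rewrite big_cons.
rewrite big_cons -IH; case: (Q i) => //.
by rewrite RintD//; exact: bmeas_sum.
Qed.

Lemma le_Rint f g : bmeas f -> bmeas g -> (forall x, f x <= g x) -> E f <= E g.
Proof. by move=> bf bg fg; apply: le_Rintegral => //; exact: bmeas_integrable. Qed.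

Lemma Rint_ge0 f : (forall x, 0 <= f x) -> 0 <= E f.
Proof. by move=> f0; apply: Rintegral_ge0 => x _. Qed.

Lemma Rint_le_cst f c : bmeas f -> (forall x, f x <= c) -> E f <= c.
Proof.
by move=> bf fc; rewrite -[leRHS]Rint_cst; apply: le_Rint => //; exact: bmeas_cst.
Qed.

Lemma norm_Rint f : bmeas f -> `|E f| <= \int[P]_x `|f x|.
Proof. by move=> bf; apply: le_normr_Rintegral => //; exact: bmeas_integrable. Qed.

Lemma norm_Rint_le f c : bmeas f -> (forall x, `|f x| <= c) -> `|E f| <= c.
Proof.
move=> bf fc; apply: le_trans (norm_Rint bf) _.
by apply: Rint_le_cst => //; exact: bmeas_norm.
Qed.

Lemma Rint_indic (A : set T) : measurable A -> \int[P]_x \1_A x = fine (P A).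
Proof. by move=> mA; rewrite /Rintegral integral_indic// setIT. Qed.

Lemma cvg_Rint (f_ : nat -> T -> R) f C : (forall n, measurable_fun setT (f_ n)) ->
  measurable_fun setT f -> (forall n x, `|f_ n x| <= C) ->
  (forall x, f_ n x @[n --> \oo] --> f x) ->
  \int[P]_x f_ n x @[n --> \oo] --> \int[P]_x f x.
Proof.
move=> mf_ mf fC ff.
have [|||||_ _] := @dominated_convergence _ T R P setT measurableT
    (fun n x => (f_ n x)%:E) (fun x => (f x)%:E) (cst C%:E).
- by move=> n; apply/measurable_EFinP.
- exact/measurable_EFinP.
- by apply: aeW => x _; apply: cvg_EFin; [exact: nearW|exact: ff].
- exact: (bmeas_integrable P (bmeas_cst C)).
- by apply: aeW => x n _; rewrite lee_fin.
rewrite -[X in _ --> X]fineK; first exact: fine_cvg.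
apply: integrable_fin_num => //; apply: (bmeas_integrable P); split=> //.
exists C => x; have cf : `|f_ n x| @[n --> \oo] --> `|f x| by exact: cvg_norm.
by apply: (closed_cvg (fun y => y <= C)) cf; [exact: closed_le|exact: nearW].
Qed.

End fixed_probability.

Lemma Rint_image d' (T' : measurableType d') (P : probability T' R)
    (Q : probability T R) (h : T' -> T) (g : T -> R) :
  measurable_fun setT h -> (forall A, measurable A -> Q A = P (h @^-1` A)) ->
  bmeas g -> \int[Q]_x g x = \int[P]_x g (h x).
Proof.
move=> mh QP bg; pose h' : {mfun T' >-> T} :=
  MeasurableFun.Pack (MeasurableFun.Class (isMeasurableFun.Build _ _ _ _ h mh)).
rewrite /Rintegral (eq_measure_integral (distribution P h')); last first.
  by move=> A mA _; exact: QP.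
rewrite integral_pushforward//; first by apply/measurable_EFinP; case: bg.
have [mgh [C gC]] := bmeas_comp mh bg.
rewrite preimage_setT; apply: measurable_bounded_integrable => //.
  by rewrite -ge0_fin_numE// fin_num_measure.
exists C; split; first exact: num_real.
by move=> M CM x _; apply: le_trans (gC x) (ltW CM).
Qed.

(** Finite mixtures of measures integrate as the corresponding mixtures of
    integrals; this covers empirical measures as well as averages of laws. *)
Lemma Rint_mixture (I : finType) (Q : pred I) (P : probability T R) (c : R)
    (P_ : I -> probability T R) f : 0 <= c ->
  (forall A, measurable A -> P A = (c%:E * \sum_(i | Q i) P_ i A)%E) ->
  bmeas f -> \int[P]_x f x = c * \sum_(i | Q i) \int[P_ i]_x f x.
Proof.
move=> c0 PE bf.
have ge0E g : bmeas g -> (forall x, 0 <= g x) ->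
    \int[P]_x g x = c * \sum_(i | Q i) \int[P_ i]_x g x.
  move=> bg g0; have mg : measurable_fun setT (EFin \o g).
    by apply/measurable_EFinP; case: bg.
  (* [msum] adds up a sequence of measures: the [P_ i] are enumerated, and the
     zero measure stands past the end. *)
  pose s := [seq i <- index_enum I | Q i].
  pose m (k : nat) : {measure set T -> \bar R} :=
    if nth None (map some s) k is Some i then P_ i else mzero.
  have sE (h : {measure set T -> \bar R} -> \bar R) :
      (\sum_(i | Q i) h (P_ i) = \sum_(k < size s) h (m k))%E.
    rewrite -big_filter -/s /m; elim: s {m} => [|i s' IH].
      by rewrite big_nil /= big_ord0.
    by rewrite big_cons /= big_ord_recl/= IH.
  rewrite /Rintegral (eq_measure_integral (mscale (NngNum c0) (msum m (size s)))).
    rewrite ge0_integral_mscale//; last by move=> x _; rewrite lee_fin.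
    rewrite ge0_integral_measure_sum//; last by move=> x _; rewrite lee_fin.
    rewrite -(sE (fun m => \int[m]_x (EFin \o g) x)%E).
    have fE i : (\int[P_ i]_x (EFin \o g) x)%E \is a fin_num.
      by apply: integrable_fin_num => //; exact: bmeas_integrable.
    rewrite sum_fine; last by move=> i _; exact: fE.
    by rewrite fineM//; apply/sum_fin_numP => i _ _; exact: fE.
  move=> A mA _; rewrite [LHS](PE _ mA) /mscale/= /msum/=; congr (_ * _)%E.
  by rewrite (sE (fun m => m A)).
case: (bf) => mf [C fC].
have C0 x : 0 <= f x + C by have := fC x; rewrite ler_norml; lra.
have bC := bmeas_cst C.
have bfC : bmeas (fun x => f x + C) by exact: bmeasD.
have := ge0E _ bfC C0; rewrite RintD//.
under eq_bigr do rewrite RintD//.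
rewrite big_split/= mulrDr -(ge0E (fun=> C))//; first by move=> /addIr.
move=> x; have := fC x; have := normr_ge0 (f x); lra.
Qed.

End bounded_measurable.

Lemma Rint_fubini d1 d2 (T1 : measurableType d1) (T2 : measurableType d2)
    (R : realType) (P : probability T1 R) (Q : probability T2 R)
    (f : T1 * T2 -> R) : bmeas f ->
  \int[(P \x Q)%E]_z f z = \int[P]_x \int[Q]_y f (x, y) /\
  \int[(P \x Q)%E]_z f z = \int[Q]_y \int[P]_x f (x, y).
Proof.
move=> bf; have intf := bmeas_integrable (P \x Q)%E bf.
have b1 x : bmeas (fun y => f (x, y)) by apply: bmeas_comp bf; exact: measurable_pair1.
have b2 y : bmeas (fun x => f (x, y)) by apply: bmeas_comp bf; exact: measurable_pair2.
split; congr fine.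
- rewrite -integral12_prod_meas1//; apply: eq_integral => x _.
  by rewrite fineK//; apply: integrable_fin_num => //; exact: bmeas_integrable (b1 x).
- rewrite -integral21_prod_meas1//; apply: eq_integral => y _.
  by rewrite fineK//; apply: integrable_fin_num => //; exact: bmeas_integrable (b2 y).
Qed.

Lemma bmeas_fubini d1 d2 (T1 : measurableType d1) (T2 : measurableType d2)
    (R : realType) (Q : probability T2 R) (f : T1 * T2 -> R) :
  bmeas f -> bmeas (fun x => \int[Q]_y f (x, y)).
Proof.
move=> bf; have b1 x : bmeas (fun y => f (x, y)).
  by apply: bmeas_comp bf; exact: measurable_pair1.
split; last by case: bf => _ [C fC]; exists C => x; exact: norm_Rint_le.
have P : probability T1 R := \d_(point : T1).
have m := measurable_fubini_F (bmeas_integrable (P \x Q)%E bf).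
by apply/measurable_EFinP; apply: eq_measurable_fun m => x _ /=; rewrite fineK//;
  apply: integrable_fin_num => //; exact: bmeas_integrable (b1 x).
Qed.

(** * Bounded Lipschitz functions on a metrizable space *)

(** The metric is kept apart from the topology: the spaces at hand come with a
    topology only, and the metric is chosen anew on each product. *)
Record metrizes (R : realType) (S : topologicalType) (d : S -> S -> R) : Prop :=
  Metrizes {
    metric_eq0 : forall x y, d x y = 0 <-> x = y;
    metricC : forall x y, d x y = d y x;
    metric_triangle : forall x y z, d x z <= d x y + d y z;
    metric_nbhs : forall (x : S) (U : set S),
      nbhs x U <-> exists2 e, 0 < e & [set y | d x y < e] `<=` U }.

Definition BL (R : realType) (T : Type) (d : T -> T -> R) (C L : R) (f : T -> R) :=
  (forall x, `|f x| <= C) /\ (forall x y, `|f x - f y| <= L * d x y).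

Section clamp.
Context (R : realType).
Implicit Types x y : R.

Definition clamp y := Num.max 0 (Num.min 1 y).

Lemma clamp_ge0 y : 0 <= clamp y.
Proof. by rewrite le_max lexx. Qed.

Lemma clamp_le1 y : clamp y <= 1.
Proof. by rewrite ge_max ler01 ge_min lexx. Qed.

Lemma norm_clamp y : `|clamp y| <= 1.
Proof. by rewrite ger0_norm ?clamp_ge0// clamp_le1. Qed.

Lemma clamp_ge1 y : 1 <= y -> clamp y = 1.
Proof. by move=> y1; rewrite /clamp min_l// max_r. Qed.

Lemma clamp_le0 y : y <= 0 -> clamp y = 0.
Proof. by move=> y0; rewrite /clamp min_r ?max_l//; lra. Qed.

Lemma clamp_id y : 0 <= y <= 1 -> clamp y = y.
Proof. by move=> /andP[y0 y1]; rewrite /clamp min_r// max_r. Qed.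

Lemma le_clamp x y : x <= y -> clamp x <= clamp y.
Proof. by move=> xy; rewrite /clamp; case: (leP 1 x); case: (leP 1 y);
  rewrite ?ge_max ?le_max ?lexx ?ler01//=; lra. Qed.

Lemma norm_clampB x y : `|clamp x - clamp y| <= `|x - y|.
Proof.
have h1 := ler_norm (x - y); have := ler_norm (y - x); rewrite distrC => h2.
rewrite ler_norml /clamp.
by case: (leP 1 x) => ?; case: (leP 1 y) => ?; rewrite ?(max_r ler01);
  case: (leP 0 x) => ?; case: (leP 0 y) => ?; apply/andP; split; lra.
Qed.

End clamp.

Section metrizable.
Context (R : realType) (S : ptopologicalType) (d : S -> S -> R).
Hypothesis dS : metrizes d.

Lemma metric_refl x : d x x = 0. Proof. exact/(metric_eq0 dS). Qed.

Lemma metric_ge0 x y : 0 <= d x y.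
Proof.
have := metric_triangle dS x y x; rewrite metric_refl (metricC dS y x) -mulr2n.
by rewrite pmulrn_lge0.
Qed.

Lemma metric_ball x e : 0 < e -> nbhs x [set y | d x y < e].
Proof. by move=> e0; apply/(metric_nbhs dS); exists e. Qed.

Lemma continuous_bmeas (f : S -> R) C : continuous f -> (forall x, `|f x| <= C) ->
  bmeas (f : borel S -> R).
Proof.
move=> /continuousP cf fC; split; last by exists C.
apply: (measurability _ (RGenOpens.measurableE R)) => _ [_ [a [b ->]] <-].
by rewrite setTI; apply: sub_sigma_algebra; apply: cf; exact: interval_open.
Qed.

Lemma BL_continuous C L f : BL d C L f -> continuous f.
Proof.
move=> [_ fL] x; apply/cvgrPdist_lt => e e0.
have [L0|L0] := leP L 0.
  apply: nearW => y; apply: le_lt_trans (fL x y) _.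
  by have := metric_ge0 x y; nra.
apply: filterS (metric_ball x (divr_gt0 e0 L0)) => y /=.
by rewrite ltr_pdivlMr// mulrC; apply: le_lt_trans; exact: fL.
Qed.

Lemma BL_bmeas C L f : BL d C L f -> bmeas (f : borel S -> R).
Proof. by move=> fBL; apply: continuous_bmeas (BL_continuous fBL) (proj1 fBL). Qed.

Lemma BLP C L f : (forall x, `|f x| <= C) -> (forall x y, f x - f y <= L * d x y) ->
  BL d C L f.
Proof.
move=> fC fL; split=> // x y; rewrite ler_norml.
by have := fL x y; have := fL y x; rewrite (metricC dS y x); lra.
Qed.

Lemma BL_cst c : BL d `|c| 0 (fun=> c).
Proof. by split=> // x y; rewrite subrr normr0 mul0r. Qed.

Lemma BLD C L C' L' f g : BL d C L f -> BL d C' L' g ->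
  BL d (C + C') (L + L') (fun x => f x + g x).
Proof.
move=> [fC fL] [gC gL]; split=> [x|x y].
  by apply: le_trans (ler_normD _ _) _; rewrite lerD.
rewrite mulrDl opprD addrACA; apply: le_trans (ler_normD _ _) _.
by rewrite lerD.
Qed.

Lemma BLM C L C' L' f g : BL d C L f -> BL d C' L' g ->
  BL d (C * C') (C * L' + C' * L) (fun x => f x * g x).
Proof.
move=> [fC fL] [gC gL]; split=> [x|x y]; first by rewrite normrM ler_pM.
have -> : f x * g x - f y * g y = f x * (g x - g y) + g y * (f x - f y) by ring.
apply: le_trans (ler_normD _ _) _; rewrite mulrDl -!mulrA !normrM.
by rewrite lerD// ler_pM.
Qed.

Lemma BLZ C L f c : BL d C L f -> BL d (`|c| * C) (`|c| * L) (fun x => c * f x).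
Proof.
move=> fBL; have := BLM (BL_cst c) fBL.
by rewrite mulr0 addr0.
Qed.

Lemma BLB C L C' L' f g : BL d C L f -> BL d C' L' g ->
  BL d (C + C') (L + L') (fun x => f x - g x).
Proof.
move=> fBL /(BLZ (-1)); rewrite normrN normr1 !mul1r => gBL.
have := BLD fBL gBL; congr BL.
by apply/funext => x; rewrite mulN1r.
Qed.

Lemma BL_clamp C L f : BL d C L f -> BL d 1 L (fun x => clamp (f x)).
Proof.
move=> [_ fL]; split=> [x|x y]; first exact: norm_clamp.
by apply: le_trans (fL x y); exact: norm_clampB.
Qed.

Lemma BL_max C L f g : BL d C L f -> BL d C L g ->
  BL d C L (fun x => Num.max (f x) (g x)).
Proof.
move=> [fC fL] [gC gL]; apply: BLP => [x|x y]; first by case: (leP (f x) (g x)).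
have := fL x y; have := gL x y; rewrite !ler_norml => /andP[_ g1] /andP[_ f1].
by case: (leP (f x) (g x)); case: (leP (f y) (g y)); lra.
Qed.

Lemma BL_sum (I : Type) (r : seq I) (f : I -> S -> R) :
  (forall i, exists C L, BL d C L (f i)) ->
  exists C L, BL d C L (fun x => \sum_(i <- r) f i x).
Proof.
move=> fBL; elim: r => [|i r [C [L IH]]].
  by exists `|0 : R|, 0; under eq_fun do rewrite big_nil; exact: BL_cst.
have [C' [L' fi]] := fBL i.
exists (C' + C), (L' + L).
by under eq_fun do rewrite big_cons; exact: BLD.
Qed.

Section inf_convolution.
Variables (f : S -> R) (C : R).
Hypothesis f0C : forall x, 0 <= f x <= C.

(** the infimal convolution of [f] with the metric, which is the largest
    [M]-Lipschitz function below [f] *)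
Definition lip_below (M : R) x := inf (range (fun y => f y + M * d x y)).

Let lb M x : 0 <= M -> has_lbound (range (fun y => f y + M * d x y)).
Proof.
move=> M0; exists 0 => _ [y _ <-]; have /andP[f0 _] := f0C y.
by rewrite addr_ge0// mulr_ge0// metric_ge0.
Qed.

Lemma lip_below_ge0 M x : 0 <= M -> 0 <= lip_below M x.
Proof.
move=> M0; apply: lb_le_inf; first by exists (f point + M * d x point), point.
move=> _ [y _ <-]; have /andP[f0 _] := f0C y.
by rewrite addr_ge0// mulr_ge0// metric_ge0.
Qed.

Lemma lip_below_le M x : 0 <= M -> lip_below M x <= f x.
Proof.
move=> M0; have <- : f x + M * d x x = f x by rewrite metric_refl mulr0 addr0.
by apply: ge_inf; [exact: lb|exists x].
Qed.

Lemma lip_below_BL M : 0 <= M -> BL d C M (lip_below M).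
Proof.
move=> M0; apply: BLP => [x|x y].
  rewrite ger0_norm; last exact: lip_below_ge0.
  by have /andP[_] := f0C x; apply: le_trans; exact: lip_below_le.
rewrite lerBlDr -lerBlDl; apply: lb_le_inf.
  by exists (f point + M * d y point), point.
move=> _ [z _ <-]; rewrite lerBlDl.
have : lip_below M x <= f z + M * d x z by apply: ge_inf; [exact: lb|exists z].
move=> /le_trans; apply; have := metric_triangle dS x y z; nra.
Qed.

Lemma lip_below_homo M M' x : 0 <= M -> M <= M' -> lip_below M x <= lip_below M' x.
Proof.
move=> M0 MM'; apply: lb_le_inf; first by exists (f point + M' * d x point), point.
move=> _ [y _ <-]; apply: (@le_trans _ _ (f y + M * d x y)).
  by apply: ge_inf; [exact: lb|exists y].
by rewrite lerD2l ler_wpM2r// metric_ge0.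
Qed.

(** Near [x], lower semicontinuity keeps [f] above [f x - e]; at a distance [r]
    from [x], the penalty [n * r] exceeds the bound [C] of [f]. *)
Lemma cvg_lip_below x : (forall e, 0 < e -> \forall y \near x, f x - e < f y) ->
  lip_below n%:R x @[n --> \oo] --> f x.
Proof.
move=> lsc; apply/cvgrPdist_le => e e0.
have /(metric_nbhs dS)[r r0 xr] := lsc _ e0.
near=> n.
have n0 : 0 <= n%:R :> R by exact: ler0n.
rewrite ger0_norm; last by rewrite subr_ge0 lip_below_le.
rewrite lerBlDr -lerBlDl; apply: lb_le_inf.
  by exists (f point + n%:R * d x point), point.
move=> _ [y _ <-].
have [/xr/= xy|xy] := ltP (d x y) r.
  by have := mulr_ge0 n0 (metric_ge0 x y); lra.
have : C / r <= n%:R by near: n; exact: nbhs_infty_ger.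
rewrite ler_pdivrMr// => Cn.
have : n%:R * r <= n%:R * d x y by apply: ler_wpM2l.
by have /andP[_ +] := f0C x; have /andP[+ _] := f0C y; lra.
Unshelve. all: by end_near. Qed.

End inf_convolution.

(** Bounded Lipschitz functions determine weak convergence: a bounded continuous
    function is an increasing limit of Lipschitz ones, so that its integral is
    lower semicontinuous, and so is the integral of its opposite. *)
Lemma BL_cvg_M1 (X : Type) (F : set_system X) {FF : Filter F}
    (nu : X -> M1 R S) (mu : M1 R S) :
  (forall C L f, BL d C L f -> \int[nu x]_s f s @[x --> F] --> \int[mu]_s f s) ->
  nu x @[x --> F] --> mu.
Proof.
move=> H; apply/M1_cvgP => f cf bf.
have [C fC] : exists C, forall x, `|f x| <= C.
  have [M [_ fM]] := bf; exists (`|M| + 1) => x; apply: fM => //.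
  by rewrite ltr_pwDr// ler_norm.
have lsc g e : continuous g -> (forall x, `|g x| <= C) -> 0 < e ->
    \forall x \near F, \int[mu]_s g s - e < \int[nu x]_s g s.
  move=> cg gC e0; pose h s := g s + C.
  have h0C s : 0 <= h s <= C + C.
    by have := gC s; rewrite ler_norml /h => /andP[]; lra.
  have bg : bmeas (g : borel S -> R) by exact: continuous_bmeas gC.
  have bh : bmeas (h : borel S -> R) by apply: bmeasD => //; exact: bmeas_cst.
  have hE P : \int[P : probability (borel S) R]_s h s = \int[P]_s g s + C.
    by rewrite RintD ?Rint_cst//; exact: bmeas_cst.
  have BLh n := lip_below_BL h0C (ler0n R n).
  have ch : \int[mu]_s lip_below h n%:R s @[n --> \oo] --> \int[mu]_s h s.
    apply: (cvg_Rint (C := C + C)).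
    - by move=> n; have [] := BL_bmeas (BLh n).
    - by have [] := bh.
    - by move=> n; have [] := BLh n.
    - move=> s; apply: (cvg_lip_below h0C) => r r0.
      have /cvgrPdist_lt/(_ _ r0) := cg s; apply: filterS => y.
      by rewrite ltr_norml /h => /andP[]; lra.
  have e2 : 0 < e / 2 by rewrite divr_gt0.
  have /cvgrPdist_lt/(_ _ e2)[n _ /(_ n (leqnn n))] := ch.
  rewrite ltr_norml => /andP[_ hn].
  have /cvgrPdist_lt/(_ _ e2) := H _ _ _ (BLh n).
  apply: filterS => x; rewrite ltr_norml => /andP[_ xn].
  have : \int[nu x]_s lip_below h n%:R s <= \int[nu x]_s h s.
    by apply: le_Rint => //; [exact: BL_bmeas (BLh n)|move=> s; exact: (lip_below_le h0C s (ler0n R n))].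
  rewrite !hE in hn *; lra.
have bf' : bmeas (f : borel S -> R) by exact: continuous_bmeas fC.
have NE P : \int[P : probability (borel S) R]_s (- f s) = - \int[P]_s f s.
  under eq_Rintegral do rewrite -mulN1r.
  by rewrite RintZ// mulN1r.
apply/cvgrPdist_lt => e e0.
have l1 := lsc f e cf fC e0.
have cNf : continuous (fun s => - f s) by move=> x; apply: cvgN; exact: cf.
have NfC x : `|- f x| <= C by rewrite normrN.
have l2 := lsc _ e cNf NfC e0.
apply: filterS2 l1 l2 => x; rewrite /= !NE => {}l1 {}l2.
by rewrite ltr_norml; apply/andP; split; lra.
Qed.

Lemma indic_lsc (G : set S) : open G -> forall x e, 0 < e ->
  \forall y \near x, (\1_G x : R) - e < \1_G y.
Proof.
move=> oG x e e0; have [Gx|nGx] := pselect (G x).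
  have : nbhs x G by exact: open_nbhs_nbhs.
  by apply: filterS => y Gy; rewrite !indicE !mem_set//=; lra.
apply: nearW => y; rewrite !indicE memNset//=.
by case: (_ \in _) => /=; lra.
Qed.

Lemma indic01 (G : set S) x : 0 <= (\1_G x : R) <= 1.
Proof. by rewrite indicE; case: (_ \in _); rewrite ?lexx ?ler01. Qed.

(** The indicator of an open set is an increasing limit of Lipschitz functions,
    and the open sets are a pi-system that generates the Borel sets. *)
Lemma BL_M1_ext (mu nu : M1 R S) :
  (forall C L f, BL d C L f -> \int[mu]_s f s = \int[nu]_s f s) -> mu = nu.
Proof.
move=> H; apply: M1_ext => B mB.
have oE (G : set S) : open G -> mu G = nu G.
  move=> oG; have mG : measurable (G : set (borel S)) by exact: sub_sigma_algebra.
  have G01 := @indic01 G.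
  have cG (P : M1 R S) :
      \int[P]_s lip_below (\1_G : S -> R) n%:R s @[n --> \oo] --> \int[P]_s \1_G s.
    apply: (cvg_Rint (C := 1)).
    - by move=> n; have [] := BL_bmeas (lip_below_BL G01 (ler0n R n)).
    - by have [] := bmeas_indic (T := borel S) R mG.
    - by move=> n; have [] := lip_below_BL G01 (ler0n R n).
    - by move=> s; apply: (cvg_lip_below G01); exact: indic_lsc.
  have : \int[mu]_s \1_G s = \int[nu]_s \1_G s :> R.
    have := cG mu; under eq_fun do rewrite (H _ _ _ (lip_below_BL G01 (ler0n R _))).
    by move=> cmu; exact: (cvg_unique _ cmu (cG nu)).
  rewrite !Rint_indic// => muG.
  by rewrite -(fineK (fin_num_measure mu _ mG)) muG fineK// fin_num_measure.
apply: (@g_sigma_algebra_measure_unique _ R (borel S) (@open S) _ (fun=> setT)) => //.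
- exact: sub_sigma_algebra.
- by move=> _; exact: openT.
- by rewrite bigcup_const.
- by move=> A B' oA oB; exact: openI.
- by move=> _; rewrite -ge0_fin_numE// fin_num_measure.
Qed.

Lemma M1_cvg_BL (X : Type) (F : set_system X) {FF : Filter F}
    (nu : X -> M1 R S) (mu : M1 R S) C L f : BL d C L f ->
  nu x @[x --> F] --> mu -> \int[nu x]_s f s @[x --> F] --> \int[mu]_s f s.
Proof.
move=> fBL c; apply: (proj1 (M1_cvgP _ _) c); first exact: BL_continuous fBL.
exists C; split; first exact: num_real.
by move=> M CM x _; apply: le_trans (proj1 fBL x) (ltW CM).
Qed.

Lemma M1_cvg_unique (X : Type) (F : set_system X) {FF : ProperFilter F}
    (nu : X -> M1 R S) (mu mu' : M1 R S) :
  nu x @[x --> F] --> mu -> nu x @[x --> F] --> mu' -> mu = mu'.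
Proof.
move=> c c'; apply: BL_M1_ext => C L f fBL.
exact: (cvg_unique _ (M1_cvg_BL fBL c) (M1_cvg_BL fBL c')).
Qed.

End metrizable.

(** * Finitely many test functions control a bounded Lipschitz ball *)

Section finite_test.
Context (R : realType) (S : ptopologicalType) (d : S -> S -> R).
Hypothesis dS : metrizes d.
Variable x : nat -> S.
Hypothesis x_dense : forall s e, 0 < e -> exists i, d s (x i) < e.

Section bumps.
Variable r : R.
Hypothesis r0 : 0 < r.

(** [1] within [r] of [x i], and [0] from [2 * r] on *)
Definition bump i s := clamp (2 - r^-1 * d s (x i)).

Fixpoint cover_fun n s :=
  if n is n'.+1 then Num.max (cover_fun n' s) (bump n' s) else 0.

(** The increments of [cover_fun] form a partition of unity, up to the defect
    [1 - cover_fun n], each part living near one point of the dense sequence. *)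
Definition part i s := cover_fun i.+1 s - cover_fun i s.

Lemma bump_BL i : BL d 1 r^-1 (bump i).
Proof.
split=> [s|s t]; first exact: norm_clamp.
apply: le_trans (norm_clampB _ _) _.
have -> : 2 - r^-1 * d s (x i) - (2 - r^-1 * d t (x i)) =
  r^-1 * (d t (x i) - d s (x i)) by ring.
rewrite normrM gtr0_norm ?invr_gt0//.
rewrite ler_pM2l ?invr_gt0// ler_norml.
have := metric_triangle dS s t (x i); have := metric_triangle dS t s (x i).
by rewrite (metricC dS t s); lra.
Qed.

Lemma cover_fun01 n s : 0 <= cover_fun n s <= 1.
Proof.
elim: n => [|n /andP[IH0 IH1]] /=; first by rewrite lexx ler01.
by rewrite le_max IH0/= ge_max IH1 clamp_le1.
Qed.

Lemma cover_fun_BL n : BL d 1 r^-1 (cover_fun n).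
Proof.
elim: n => [|n IH] /=; last exact: (BL_max dS IH (bump_BL n)).
split=> [s|s t]; first by rewrite normr0 ler01.
by rewrite subrr normr0 mulr_ge0 ?invr_ge0 ?(metric_ge0 dS)// ltW.
Qed.

Lemma part_BL i : BL d (1 + 1) (r^-1 + r^-1) (part i).
Proof. exact: BLB (cover_fun_BL i.+1) (cover_fun_BL i). Qed.

Lemma part_ge0 i s : 0 <= part i s.
Proof. by rewrite subr_ge0 /= le_max lexx. Qed.

Lemma part_far i s : 2 * r <= d s (x i) -> part i s = 0.
Proof.
move=> far; have b0 : bump i s = 0.
  by apply: clamp_le0; rewrite subr_le0 mulrC ler_pdivlMr.
by rewrite /part /= b0 max_l ?subrr//; have /andP[] := cover_fun01 i s.
Qed.

Lemma sum_part n s : \sum_(i < n) part i s = cover_fun n s.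
Proof.
elim: n => [|n IH]; first by rewrite big_ord0.
by rewrite big_ord_recr /= IH /part addrC subrK.
Qed.

Lemma cvg_cover_fun s : cover_fun n s @[n --> \oo] --> (1 : R).
Proof.
have [i si] := x_dense s r0.
apply: cvg_near_cst; exists i.+1 => // n /= ni.
have bi : bump i s = 1.
  by apply: clamp_ge1; rewrite lerBrDr -lerBrDl mulrC ler_pdivrMr//; lra.
apply/eqP; rewrite eq_le; have /andP[_ ->]/= := cover_fun01 n s.
elim: n ni => // n IH; rewrite ltnS leq_eqVlt => /predU1P[<-|ni] /=.
  by rewrite le_max bi lexx orbT.
by rewrite le_max IH.
Qed.

(** On the part number [i], which lives within [2 * r] of [x i], replacing [g] by
    its value at [x i] costs [2 * r * L]; where the parts do not add up to [1], the
    bound [C] is all there is. *)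
Lemma part_approx C L g n s : 0 <= L -> BL d C L g ->
  `|g s - \sum_(i < n) g (x i) * part i s|
    <= C * (1 - cover_fun n s) + 2 * r * L.
Proof.
move=> L0 [gC gL].
have /andP[c0 c1] := cover_fun01 n s.
have -> : g s - \sum_(i < n) g (x i) * part i s =
    g s * (1 - cover_fun n s) + \sum_(i < n) (g s - g (x i)) * part i s.
  under [X in _ = _ + X]eq_bigr do rewrite mulrBl.
  by rewrite sumrB -mulr_sumr sum_part; ring.
apply: le_trans (ler_normD _ _) _; apply: lerD.
  by rewrite normrM [X in _ * X]ger0_norm ?subr_ge0// ler_wpM2r ?subr_ge0.
apply: le_trans (ler_norm_sum _ _ _) _.
have -> : 2 * r * L = 2 * r * L * 1 by rewrite mulr1.
apply: (@le_trans _ _ (2 * r * L * cover_fun n s)); last first.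
  by rewrite ler_wpM2l// mulr_ge0// mulr_ge0// ltW.
rewrite -sum_part mulr_sumr; apply: ler_sum => i _.
rewrite normrM [X in _ * X]ger0_norm ?part_ge0//.
have [far|near] := leP (2 * r) (d s (x i)); first by rewrite part_far// !mulr0.
rewrite ler_wpM2r ?part_ge0//; apply: le_trans (gL _ _) _.
by rewrite mulrC ler_wpM2r// ltW.
Qed.

End bumps.

(** By [part_approx], every function of the bounded Lipschitz ball is close to a
    combination, with coefficients bounded by [C], of the same finitely many parts.
    The error comes from the defect of the partition, which is small under [mu]
    when [n] is large, and remains so under every [nu] that gives nearly the same
    integrals to the parts. *)
Lemma BL_finite_test (mu : M1 R S) (C L e : R) : 0 <= C -> 0 <= L -> 0 < e ->
  exists n (phi : 'I_n -> S -> R) (eta : R), [/\ 0 < eta,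
    forall i, exists C' L', BL d C' L' (phi i) &
    forall nu : M1 R S,
      (forall i, `|\int[nu]_s phi i s - \int[mu]_s phi i s| < eta) ->
      forall g, BL d C L g -> `|\int[nu]_s g s - \int[mu]_s g s| <= e].
Proof.
move=> C0 L0 e0.
(* The error [2 * r * L] of [part_approx] is made under both laws. *)
pose r := e / (12 * (L + 1)).
have r0 : 0 < r by rewrite divr_gt0// mulr_gt0//; lra.
have rL : 4 * r * L <= e / 3.
  have -> : e / 3 = 4 * r * (L + 1) by rewrite /r; field; lra.
  by rewrite ler_wpM2l//; lra.
have bc n : bmeas (cover_fun r n : borel S -> R) by exact: BL_bmeas (cover_fun_BL r0 n).
have cc : \int[mu]_s cover_fun r n s @[n --> \oo] --> (1 : R).
  rewrite -[X in _ --> X](Rint_cst mu).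
  apply: (cvg_Rint (C := 1)) => [n||n s|s].
  - by have [] := bc n.
  - exact: measurable_cst.
  - by have [] := cover_fun_BL r0 n.
  - exact: cvg_cover_fun.
have e1 : 0 < e / (6 * (C + 1)) by rewrite divr_gt0// mulr_gt0//; lra.
have /cvgrPdist_lt/(_ _ e1)[n _ /(_ n (leqnn n))] := cc.
rewrite ltr_norml => /andP[_ cn].
(* [N] bounds the number of parts, and is positive even without any part. *)
have [N N0 nN] : exists2 N : R, 0 < N & n%:R <= N.
  by exists n.+1%:R; rewrite ?ltr0n ?ler_nat.
pose eta := e / (6 * (C + 1) * N).
have eta0 : 0 < eta by rewrite divr_gt0// mulr_gt0// mulr_gt0//; lra.
exists n, (fun i => part r i), eta; split=> // [i|nu nuE g gBL].
  by exists (1 + 1), (r^-1 + r^-1); exact: part_BL.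
have bp i : bmeas (part r i : borel S -> R) by exact: BL_bmeas (part_BL r0 i).
have bg : bmeas (g : borel S -> R) by exact: BL_bmeas gBL.
pose G s := \sum_(i < n) g (x i) * part r i s.
have bG : bmeas (G : borel S -> R) by apply: bmeas_sum => i; exact: bmeasZ.
have GE (P : M1 R S) : \int[P]_s G s = \sum_(i < n) g (x i) * \int[P]_s part r i s.
  by rewrite Rint_sum; [apply: eq_bigr => i _; rewrite RintZ|move=> i; exact: bmeasZ].
have gG (P : M1 R S) : `|\int[P]_s g s - \int[P]_s G s| <=
    C * (1 - \int[P]_s cover_fun r n s) + 2 * r * L.
  rewrite -RintB//; apply: le_trans (norm_Rint _ (bmeasB bg bG)) _.
  have b1 : bmeas (fun s : borel S => 1 - cover_fun r n s).
    by apply: bmeasB => //; exact: bmeas_cst.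
  have -> : C * (1 - \int[P]_s cover_fun r n s) + 2 * r * L =
      \int[P]_s (C * (1 - cover_fun r n s) + 2 * r * L).
    rewrite RintD; [|exact: bmeasZ|exact: bmeas_cst].
    by rewrite RintZ// RintB ?Rint_cst//; exact: bmeas_cst.
  apply: le_Rint.
  - by apply: bmeas_norm; exact: bmeasB.
  - by apply: bmeasD; [exact: bmeasZ|exact: bmeas_cst].
  - by move=> s; exact: part_approx.
pose D := \sum_(i < n) `|\int[nu]_s part r i s - \int[mu]_s part r i s|.
have De : D <= e / (6 * (C + 1)).
  have : D <= \sum_(i < n) eta by apply: ler_sum => i _; exact: ltW.
  move=> /le_trans; apply; rewrite sumr_const card_ord -[X in X <= _]mulr_natr.
  have -> : e / (6 * (C + 1)) = eta * N by rewrite /eta; field; lra.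
  by rewrite ler_pM2l.
have DG : `|\int[nu]_s G s - \int[mu]_s G s| <= C * D.
  rewrite !GE -sumrB /D mulr_sumr; apply: le_trans (ler_norm_sum _ _ _) _.
  apply: ler_sum => i _; rewrite -mulrBr normrM ler_wpM2r//.
  by case: gBL.
have Dc : `|\int[nu]_s cover_fun r n s - \int[mu]_s cover_fun r n s| <= D.
  have cE (P : M1 R S) : \int[P]_s cover_fun r n s = \sum_(i < n) \int[P]_s part r i s.
    by rewrite -Rint_sum//; apply: eq_Rintegral => s _; rewrite sum_part.
  by rewrite !cE -sumrB; exact: ler_norm_sum.
have := gG nu; have := gG mu; move: DG Dc; rewrite !ler_norml.
set a := \int[nu]_s g s; set b := \int[mu]_s g s.
set a' := \int[nu]_s G s; set b' := \int[mu]_s G s.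
set u := \int[nu]_s _; set v := \int[mu]_s _.
move=> /andP[h1 h2] /andP[h3 h4] /andP[h5 h6] /andP[h7 h8].
have p6 : 0 < 6 * (C + 1) by lra.
have k1 : 6 * (C * D) <= e.
  have : 0 <= D by exact: sumr_ge0.
  by move: De; rewrite ler_pdivlMr//; lra.
have k2 : 6 * (C * (1 - v)) <= e.
  have : v <= 1.
    by apply: Rint_le_cst => // s; have /andP[] := cover_fun01 r n s.
  by move: cn; rewrite ltr_pdivlMr// -/v; lra.
have k3 : C * (1 - u) <= C * (1 - v) + C * D.
  by rewrite -mulrDr ler_wpM2l//; lra.
by apply/andP; split; lra.
Qed.

Lemma BL_near (X : Type) (F : set_system X) {FF : Filter F}
    (nu : X -> M1 R S) (mu : M1 R S) (C L e : R) :
  nu y @[y --> F] --> mu -> 0 <= C -> 0 <= L -> 0 < e ->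
  \forall y \near F, forall g, BL d C L g ->
    `|\int[nu y]_s g s - \int[mu]_s g s| <= e.
Proof.
move=> c C0 L0 e0.
have [n [phi [eta [eta0 phiBL H]]]] := BL_finite_test mu C0 L0 e0.
have : \forall y \near F, forall i : 'I_n,
    `|\int[nu y]_s phi i s - \int[mu]_s phi i s| < eta.
  apply: filter_forall => i; have [C' [L' pBL]] := phiBL i.
  have cp : \int[nu y]_s phi i s @[y --> F] --> \int[mu]_s phi i s.
    exact: (M1_cvg_BL dS pBL c).
  move/cvgrPdist_lt : cp => /(_ _ eta0).
  by apply: filterS => y; rewrite distrC.
by apply: filterS => y; exact: H.
Qed.

End finite_test.

(** * Metrics on products *)

Section product_metrics.
Context (R : realType) (A : ptopologicalType) (d : A -> A -> R).
Hypothesis dA : metrizes d.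

Definition dist_pos (p q : A * R) := d p.1 q.1 + `|p.2 - q.2|.

Lemma metrizes_pos : metrizes dist_pos.
Proof.
have dge0 := metric_ge0 dA; have dxx := metric_refl dA.
rewrite /dist_pos; split=> [[a x] [b y]|[a x] [b y]|[a x] [b y] [c z]|[a x] U] /=.
- split=> [|[-> ->]]; last by rewrite dxx subrr normr0 addr0.
  have := dge0 a b; have := normr_ge0 (x - y) => h1 h2 h3.
  have /(metric_eq0 dA) -> : d a b = 0 by lra.
  have : `|x - y| = 0 by lra.
  by move/eqP; rewrite normr_eq0 subr_eq0 => /eqP ->.
- by rewrite (metricC dA a) distrC.
- have := metric_triangle dA a b c; have := ler_distD y x z; lra.
split=> [[[V W] /= [aV xW] VWU]|[e e0 eU]].
  have /(metric_nbhs dA)[r r0 rV] := aV.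
  have /nbhs_ballP[t /= t0 tW] := xW.
  exists (Num.min r t); first by rewrite lt_min r0.
  move=> [b y] /=; rewrite lt_min => /andP[h1 h2]; apply: VWU; split=> /=.
    by apply: rV => /=; have := normr_ge0 (x - y); lra.
  by apply: tW; rewrite /ball/=; have := dge0 a b; lra.
have e2 : 0 < e / 2 by rewrite divr_gt0.
exists ([set b | d a b < e / 2], [set y | `|x - y| < e / 2]) => /=.
  by split; [exact: metric_ball|apply/nbhs_ballP; exists (e / 2)].
by move=> [b y] /= [h1 h2]; apply: eU => /=; lra.
Qed.

Definition dist_row k (v w : 'rV[A]_k) := \sum_(i < k) d (v 0 i) (w 0 i).

Lemma le_dist_row k (v w : 'rV[A]_k) i : d (v 0 i) (w 0 i) <= dist_row v w.
Proof.
by rewrite /dist_row (bigD1 i)//= lerDl sumr_ge0// => j _; exact: metric_ge0.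
Qed.

Lemma metrizes_row k : metrizes (@dist_row k).
Proof.
split=> [v w|v w|u v w|v U].
- split=> [vw|->]; last by apply: big1 => i _; exact: metric_refl.
  apply/rowP => i; apply/(metric_eq0 dA)/eqP; rewrite eq_le metric_ge0// andbT.
  by rewrite -vw le_dist_row.
- by apply: eq_bigr => i _; exact: metricC.
- by rewrite -big_split; apply: ler_sum => i _; exact: metric_triangle.
split=> [[P vP PU]|[e e0 eU]].
  have /choice[r rP] : forall i : 'I_k, exists r, 0 < r /\
      [set y | d (v 0 i) y < r] `<=` P 0 i.
    by move=> i; have /(metric_nbhs dA)[r r0 rP] := vP 0 i; exists r.
  exists (\big[Num.min/1]_(i < k) r i).
    by apply: lt_bigmin => // i _; have [] := rP i.
  move=> w /= vw; apply: PU => i j; rewrite (ord1 i).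
  have [_] := rP j; apply => /=; apply: le_lt_trans (le_dist_row v w j) _.
  by apply: lt_le_trans vw _; exact: bigmin_le_cond.
exists (fun _ j => [set y | d (v 0 j) y < e / k.+1%:R]).
  by move=> i j; rewrite (ord1 i); apply: metric_ball => //; rewrite divr_gt0.
move=> w /= vw; apply: eU => /=.
apply: (@le_lt_trans _ _ (\sum_(i < k) e / k.+1%:R)).
  by apply: ler_sum => i _; exact/ltW/vw.
rewrite sumr_const card_ord -[_ *+ k]mulr_natr mulrAC ltr_pdivrMr ?ltr0n//.
by rewrite ltr_pM2l// ltr_nat.
Qed.

End product_metrics.

Lemma polish_metric (R : realType) (A : polishType R) :
  exists d : A -> A -> R, metrizes d.
Proof. by have [d [d0 dC dT dn _]] := @polish_complete R A; exists d. Qed.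

Lemma dense_sequence_pos (R : realType) (A : polishType R) (d : A -> A -> R) :
  metrizes d -> exists x : nat -> A * R,
    forall s e, 0 < e -> exists i, dist_pos d s (x i) < e.
Proof.
move=> dA; have [D cD dD] := @polish_separable R A.
have [a Da] : exists a : nat -> A, forall s (e : R), 0 < e -> exists i, d s (a i) < e.
  have /countable_injP[f finj] := cD.
  exists (fun n => xget point [set s | D s /\ f s = n]) => s e e0.
  have := metric_ball dA s e0; rewrite nbhsE => -[B [oB Bs] Be].
  have [y [By Dy]] : B `&` D !=set0 by apply: dD => //; exists s.
  exists (f y); case: xgetP => [z _ [Dz fz]|/(_ y)]; last by case.
  by rewrite (finj z y) ?inE//; exact: Be.
pose x n : A * R := if (unpickle n : option (nat * rat)) is Some (i, q)
  then (a i, ratr q) else point.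
exists x => s e e0; have e2 : 0 < e / 2 by rewrite divr_gt0.
have [i ai] := Da s.1 _ e2.
have [q qs] : exists q : rat, `|s.2 - ratr q| < e / 2.
  have [y [sy [q _ qy]]] : ball s.2 (e / 2) `&` (@ratr R @` setT) !=set0.
    apply: dense_rat; first by exists s.2; exact: ballxx.
    exact: ball_open.
  by exists q; rewrite qy.
by exists (pickle (i, q)); rewrite /x pickleK /dist_pos/=; lra.
Qed.

(** * A Daniell-type representation theorem *)

Section daniell.
Context (R : realType) (S : ptopologicalType) (d : S -> S -> R).
Hypothesis dS : metrizes d.
Implicit Types (f g : S -> R) (u : nat -> S -> R) (E : set S).

Definition isBL f := exists C K, BL d C K f.

Lemma isBL_cst c : isBL (fun=> c).
Proof. by exists `|c|, 0; exact: BL_cst. Qed.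

Lemma isBLD f g : isBL f -> isBL g -> isBL (fun x => f x + g x).
Proof. by move=> [? [? fBL]] [? [? gBL]]; do 2 eexists; exact: BLD fBL gBL. Qed.

Lemma isBLM f g : isBL f -> isBL g -> isBL (fun x => f x * g x).
Proof. by move=> [? [? fBL]] [? [? gBL]]; do 2 eexists; exact: BLM fBL gBL. Qed.

Lemma isBLZ c f : isBL f -> isBL (fun x => c * f x).
Proof. by apply: isBLM; exact: isBL_cst. Qed.

Lemma isBLB f g : isBL f -> isBL g -> isBL (fun x => f x - g x).
Proof. by move=> [? [? fBL]] [? [? gBL]]; do 2 eexists; exact: BLB fBL gBL. Qed.

Lemma isBL_clamp f : isBL f -> isBL (fun x => clamp (f x)).
Proof. by move=> [? [? fBL]]; do 2 eexists; exact: BL_clamp fBL. Qed.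

Lemma isBL_sum (I : Type) (r : seq I) (f : I -> S -> R) :
  (forall i, isBL (f i)) -> isBL (fun x => \sum_(i <- r) f i x).
Proof. exact: BL_sum. Qed.

(** Continuity along sequences decreasing to [0] plays the part of tightness: it
    keeps the representing measure from losing mass. *)
Record daniell (L : (S -> R) -> R) : Prop := Daniell {
  daniellD : forall f g, isBL f -> isBL g -> L (fun x => f x + g x) = L f + L g;
  daniellZ : forall c f, isBL f -> L (fun x => c * f x) = c * L f;
  daniell_ge0 : forall f, isBL f -> (forall x, 0 <= f x) -> 0 <= L f;
  daniell1 : L (fun=> 1) = 1;
  daniell_dec : forall u, (forall n, isBL (u n)) ->
    (forall n x, u n.+1 x <= u n x) ->
    (forall x, u n x @[n --> \oo] --> 0) -> L (u n) @[n --> \oo] --> 0 }.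

Variable L : (S -> R) -> R.
Hypothesis DL : daniell L.

Let L0 : L (fun=> 0) = 0.
Proof.
rewrite -[RHS](mul0r (L (fun=> 0))) -(daniellZ DL 0 (isBL_cst 0)).
by congr L; apply/funext => x; rewrite mul0r.
Qed.

Let LB f g : isBL f -> isBL g -> L (fun x => f x - g x) = L f - L g.
Proof.
move=> bf bg; rewrite -mulN1r -(daniellZ DL)// -(daniellD DL)//; last exact: isBLZ.
by congr L; apply/funext => x; rewrite mulN1r.
Qed.

Let leL f g : isBL f -> isBL g -> (forall x, f x <= g x) -> L f <= L g.
Proof.
move=> bf bg fg; rewrite -subr_ge0 -LB//; apply: (daniell_ge0 DL); first exact: isBLB.
by move=> x; rewrite subr_ge0.
Qed.

Let L_sum (I : Type) (r : seq I) (f : I -> S -> R) : (forall i, isBL (f i)) ->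
  L (fun x => \sum_(i <- r) f i x) = \sum_(i <- r) L (f i).
Proof.
move=> bf; elim: r => [|i r IH].
  by rewrite big_nil -[RHS]L0; congr L; apply/funext => x; rewrite big_nil.
rewrite big_cons -IH -(daniellD DL)//; last exact: isBL_sum.
by congr L; apply/funext => x; rewrite big_cons.
Qed.

(** Increasing sequences, instead of single functions, are what makes the outer
    measure below countably subadditive and exact on open sets. *)
Definition covers E u := [/\ forall n, isBL (u n), forall n x, 0 <= u n x,
  forall n x, u n x <= u n.+1 x &
  forall x, E x -> forall e, 0 < e -> exists n, 1 - e < u n x].

Let covers_homo E u m n x : covers E u -> (m <= n)%N -> u m x <= u n x.
Proof.
move=> [_ _ inc _] /subnK <-; elim: (n - m)%N => //= k IH.
by apply: le_trans IH _; rewrite addSn.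
Qed.

Definition cover_bound E (c : R) := exists2 u, covers E u & forall n, L (u n) <= c.

Definition outer (E : set S) : \bar R := ereal_inf (EFin @` cover_bound E).

Let outer_le E c : cover_bound E c -> (outer E <= c%:E)%E.
Proof. by move=> Ec; apply: ereal_inf_lbound; exists c. Qed.

Let cover_bound_ge0 E c : cover_bound E c -> 0 <= c.
Proof.
move=> [u [bu u0 _ _] uc]; apply: le_trans (uc 0%N).
by apply: (daniell_ge0 DL).
Qed.

Let outer_ge0 E : (0 <= outer E)%E.
Proof.
by apply: le_ereal_inf_tmp => _ [c Ec <-]; rewrite lee_fin; exact: cover_bound_ge0 Ec.
Qed.

Let le_outer : {homo outer : E E' / E `<=` E' >-> (E <= E')%E}.
Proof.
move=> E E' EE'; apply: le_ereal_inf => _ [c [u [bu u0 inc uE] uc] <-].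
by exists c => //; exists u => //; split=> // x /EE'; exact: uE.
Qed.

Let outer_le1 E : (outer E <= 1)%E.
Proof.
apply: outer_le; exists (fun _ _ => 1) => [|n]; last by rewrite daniell1.
split=> //; first by move=> n; exact: isBL_cst.
by move=> x _ e e0; exists 0%N; lra.
Qed.

Let outer_fin E : outer E \is a fin_num.
Proof. by rewrite ge0_fin_numE// (le_lt_trans (outer_le1 E))// ltry. Qed.

Let outer0 : outer set0 = 0%E.
Proof.
apply/eqP; rewrite eq_le outer_ge0 andbT; apply: outer_le.
exists (fun _ _ => 0) => [|n]; last by rewrite L0.
by split=> // n; exact: isBL_cst.
Qed.

Let outer_sigma_subadditive : sigma_subadditive outer.
Proof.
move=> E; apply/lee_addgt0Pr => e e0.
have := @epsilon_trick R (fun n => outer (E n)) (PosNum e0)%:num xpredT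
  (fun n => outer_ge0 (E n)) (ltW e0).
rewrite /=; apply: le_trans.
have /choice[c cE] : forall n, exists c : R, cover_bound (E n) c /\
    (c%:E <= outer (E n) + (e / (2 ^ n.+1)%:R)%:E)%E.
  move=> n; have en : 0 < e / (2 ^ n.+1)%:R by rewrite divr_gt0// ltr0n expn_gt0.
  have [_ [c Ec <-] cE] := lb_ereal_inf_adherent en (outer_fin (E n)).
  by exists c; split=> //; exact: ltW.
have c0 n : 0 <= c n by exact: cover_bound_ge0 (cE n).1.
apply: (@le_trans _ _ (\sum_(n <oo) (c n)%:E)%E); last first.
  by apply: lee_nneseries => [n _ _|n _]; [rewrite lee_fin|exact: (cE n).2].
have sum0 : (0 <= \sum_(n <oo) (c n)%:E)%E by apply: nneseries_ge0 => n _; rewrite lee_fin.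
have [soo|] := eqVneq (\sum_(n <oo) (c n)%:E)%E +oo%E; first by rewrite soo leey.
rewrite -ltey -ge0_fin_numE// => sfin.
have sum_le m : \sum_(i < m) c i <= fine (\sum_(n <oo) (c n)%:E)%E.
  rewrite -lee_fin fineK// -sumEFin -(big_mkord xpredT (fun i => (c i)%:E)).
  by apply: nneseries_lim_ge => n _ _; rewrite lee_fin.
rewrite -(fineK sfin).
have /choice[u uE] : forall n, exists u, covers (E n) u /\ forall m, L (u m) <= c n.
  by move=> n; have [[u un uc] _] := cE n; exists u.
have bu n m : isBL (u n m) by have [[]] := uE n.
have u0 n m x : 0 <= u n m x by have [[]] := uE n.
apply: outer_le; exists (fun m x => \sum_(i < m) u i m x).
  split=> [m|m x|m x|x [n _ Enx] r r0].
  - exact: isBL_sum.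
  - exact: sumr_ge0.
  - rewrite big_ord_recr /= -[leLHS]addr0 lerD//.
    by apply: ler_sum => i _; apply: covers_homo (uE i).1 _.
  - have [[_ _ _ /(_ x Enx r r0)[m um]] _] := uE n.
    exists (maxn n.+1 m).
    have nm : (n < maxn n.+1 m)%N by rewrite leq_maxl.
    rewrite (bigD1 (Ordinal nm))//=; apply: lt_le_trans um _.
    rewrite -[leLHS]addr0 lerD ?sumr_ge0//.
    by apply: covers_homo (uE n).1 _; exact: leq_maxr.
move=> m; rewrite L_sum//; apply: le_trans (sum_le m).
by apply: ler_sum => i _; exact: (uE i).2.
Qed.

HB.instance Definition _ := isOuterMeasure.Build R S outer
  outer0 outer_ge0 le_outer outer_sigma_subadditive.

(** A cover of [X] splits along Lipschitz functions [phi p] increasing to the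
    indicator of [G]: [u p * phi p] covers [X] inside [G], and, for each fixed
    [p], [u m * (1 - phi p)] covers [X] outside of [G]. *)
Let open_caratheodory (G : set S) : open G -> outer.-caratheodory G.
Proof.
move=> oG; apply: le_caratheodory_measurable => X.
apply: le_ereal_inf_tmp => _ [c [u uX uc] <-].
have [bu u0 uinc uX1] := uX.
pose phi (p : nat) := lip_below d (\1_G : S -> R) p%:R.
have G01 := @indic01 R S G.
have bphi p : isBL (phi p) by exists 1, p%:R; exact: (lip_below_BL dS G01 (ler0n R p)).
have phi0 p x : 0 <= phi p x by exact: (lip_below_ge0 dS G01 x (ler0n R p)).
have phiG p x : phi p x <= \1_G x by exact: (lip_below_le dS G01 x (ler0n R p)).
have phi1 p x : phi p x <= 1 by apply: le_trans (phiG p x) _; have /andP[] := G01 x.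
have phi_inc p x : phi p x <= phi p.+1 x.
  by apply: (lip_below_homo dS G01) => //; rewrite ler_nat.
have b1phi p : isBL (fun x => 1 - phi p x) by apply: isBLB => //; exact: isBL_cst.
pose t := fine (outer (X `&` ~` G)).
have tE : outer (X `&` ~` G) = t%:E by rewrite fineK.
have split_le p : L (fun x => u p x * phi p x) <= c - t.
  rewrite lerBrDr -lerBrDl -lee_fin -tE.
  apply: outer_le; exists (fun m x => u m x * (1 - phi p x)).
    split=> [m|m x|m x|x [Xx nGx] e e0].
    - exact: isBLM.
    - by rewrite mulr_ge0// subr_ge0.
    - by rewrite ler_wpM2r// subr_ge0.
    - have [n un] := uX1 x Xx e e0; exists n.
      have -> : phi p x = 0.
        by apply/eqP; rewrite eq_le phi0 andbT; have := phiG p x; rewrite indicE memNset.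
      by rewrite subr0 mulr1.
  move=> m; rewrite lerBrDl; apply: (@le_trans _ _ (L (u (maxn m p)))) => //.
  rewrite -(daniellD DL); [|exact: isBLM|exact: isBLM].
  apply: leL => // [|x]; first by apply: isBLD; exact: isBLM.
  have h1 := covers_homo x uX (leq_maxl m p); have h2 := covers_homo x uX (leq_maxr m p).
  by have := phi0 p x; have := phi1 p x; nra.
have : (outer (X `&` G) <= (c - t)%:E)%E.
  apply: outer_le; exists (fun p x => u p x * phi p x) => //.
  split=> [m|m x|m x|x [Xx Gx] e e0].
  - exact: isBLM.
  - exact: mulr_ge0.
  - exact: ler_pM.
  - have [e2|e2] := leP 2 e.
      by exists 0%N; have := mulr_ge0 (u0 0%N x) (phi0 0%N x); lra.
    have e4 : 0 < e / 2 by lra.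
    have [n un] := uX1 x Xx _ e4.
    have := cvg_lip_below dS G01 (@indic_lsc R S G oG x).
    move=> /cvgrPdist_lt/(_ _ e4)[p _ /(_ _ (leqnn p))].
    rewrite indicE mem_set// -/(phi p) ltr_norml => /andP[_ pp].
    exists (maxn n p).
    have phi_homo : phi p x <= phi (maxn n p) x.
      by apply: (lip_below_homo dS G01) => //; rewrite ler_nat leq_maxr.
    have un' := covers_homo x uX (leq_maxl n p).
    have : (1 - e / 2) * (1 - e / 2) <= u (maxn n p) x * phi (maxn n p) x.
      by apply: ler_pM; move: pp; rewrite /=; lra.
    by have := mulr_gt0 e4 e4; lra.
by move=> h; rewrite -[leRHS]/(c%:E) -(subrK t c) EFinD -tE; exact: leeD.
Qed.

Let borel_caratheodory (B : set (borel S)) : measurable B -> outer.-cara.-measurable B.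
Proof.
move=> mB; apply: mB; split.
  split.
  - exact: measurable0.
  - by move=> A mA; rewrite setTD; exact: measurableC.
  - by move=> F mF; exact: bigcupT_measurable.
by move=> G oG; exact: open_caratheodory.
Qed.

Let outer_semi_sigma_additive : semi_sigma_additive (outer : set (borel S) -> \bar R).
Proof.
move=> F mF tF mUF.
apply: (@caratheodory_measure_sigma_additive R S outer F) => //.
  by move=> n; exact: borel_caratheodory.
exact: borel_caratheodory.
Qed.

Let daniell_measure : {measure set (borel S) -> \bar R} :=
  HB.pack (outer : set (borel S) -> \bar R) (isMeasure.Build _ _ _ (outer : set (borel S) -> \bar R)
    outer0 outer_ge0 outer_semi_sigma_additive).

(** If the [u n] cover the whole space, then the [clamp (1 - u n)] decrease to [0],
    so that [L (u n)] is at least [1] in the limit: this is where continuity along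
    decreasing sequences enters. *)
Let outerT : outer setT = 1%E.
Proof.
apply/eqP; rewrite eq_le outer_le1/=.
apply: le_ereal_inf_tmp => _ [c [u [bu u0 uinc u1] uc] <-]; rewrite lee_fin.
pose v n x := clamp (1 - u n x).
have bv n : isBL (v n) by apply/isBL_clamp/isBLB => //; exact: isBL_cst.
have : L (v n) @[n --> \oo] --> 0.
  apply: (daniell_dec DL) => // [n x|x].
    by apply: le_clamp; rewrite lerB.
  apply/cvgrPdist_lt => e e0; have [n un] := u1 x I e e0.
  exists n => // m /= nm; rewrite sub0r normrN ger0_norm ?clamp_ge0//.
  have : u n x <= u m x by apply: (@covers_homo setT).
  have u0m := u0 m x; rewrite /v; have [h|h] := leP (1 - u m x) 0.
    by rewrite clamp_le0.
  by rewrite clamp_id; lra.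
move=> Lv; apply/ler_addgt0Pr => e e0.
move/cvgrPdist_lt : Lv => /(_ _ e0)[n _ /(_ n (leqnn n))].
rewrite sub0r normrN => /ltW /(le_trans (ler_norm _)) vn.
apply: (@le_trans _ _ (L (u n) + L (v n))); last by rewrite lerD.
rewrite -(daniellD DL)// -[leLHS](daniell1 DL); apply: leL => //.
- exact: isBL_cst.
- exact: isBLD.
- move=> x; rewrite /v; have [h|h] := leP (1 - u n x) 0.
    by rewrite clamp_le0//; lra.
  by have u0n := u0 n x; rewrite clamp_id; lra.
Qed.

Let daniell_law : M1 R S := @mkM1 R S daniell_measure outerT.

Lemma sum_clamp (y : R) n : 0 <= y ->
  \sum_(i < n) clamp (y - i%:R) = Num.min y n%:R.
Proof.
move=> y0; elim: n => [|n IH]; first by rewrite big_ord0 min_r.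
rewrite big_ord_recr /= IH -natr1.
have [h|h] := leP y n%:R; first by rewrite clamp_le0 ?subr_le0// addr0 min_l//; lra.
have [h'|h'] := leP y (n%:R + 1); first by rewrite clamp_id; lra.
by rewrite clamp_ge1//; lra.
Qed.

(** Layer-cake upper bound: [n * f] is the sum of the [clamp (n * f - i)], whose
    supports lie where the shifted [clamp (n * f - i + 1)] equal [1]; the shift
    costs [1 / n]. *)
Let daniell_int_le (f : S -> R) : isBL f -> (forall x, 0 <= f x <= 1) ->
  \int[daniell_law]_x f x <= L f.
Proof.
move=> bf f01; set rho := daniell_law.
have bm g : isBL g -> bmeas (g : borel S -> R) by move=> [? [? gBL]]; exact: BL_bmeas gBL.
suff H n : \int[rho]_x f x <= L f + n.+1%:R^-1.
  apply/ler_addgt0Pr => e e0.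
  have [n _ /(_ n (leqnn n)) ne] := near_infty_natSinv_lt (PosNum e0).
  by apply: le_trans (H n) _; rewrite lerD2l ltW.
set N : R := n.+1%:R; have N0 : 0 < N by rewrite ltr0n.
pose up (i : 'I_n.+1) x := clamp (N * f x - i%:R).
pose dn (i : 'I_n.+1) x := clamp (N * f x + 1 - i%:R).
have bNf : isBL (fun x => N * f x) by exact: isBLZ.
have bup i : isBL (up i) by apply/isBL_clamp/isBLB => //; exact: isBL_cst.
have bdn i : isBL (dn i).
  by apply/isBL_clamp/isBLB; [apply: isBLD => //|]; exact: isBL_cst.
have up_le i : \int[rho]_x up i x <= L (dn i).
  have oG : open [set x | 0 < N * f x - i%:R].
    have [C [K fBL]] : isBL (fun x => N * f x - i%:R).
      by apply: isBLB => //; exact: isBL_cst.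
    rewrite openE => x /= Gx; apply: (cvgr_gt _ (BL_continuous dS fBL (x := x))).
    exact: Gx.
  set G := [set x | _] in oG.
  have mG : measurable (G : set (borel S)) by exact: sub_sigma_algebra.
  apply: (@le_trans _ _ (\int[rho]_x \1_G x)).
    apply: le_Rint; [exact: bm|exact: bmeas_indic|move=> x].
    have [Gx|nGx] := pselect (G x); first by rewrite indicE mem_set// clamp_le1.
    by rewrite indicE memNset// /up clamp_le0// leNgt; apply/negP.
  rewrite Rint_indic// -lee_fin fineK ?fin_num_measure// mkM1E//=.
  apply: outer_le; exists (fun _ => dn i) => //.
  split=> // [_ x|x Gx e e0]; first exact: clamp_ge0.
  by exists 0%N; rewrite /dn clamp_ge1; [|move: Gx; rewrite /G/=]; lra.
have NfE x : N * f x = \sum_(i < n.+1) up i x.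
  rewrite sum_clamp; first by have /andP[? ?] := f01 x; rewrite min_l//; nra.
  by have /andP[? ?] := f01 x; nra.
have : N * \int[rho]_x f x <= L (fun x => N * f x + 1).
  rewrite -RintZ; last exact: bm.
  under eq_Rintegral do rewrite NfE.
  rewrite Rint_sum; last by move=> i; exact: bm.
  apply: (@le_trans _ _ (\sum_(i < n.+1) L (dn i))); first exact: ler_sum.
  rewrite -L_sum//; apply: leL; [exact: isBL_sum|by apply: isBLD => //; exact: isBL_cst|].
  move=> x; have /andP[? ?] := f01 x.
  by rewrite sum_clamp ?ge_min ?lexx//; nra.
rewrite (daniellD DL)//; last exact: isBL_cst.
rewrite (daniellZ DL)// (daniell1 DL) => h.
by rewrite -(ler_pM2l N0) mulrDr mulfV ?gt_eqF.
Qed.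

(** The bound [daniell_int_le] for [f] and for [1 - f] is an equality for [f] with
    values in the unit interval; an affine change of variable does the rest. *)
Lemma daniell_representation : exists rho : M1 R S,
  forall C K f, BL d C K f -> \int[rho]_x f x = L f.
Proof.
exists daniell_law => C K f fBL; set rho := daniell_law.
have bm g : isBL g -> bmeas (g : borel S -> R) by move=> [? [? gBL]]; exact: BL_bmeas gBL.
have bf : isBL f by exists C, K.
pose c := (2 * (`|C| + 1))^-1.
have c0 : 0 < c by rewrite invr_gt0; have := normr_ge0 C; lra.
have cC : c * (2 * (`|C| + 1)) = 1.
  by rewrite mulVf//; have := normr_ge0 C; lra.
pose g x := c * f x + 2^-1.
have g01 x : 0 <= g x <= 1.
  have := proj1 fBL x; have := ler_norm C; rewrite ler_norml /g => h1 /andP[h2 h3].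
  by apply/andP; split; nra.
have bcf : isBL (fun x => c * f x) by exact: isBLZ.
have bg : isBL g by apply: isBLD => //; exact: isBL_cst.
have b1g : isBL (fun x => 1 - g x) by apply: isBLB => //; exact: isBL_cst.
have gE : \int[rho]_x g x = L g.
  apply/eqP; rewrite eq_le daniell_int_le//=.
  have : \int[rho]_x (1 - g x) <= L (fun x => 1 - g x).
    by apply: daniell_int_le => // x; have := g01 x; lra.
  rewrite RintB; [|exact/bm/isBL_cst|exact: bm].
  by rewrite Rint_cst LB ?(daniell1 DL)//; [lra|exact: isBL_cst].
move: gE; rewrite /g RintD; [|exact: bm|exact/bm/isBL_cst].
rewrite (daniellD DL)//; last exact: isBL_cst.
have -> : L (fun=> 2^-1) = 2^-1.
  rewrite -[RHS]mulr1 -(daniell1 DL) -(daniellZ DL); last exact: isBL_cst.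
  by congr L; apply/funext => x; rewrite mulr1.
rewrite Rint_cst => /addIr; rewrite RintZ; last exact: bm.
rewrite (daniellZ DL)// => /mulfI; apply; exact: lt0r_neq0.
Qed.

End daniell.

(** * Increasing tuples against all tuples *)

Section tuples.
Context (R : realType) (n : nat).
Local Notation tup k := (k.-tuple 'I_n).

Lemma sum_tuple_cons k (F : tup k.+1 -> R) :
  \sum_t F t = \sum_x \sum_(t : tup k) F (cons_tuple x t).
Proof.
rewrite pair_big /= (reindex (fun p : 'I_n * tup k => cons_tuple p.1 p.2)) //=.
exists (fun t : tup k.+1 => (thead t, behead_tuple t)) => [[x t] _|t _] /=.
  by congr pair; apply: val_inj.
by rewrite [RHS]tuple_eta; apply: val_inj.
Qed.

(** the probability that [k] independent uniform positions are not distinct *)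
Definition collision k : R := 1 - (n ^_ k)%:R / (n ^ k)%:R.

Definition incr_avg k (Phi : tup k -> R) : R :=
  'C(n, k)%:R^-1 * \sum_(t : tup k | sorted ltn (map val t)) Phi t.

Definition all_avg k (Phi : tup k -> R) : R := (n ^ k)%:R^-1 * \sum_t Phi t.

Definition tsort k (t : tup k) : tup k := [tuple of sort (fun i j : 'I_n => (i <= j)%N) t].

Lemma tsortE k (t s : tup k) : perm_eq t s -> sorted ltn (map val s) -> tsort t = s.
Proof.
move=> ts ss; apply: val_inj => /=.
apply: (@sorted_eq _ (fun i j : 'I_n => (i <= j)%N)).
- by move=> b a c; exact: leq_trans.
- by move=> a b /andP[ab ba]; apply/val_inj/eqP; rewrite eqn_leq ab.
- by apply: sort_sorted => i j; exact: leq_total.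
- move: ss; rewrite sorted_map; apply: sub_sorted => i j; exact: ltnW.
- by rewrite perm_sort.
Qed.

Lemma sorted_tsort k (t : tup k) : uniq t -> sorted ltn (map val (tsort t)).
Proof.
move=> ut; rewrite ltn_sorted_uniq_leq map_inj_uniq ?sort_uniq; last exact: val_inj.
by rewrite ut sorted_map sort_sorted// => i j; exact: leq_total.
Qed.

Lemma card_perm_tuple k (s : tup k) : uniq s -> #|[pred t : tup k | perm_eq t s]| = k`!.
Proof.
move=> us; rewrite -[in RHS](size_tuple s) -size_permutations// cardE.
rewrite -(size_map val); apply: perm_size; apply: uniq_perm.
- by rewrite map_inj_uniq ?enum_uniq//; exact: val_inj.
- exact: permutations_uniq.
move=> u; rewrite mem_permutations; apply/mapP/idP => [[t]|us'].
  by rewrite mem_enum inE => ts ->.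
have su : size u == k by rewrite (perm_size us') size_tuple.
by exists (Tuple su) => //; rewrite mem_enum inE.
Qed.

Lemma sum_uniq_incr k (Phi : tup k -> R) :
  (forall t : tup k, uniq t -> Phi t = Phi (tsort t)) ->
  \sum_(t : tup k | uniq t) Phi t =
  k`!%:R * \sum_(t : tup k | sorted ltn (map val t)) Phi t.
Proof.
move=> sym; rewrite (partition_big (@tsort k) (fun t => sorted ltn (map val t)))/=;
  last by move=> t; exact: sorted_tsort.
rewrite mulr_sumr; apply: eq_bigr => s ss.
have us : uniq s.
  by move: ss; rewrite ltn_sorted_uniq_leq map_inj_uniq => [/andP[]//|]; exact: val_inj.
have E (t : tup k) : (uniq t && (tsort t == s)) = perm_eq t s.
  apply/andP/idP => [[_ /eqP <-]|ts]; first by rewrite perm_sym perm_sort.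
  by rewrite (perm_uniq ts) us (tsortE ts ss) eqxx.
rewrite (eq_bigl _ _ E) (eq_bigr (fun=> Phi s)); last first.
  move=> t ts; rewrite sym; last by rewrite (perm_uniq ts).
  by rewrite (tsortE ts ss).
by rewrite sumr_const -(card_perm_tuple us) mulr_natl; congr (_ *+ _); apply: eq_card.
Qed.

(** Each increasing tuple is the sorted form of [k!] tuples of distinct entries, so
    that a symmetric function has the same average over both kinds; the remaining
    tuples have weight [collision k]. *)
Lemma incr_avg_all_avg k (Phi : tup k -> R) C : (k <= n)%N -> (0 < n)%N ->
  (forall t : tup k, uniq t -> Phi t = Phi (tsort t)) -> (forall t, `|Phi t| <= C) ->
  `|incr_avg Phi - all_avg Phi| <= 2 * C * collision k.
Proof.
move=> kn n0 sym PhiC.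
have C0 : 0 <= C.
  have h : size (nseq k (Ordinal n0)) == k by rewrite size_nseq.
  by apply: le_trans (PhiC (Tuple h)).
have K0 : 0 < 'C(n, k)%:R :> R by rewrite ltr0n bin_gt0.
have N0 : 0 < (n ^ k)%:R :> R by rewrite ltr0n expn_gt0 n0.
set U := \sum_(t : tup k | sorted ltn (map val t)) Phi t.
set V := \sum_(t : tup k | ~~ uniq t) Phi t.
have allE : \sum_t Phi t = k`!%:R * U + V by rewrite -sum_uniq_incr// [LHS](bigID (fun t : tup k => uniq t)).
have ffE : (n ^_ k)%:R = k`!%:R * 'C(n, k)%:R :> R by rewrite -natrM mulnC bin_ffact.
have cardU : \sum_(t : tup k | sorted ltn (map val t)) (1 : R) = 'C(n, k)%:R.
  by rewrite sumr_const -card_ltn_sorted_tuples; congr (_ *+ _); apply: eq_card => t; rewrite inE.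
have cardV : \sum_(t : tup k | ~~ uniq t) (1 : R) = (n ^ k)%:R - (n ^_ k)%:R.
  rewrite ffE -cardU -sum_uniq_incr//.
  have -> : (n ^ k)%:R = \sum_(t : tup k | uniq t) (1 : R) +
      \sum_(t : tup k | ~~ uniq t) (1 : R).
    transitivity (\sum_(t : tup k) (1 : R)).
      by rewrite sumr_const card_tuple card_ord.
    by rewrite (bigID (fun t : tup k => uniq t)).
  by rewrite [RHS]addrC addKr.
have UC : `|U| <= C * 'C(n, k)%:R.
  rewrite -cardU mulr_sumr; apply: le_trans (ler_norm_sum _ _ _) _.
  by apply: ler_sum => t _; rewrite mulr1.
have VC : `|V| <= C * ((n ^ k)%:R - (n ^_ k)%:R).
  rewrite -cardV mulr_sumr; apply: le_trans (ler_norm_sum _ _ _) _.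
  by apply: ler_sum => t _; rewrite mulr1.
rewrite /incr_avg /all_avg allE -/U.
have -> : 'C(n, k)%:R^-1 * U - (n ^ k)%:R^-1 * (k`!%:R * U + V) =
    U / 'C(n, k)%:R * collision k - V / (n ^ k)%:R.
  by rewrite /collision ffE; field; rewrite !gt_eqF.
have -> : 2 * C * collision k = C * collision k + C * collision k by ring.
have c0 : 0 <= collision k.
  rewrite subr_ge0 ler_pdivrMr// mul1r ler_nat.
  have : (0 : R) <= (n ^ k)%:R - (n ^_ k)%:R by rewrite -cardV sumr_ge0.
  by rewrite subr_ge0 ler_nat.
apply: le_trans (ler_normB _ _) _; apply: lerD.
  rewrite normrM [X in _ * X]ger0_norm// ler_wpM2r// normrM normfV.
  by rewrite (ger0_norm (ltW K0)) ler_pdivrMr.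
rewrite normrM normfV (ger0_norm (ltW N0)) ler_pdivrMr//.
by apply: le_trans VC _; rewrite /collision -mulrA mulrBl mul1r divfK ?gt_eqF.
Qed.

(** The entry number [k] meets one of the previous ones with probability at most
    [k / n]. *)
Lemma collision_le k : (0 < n)%N -> collision k <= (k * k)%:R / n%:R.
Proof.
move=> n0; have N0 : 0 < n%:R :> R by rewrite ltr0n.
have r0 j : 0 <= (n ^_ j)%:R / (n ^ j)%:R :> R by rewrite divr_ge0.
have r1 j : (n ^_ j)%:R / (n ^ j)%:R <= 1 :> R.
  rewrite ler_pdivrMr ?ltr0n ?expn_gt0 ?n0// mul1r ler_nat.
  elim: j => // j IHj; rewrite ffactnSr expnSr.
  by rewrite leq_mul// leq_subr.
elim: k => [|k IH]; first by rewrite /collision ffactn0 expn0 divr1 subrr mul0r.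
have step : collision k.+1 <= collision k + k%:R / n%:R.
  rewrite /collision ffactnSr expnSr !natrM invfM mulrACA.
  have := r0 k; have := r1 k; set r := _ / _ => r1k r0k.
  have : 1 - k%:R / n%:R <= (n - k)%:R / n%:R :> R.
    rewrite ler_pdivlMr// mulrBl mul1r divfK ?gt_eqF// lerBlDr -natrD ler_nat.
    lia.
  have : 0 <= k%:R / n%:R :> R by rewrite divr_ge0.
  set q := (n - k)%:R / _; set c := k%:R / _ => c0 cq.
  have : r * (1 - c) <= r * q by apply: ler_wpM2l.
  have : r * c <= 1 * c by apply: ler_wpM2r.
  by lra.
apply: le_trans step _; apply: le_trans (lerD IH (lexx _)) _.
by rewrite -mulrDl ler_pM2r ?invr_gt0// -natrD ler_nat; lia.
Qed.

End tuples.

Lemma collision_ge0 (R : realType) n k : (0 < n)%N -> 0 <= collision R n k.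
Proof.
move=> n0; rewrite subr_ge0 ler_pdivrMr ?ltr0n ?expn_gt0 ?n0// mul1r ler_nat.
by elim: k => // k IH; rewrite ffactnSr expnSr leq_mul// leq_subr.
Qed.

Lemma collision_near0 (R : realType) k (e : R) : 0 < e ->
  \forall n \near \oo, collision R n k < e.
Proof.
move=> e0; near=> n.
have n0 : (0 < n)%N by near: n; exact: nbhs_infty_gt.
apply: le_lt_trans (collision_le R k n0) _.
rewrite ltr_pdivrMr ?ltr0n// mulrC -ltr_pdivrMr//.
by near: n; exact: nbhs_infty_gtr.
Unshelve. all: by end_near. Qed.

Section moments.
Context (R : realType) (n : nat) (a : 'I_n -> 'I_n -> R).
Hypotheses (a0 : forall y, \sum_x a x y = 0) (a1 : forall x y, `|a x y| <= 1).

Let U (t : seq 'I_n) y := \sum_(x <- t) a x y.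

Let sqr1 x y : a x y ^+ 2 <= 1.
Proof. by rewrite -real_normK ?num_real// exprn_ile1. Qed.

Let step (c : R) y : \sum_x (a x y + c) ^+ 2 <= n%:R + n%:R * c ^+ 2.
Proof.
rewrite (eq_bigr (fun x => a x y ^+ 2 + (2 * c) * a x y + c ^+ 2)); last first.
  by move=> x _; ring.
rewrite !big_split /= -mulr_sumr a0 mulr0 addr0.
rewrite sumr_const card_ord -[_ *+ n]mulr_natl lerD2r.
apply: (@le_trans _ _ (\sum_(x < n) 1)); first exact: ler_sum.
by rewrite sumr_const card_ord.
Qed.

Let second_moment_one k y : \sum_(t : k.-tuple 'I_n) U t y ^+ 2 <= k%:R * (n ^ k)%:R.
Proof.
elim: k => [|k IH].
  by rewrite mul0r big1// => t _; rewrite (tuple0 t) /U big_nil expr0n.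
rewrite sum_tuple_cons exchange_big/=.
apply: (@le_trans _ _ (\sum_(t : k.-tuple 'I_n) (n%:R + n%:R * U t y ^+ 2))).
  by apply: ler_sum => t _; rewrite /U; under eq_bigr do rewrite big_cons; exact: step.
rewrite big_split /= -mulr_sumr sumr_const card_tuple card_ord.
rewrite -[_ *+ (n ^ k)]mulr_natr -natrM -expnS.
have -> : k.+1%:R * (n ^ k.+1)%:R = (n ^ k.+1)%:R + n%:R * (k%:R * (n ^ k)%:R) :> R.
  by rewrite expnS !natrM -natr1; ring.
by rewrite lerD2l ler_wpM2l.
Qed.

(** One more entry [x] of the sample adds a centred variable [a x y] to the sum at
    [y], whose second moment thus grows by [1] only. The term where [x] is [y]
    itself is not centred, and is set apart by [(b + c) ^+ 2 <= 2 * b ^+ 2 + 2 * c ^+ 2]. *)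
Lemma second_moment k :
  \sum_(t : k.-tuple 'I_n) \sum_(y <- t) (\sum_(x <- t) a x y) ^+ 2
  <= 2 * (k * k)%:R * (n ^ k)%:R.
Proof.
elim: k => [|k IH].
  by rewrite mulr0 mul0r big1// => t _; rewrite (tuple0 t) big_nil.
rewrite sum_tuple_cons.
under eq_bigr do under eq_bigr do rewrite big_cons.
under eq_bigr do rewrite big_split/=.
rewrite big_split/=.
(* the sum at the new entry *)
have h1 : \sum_x \sum_(t : k.-tuple 'I_n) U (x :: t) x ^+ 2 <=
    2 * (n ^ k.+1)%:R + 2 * k%:R * (n ^ k.+1)%:R.
  apply: (@le_trans _ _ (\sum_(x < n) (2 * (n ^ k)%:R + 2 * (k%:R * (n ^ k)%:R)))).
    apply: ler_sum => x _.
    apply: (@le_trans _ _ (\sum_(t : k.-tuple 'I_n) (2 + 2 * U t x ^+ 2))).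
      apply: ler_sum => t _; rewrite /U big_cons -/(U t x).
      by have := sqr1 x x; have := sqr_ge0 (a x x - U t x); rewrite !expr2; lra.
    rewrite big_split /= -mulr_sumr sumr_const card_tuple card_ord -[_ *+ _]mulr_natr.
    by rewrite lerD2l ler_pM2l//; exact: second_moment_one.
  rewrite sumr_const card_ord -[_ *+ n]mulr_natl expnS natrM.
  by lra.
(* the sums at the previous entries *)
have h2 : \sum_x \sum_(t : k.-tuple 'I_n) \sum_(y <- t) U (x :: t) y ^+ 2 <=
    k%:R * (n ^ k.+1)%:R + 2 * (k * k)%:R * (n ^ k.+1)%:R.
  rewrite exchange_big/=.
  apply: (@le_trans _ _ (\sum_(t : k.-tuple 'I_n)
      (n%:R * k%:R + n%:R * \sum_(y <- t) U t y ^+ 2))).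
    apply: ler_sum => t _; rewrite exchange_big/=.
    apply: (@le_trans _ _ (\sum_(y <- t) (n%:R + n%:R * U t y ^+ 2))).
      by apply: ler_sum => y _; rewrite /U; under eq_bigr do rewrite big_cons; exact: step.
    rewrite big_split/= -mulr_sumr lerD2r big_const_seq count_predT size_tuple.
    by rewrite iter_addr_0 mulr_natr.
  rewrite big_split /= -!mulr_sumr sumr_const card_tuple card_ord -[_ *+ (n ^ k)]mulr_natr.
  have -> : n%:R * (k%:R * (n ^ k)%:R) = k%:R * (n ^ k.+1)%:R :> R.
    by rewrite expnS natrM; ring.
  rewrite lerD2l; apply: le_trans (ler_wpM2l _ IH) _ => //.
  by rewrite expnS natrM; lra.
apply: le_trans (lerD h1 h2) _.
rewrite -!mulrDl ler_wpM2r//.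
have -> : 2 + 2 * k%:R + (k%:R + 2 * (k * k)%:R) = (2 + 3 * k + 2 * (k * k))%:R :> R.
  by rewrite !natrD !natrM; ring.
by rewrite -natrM ler_nat; lia.
Qed.

End moments.

(** * Ranks in a random subsequence against positions in the word *)

Section ranks.
Context (R : realType) (m : nat).
Local Notation tup k := (k.-tuple 'I_m).

Lemma all_avg_mean k (g : 'I_m -> R) : (0 < m)%N -> (0 < k)%N ->
  all_avg (fun t : tup k => k%:R^-1 * \sum_(y <- t) g y) = m%:R^-1 * \sum_y g y.
Proof.
move=> m0 k0; have M0 : m%:R != 0 :> R by rewrite pnatr_eq0 -lt0n.
have sumE : m%:R * \sum_(t : tup k) \sum_(y <- t) g y = k%:R * (m ^ k)%:R * \sum_y g y.
  elim: k {k0} => [|k IH].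
    by rewrite mul0r mul0r big1 ?mulr0// => t _; rewrite (tuple0 t) big_nil.
  rewrite sum_tuple_cons.
  under eq_bigr do under eq_bigr do rewrite big_cons.
  under eq_bigr do rewrite big_split/= sumr_const card_tuple card_ord.
  rewrite big_split/= sumr_const card_ord sumrMnl mulrDr.
  rewrite -[X in _ + m%:R * X]mulr_natl IH -[_ *+ (m ^ k)]mulr_natl.
  rewrite expnS natrM -natr1; ring.
rewrite /all_avg -mulr_sumr.
have K0 : k%:R != 0 :> R by rewrite pnatr_eq0 -lt0n.
have N0 : (m ^ k)%:R != 0 :> R by rewrite pnatr_eq0 -lt0n expn_gt0 m0.
apply: (mulfI M0); rewrite mulrCA [X in _ * X]mulrCA sumE.
by field; rewrite M0 K0 N0.
Qed.

Variables (f : 'I_m -> R -> R) (C L : R).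
Hypotheses (fC : forall y x, `|f y x| <= C)
  (fL : forall y x x', `|f y x - f y x'| <= L * `|x - x'|) (L0 : 0 <= L).

(** the average of [f] over a sample, each letter being placed at its rank *)
Let rank_mean k (t : tup k) : R :=
  k%:R^-1 * \sum_(y <- t) f y ((count (fun z : 'I_m => (z <= y)%N) t)%:R / k%:R).

Let rank_mean_sorted k (t : tup k) : sorted ltn (map val t) ->
  rank_mean t = k%:R^-1 * \sum_(i < k) f (tnth t i) (i.+1%:R / k%:R).
Proof.
move=> st; rewrite /rank_mean big_tuple; congr (_ * _); apply: eq_bigr => i _.
congr (f _ (_%:R / _)); rewrite -sum1_count big_tuple.
have mono (j l : 'I_k) : (j < l)%N -> (tnth t j < tnth t l)%N.
  move=> jl; have := sorted_ltn_nth ltn_trans 0%N st.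
  move=> /(_ j l); rewrite !inE !size_map !size_tuple !ltn_ord => /(_ isT isT jl).
  by rewrite !(nth_map (tnth t i)) ?size_tuple// -!tnth_nth.
have le_tnth (j : 'I_k) : (tnth t j <= tnth t i)%N = (j < i.+1)%N.
  rewrite ltnS; have [ji|ij|ji] := ltngtP j i.
  - by rewrite ltnW// mono.
  - by apply/negbTE; rewrite -ltnNge mono.
  - by rewrite (val_inj ji) leqnn.
rewrite (eq_bigl _ _ le_tnth) (big_ord_narrow (ltn_ord i)).
by rewrite sum_nat_const card_ord muln1.
Qed.

Let rank_mean_perm k (t s : tup k) : perm_eq t s -> rank_mean t = rank_mean s.
Proof.
move=> ts; rewrite /rank_mean (perm_big _ ts)/=; congr (_ * _).
by apply: eq_bigr => y _; rewrite (seq.permP ts).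
Qed.

Let norm_rank_mean k (t : tup k) : (0 < k)%N -> `|rank_mean t| <= C.
Proof.
move=> k0; rewrite /rank_mean normrM normfV normr_nat ler_pdivrMl ?ltr0n//.
apply: le_trans (ler_norm_sum _ _ _) _; rewrite big_tuple.
apply: (@le_trans _ _ (\sum_(i < k) C)); first exact: ler_sum.
by rewrite sumr_const card_ord mulr_natl.
Qed.

(** The placement of a letter at its rank differs from its placement at its
    position in the word by a centred count, whose square has mean of order
    [1 / k]; [|u| <= eta + u ^+ 2 / eta] turns this into a bound on the mean. *)
Let rank_mean_all k eta : (0 < m)%N -> (0 < k)%N -> 0 < eta ->
  `|all_avg (@rank_mean k) - m%:R^-1 * \sum_y f y (y.+1%:R / m%:R)|
    <= L * (eta + 2 / (k%:R * eta)).
Proof.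
move=> m0 k0 eta0.
have M0 : 0 < m%:R :> R by rewrite ltr0n.
have K0 : 0 < k%:R :> R by rewrite ltr0n.
have N0 : 0 < (m ^ k)%:R :> R by rewrite ltr0n expn_gt0 m0.
pose a (x y : 'I_m) : R := (x <= y)%N%:R - y.+1%:R / m%:R.
have a0 y : \sum_x a x y = 0.
  rewrite sumrB sumr_const card_ord -[X in _ - X]mulr_natr divfK ?gt_eqF//.
  rewrite -natr_sum (_ : (\sum_i _)%N = y.+1) ?subrr//.
  rewrite -big_mkcond/= (big_ord_narrow (ltn_ord y)).
  by rewrite sum_nat_const card_ord muln1.
have a1 x y : `|a x y| <= 1.
  have : y.+1%:R / m%:R <= 1 :> R by rewrite ler_pdivrMr// mul1r ler_nat.
  have : 0 <= y.+1%:R / m%:R :> R by rewrite divr_ge0.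
  by rewrite /a ler_norml; case: (x <= y)%N => /=; lra.
rewrite -(all_avg_mean (fun y => f y (y.+1%:R / m%:R)) m0 k0) /all_avg -mulrBr -sumrB.
rewrite normrM normfV (ger0_norm (ltW N0)) ler_pdivrMl//.
apply: le_trans (ler_norm_sum _ _ _) _.
pose V (t : tup k) := \sum_(y <- t) (\sum_(x <- t) a x y) ^+ 2.
apply: (@le_trans _ _ (\sum_(t : tup k) (L * eta + L / (k%:R ^+ 3 * eta) * V t))).
  apply: ler_sum => t _; rewrite /rank_mean -mulrBr -sumrB.
  rewrite normrM normfV normr_nat ler_pdivrMl//.
  apply: le_trans (ler_norm_sum _ _ _) _.
  have -> : k%:R * (L * eta + L / (k%:R ^+ 3 * eta) * V t) =
      \sum_(y <- t) (L * eta + L / (k%:R ^+ 2 * eta) * (\sum_(x <- t) a x y) ^+ 2).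
    rewrite big_split/= -!mulr_sumr big_const_seq count_predT size_tuple iter_addr_0.
    by rewrite -/(V t) -[eta *+ k]mulr_natl; field; rewrite !gt_eqF.
  apply: ler_sum => y _.
  set u := \sum_(x <- t) a x y.
  have uE : (count (fun z : 'I_m => (z <= y)%N) t)%:R / k%:R - y.+1%:R / m%:R = u / k%:R.
    rewrite /u sumrB big_const_seq count_predT size_tuple iter_addr_0.
    rewrite -natr_sum -sum1_count big_mkcond/= -[y.+1%:R / m%:R *+ k]mulr_natr.
    by field; rewrite !gt_eqF.
  apply: le_trans (fL _ _ _) _; rewrite uE.
  have -> : L * eta + L / (k%:R ^+ 2 * eta) * u ^+ 2 = L * (eta + (u / k%:R) ^+ 2 / eta).
    by field; rewrite !gt_eqF.
  rewrite ler_wpM2l//; set v := u / _.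
  have -> : eta + v ^+ 2 / eta = (eta ^+ 2 + `|v| ^+ 2) / eta.
    by rewrite real_normK ?num_real//; field; rewrite gt_eqF.
  rewrite ler_pdivlMr//; have := sqr_ge0 (`|v| - eta).
  by have := mulr_ge0 (normr_ge0 v) (ltW eta0); rewrite !expr2; lra.
rewrite big_split/= -!mulr_sumr sumr_const card_tuple card_ord -[eta *+ (m ^ k)]mulr_natl.
rewrite [leRHS](_ : _ = L * ((m ^ k)%:R * eta) +
    L / (k%:R ^+ 3 * eta) * (2 * (k * k)%:R * (m ^ k)%:R)); last first.
  by rewrite natrM; field; rewrite !gt_eqF.
rewrite lerD2l ler_wpM2l//; last exact: second_moment.
by rewrite divr_ge0// mulr_ge0// ltW.
Qed.

(** In an increasing tuple the entry number [i] has rank [i.+1], and the mean by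
    ranks is a symmetric function of the sample: increasing tuples may therefore
    be replaced by samples of independent positions. *)
Lemma incr_avg_rank k eta : (0 < k <= m)%N -> 0 < eta ->
  `|m%:R^-1 * \sum_y f y (y.+1%:R / m%:R) -
    incr_avg (fun t : tup k => k%:R^-1 * \sum_(i < k) f (tnth t i) (i.+1%:R / k%:R))|
  <= L * (eta + 2 / (k%:R * eta)) + 2 * C * collision R m k.
Proof.
move=> /andP[k0 km] eta0; have m0 := leq_trans k0 km.
have -> : incr_avg (fun t : tup k =>
    k%:R^-1 * \sum_(i < k) f (tnth t i) (i.+1%:R / k%:R)) = incr_avg (@rank_mean k).
  by rewrite /incr_avg; congr (_ * _); apply: eq_bigr => t /rank_mean_sorted.
have h1 := rank_mean_all m0 k0 eta0.
have h2 : `|incr_avg (@rank_mean k) - all_avg (@rank_mean k)| <= 2 * C * collision R m k.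
  apply: incr_avg_all_avg => // [t _|t]; last exact: norm_rank_mean.
  by apply: rank_mean_perm; rewrite perm_sym perm_sort.
rewrite distrC; apply: le_trans (lerD h1 h2).
by rewrite [leRHS]addrC; exact: ler_distD.
Qed.

End ranks.

(** * Integrals against the laws attached to a word *)

Section word_integrals.
Context (R : realType) (A : ptopologicalType).

Lemma Rint_rho n (w : 'rV[A]_n.+1) (f : A * R -> R) :
  bmeas (f : borel (A * R)%type -> R) ->
  \int[rho_ R w]_z f z = n.+1%:R^-1 * \sum_(j < n.+1) f (position R w j).
Proof.
move=> bf; rewrite (Rint_mixture (Q := predT) (c := n.+1%:R^-1)
  (P_ := fun j => \d_(position R w j : borel (A * R)%type))) ?invr_ge0//.
  congr (_ * _); apply: eq_bigr => j _.
  rewrite /Rintegral integral_dirac//; last by apply/measurable_EFinP; case: bf.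
  by rewrite diracT mul1e.
by move=> B mB; rewrite rhoE.
Qed.

Lemma Rint_RSS n (w : 'rV[A]_n) k (F : 'rV[A]_k -> R) : (k <= n)%N ->
  bmeas (F : borel 'rV[A]_k -> R) ->
  \int[RSS R w k]_v F v = incr_avg (fun t => F (subword w t)).
Proof.
move=> kn bF; rewrite (Rint_mixture (c := 'C(n, k)%:R^-1)
  (Q := fun t : k.-tuple 'I_n => sorted ltn (map val t))
  (P_ := fun t : k.-tuple 'I_n => \d_(subword w t : borel 'rV[A]_k))) ?invr_ge0//.
  congr (_ * _); apply: eq_bigr => t _.
  rewrite /Rintegral integral_dirac//; last by apply/measurable_EFinP; case: bF.
  by rewrite diracT mul1e.
by move=> B mB; rewrite RSSE.
Qed.

Lemma position_continuous n (j : 'I_n.+1) :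
  continuous (fun v : 'rV[A]_n.+1 => position R v j).
Proof.
move=> v; apply: (@cvg_pair _ _ _ (nbhs v) (nbhs (v 0 j : A))
  (nbhs (j.+1%:R / n.+1%:R : R))); [exact: row_coord_continuous|exact: cvg_cst].
Qed.

Lemma Rint_PosSam n (mu : M1 R 'rV[A]_n.+1) (f : A * R -> R) :
  bmeas (f : borel (A * R)%type -> R) ->
  \int[PosSam mu]_z f z =
    \int[mu]_v (n.+1%:R^-1 * \sum_(j < n.+1) f (position R v j)).
Proof.
move=> bf.
have mpos (j : 'I_n.+1) : measurable_fun setT
    ((fun v => position R v j) : borel 'rV[A]_n.+1 -> borel (A * R)%type).
  exact: continuous_borel_measurable (@position_continuous n j).
pose X j : {mfun (borel 'rV[A]_n.+1) >-> (borel (A * R)%type)} :=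
  MeasurableFun.Pack (MeasurableFun.Class (isMeasurableFun.Build _ _ _ _ _ (mpos j))).
have bfj j : bmeas ((fun v => f (position R v j)) : borel 'rV[A]_n.+1 -> R).
  exact: (bmeas_comp (mpos j) bf).
rewrite (Rint_mixture (Q := predT) (c := n.+1%:R^-1)
  (P_ := fun j => distribution mu (X j))) ?invr_ge0//.
  rewrite RintZ; last exact: bmeas_sum.
  rewrite Rint_sum//; congr (_ * _); apply: eq_bigr => j _.
  exact: (Rint_image (mpos j)).
move=> B mB; rewrite mkM1E//= /PosSam_fun.
under eq_integral do rewrite rhoE//.
have mB' j : measurable_fun setT ((fun v => \d_(position R v j : borel (A * R)%type) B)
    : borel 'rV[A]_n.+1 -> \bar R).
  apply: (@measurableT_comp _ _ _ _ _ _
    (fun p : borel (A * R)%type => \d_p B : \bar R)) (mpos j).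
  exact: measurable_fun_dirac.
rewrite ge0_integralZl//; [|exact: emeasurable_sum|by move=> v _; exact: sume_ge0].
congr (_ * _)%E; rewrite ge0_integral_sum//.
apply: eq_bigr => j _; rewrite /distribution /pushforward /=.
have mB'' : measurable ((fun v => position R v j) @^-1` B : set (borel 'rV[A]_n.+1)).
  by rewrite -[X in measurable X]setTI; exact: (mpos j measurableT _ mB).
by rewrite -[X in _ = mu X]setIT -integral_indic.
Qed.

(** Only the dependence on the position matters to the comparison of ranks with
    positions, and a function of the letter alone has [L = 0]. *)
Definition pos_lip (f : A * R -> R) C L :=
  (forall z, `|f z| <= C) /\ forall a x x', `|f (a, x) - f (a, x')| <= L * `|x - x'|.

(** In a random subsequence, a letter is placed at its rank, which is close to its
    position in the word by [incr_avg_rank]. The bound depends on the word through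
    its length only. *)
Lemma rho_PosSam_RSS n (w : 'rV[A]_n.+1) k (f : A * R -> R) C L eta :
  bmeas (f : borel (A * R)%type -> R) -> pos_lip f C L -> 0 <= L ->
  (k <= n)%N -> 0 < eta ->
  `|\int[rho_ R w]_z f z - \int[PosSam (RSS R w k.+1)]_z f z| <=
    L * (eta + 2 / (k.+1%:R * eta)) + 2 * C * collision R n.+1 k.+1.
Proof.
move=> bf [fC fL] L0 kn eta0.
have bj (j : 'I_k.+1) : bmeas ((fun v => f (position R v j)) : borel 'rV[A]_k.+1 -> R).
  apply: (bmeas_comp _ bf).
  exact: continuous_borel_measurable (@position_continuous k j).
rewrite Rint_rho// Rint_PosSam// Rint_RSS//; last by apply/bmeasZ/bmeas_sum.
have := @incr_avg_rank R n.+1 (fun y x => f (w 0 y, x)) C L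
  (fun y x => fC _) (fun y => fL _) L0 k.+1 eta kn eta0.
congr (_ <= _); congr (`| _ - _ |).
rewrite /incr_avg; congr (_ * _); apply: eq_bigr => t _; congr (_ * _).
by apply: eq_bigr => i _; rewrite /position mxE.
Qed.

End word_integrals.

(** * Weak convergence of product laws *)

Section iid_convergence.
Context (R : realType) (S : ptopologicalType) (d : S -> S -> R).
Hypothesis dS : metrizes d.
Variable x : nat -> S.
Hypothesis x_dense : forall s e, 0 < e -> exists i, d s (x i) < e.

Lemma metrizable_second_countable : @second_countable S.
Proof.
pose b (p : nat * nat) : set S := [set y | d (x p.1) y < p.2.+1%:R^-1].
exists (range b); first exact: (sub_countable (card_image_le _ _) (countableP _)).
split=> [_ [p _ <-]|s U /(metric_nbhs dS)[e e0 eU]].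
  rewrite openE => y /= xy; apply/(metric_nbhs dS); exists (p.2.+1%:R^-1 - d (x p.1) y).
    by rewrite subr_gt0.
  by move=> z /=; rewrite ltrBrDl; apply: le_lt_trans; exact: metric_triangle.
have e2 : 0 < e / 2 by rewrite divr_gt0.
have [n _ /(_ n (leqnn n)) ne'] := near_infty_natSinv_lt (PosNum e2).
have ne : n.+1%:R^-1 < e / 2 := ne'.
have [i si] := @x_dense s n.+1%:R^-1 (ltac:(by rewrite invr_gt0)).
exists (b (i, n)); first by split; [exists (i, n)|rewrite /b/= (metricC dS)].
move=> z /= iz; apply: eU => /=; apply: le_lt_trans (metric_triangle dS s (x i) z) _.
by rewrite [ltRHS]splitr ltrD// (lt_trans _ ne).
Qed.

Definition dist_tuple k (s t : k.-tuple S) := \sum_(i < k) d (tnth s i) (tnth t i).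

Lemma dist_tuple_cons k s (t t' : k.-tuple S) :
  dist_tuple (cons_tuple s t) (cons_tuple s t') = dist_tuple t t'.
Proof.
rewrite /dist_tuple big_ord_recl !tnth0 metric_refl// add0r.
by apply: eq_bigr => i _; rewrite !tnthS.
Qed.

Lemma dist_tuple_head k s s' (t : k.-tuple S) :
  dist_tuple (cons_tuple s t) (cons_tuple s' t) = d s s'.
Proof.
rewrite /dist_tuple big_ord_recl !tnth0 big1 ?addr0// => i _.
by rewrite !tnthS metric_refl.
Qed.

(** Tuples carry the product sigma-algebra, rows the Borel one; on rows over a
    second countable space a continuous function is measurable for both. *)
Lemma BL_tuple_bmeas k C L (Phi : k.-tuple S -> R) : BL (@dist_tuple k) C L Phi ->
  bmeas (Phi : k.-tuple (borel S) -> R).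
Proof.
move=> [PC PL]; pose row (t : k.-tuple (borel S)) : 'rV[S]_k := \row_i tnth t i.
have mrow : measurable_fun setT (row : _ -> borel 'rV[S]_k).
  apply: measurable_row; first exact: metrizable_second_countable.
  move=> i; rewrite (_ : (fun t => _) = (fun t => tnth t i)); first exact: measurable_tnth.
  by apply/funext => t; rewrite mxE.
pose Psi (v : 'rV[S]_k) := Phi [tuple v 0 i | i < k].
have PsiBL : BL (@dist_row _ _ d k) C L Psi.
  split=> [v|v w]; first exact: PC.
  apply: le_trans (PL _ _) _; rewrite /dist_tuple /dist_row.
  by under eq_bigr do rewrite !tnth_mktuple.
have := bmeas_comp mrow (BL_bmeas (metrizes_row dS k) PsiBL).
congr bmeas; apply/funext => t; congr Phi.
by apply: eq_from_tnth => i; rewrite tnth_mktuple mxE.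
Qed.

Lemma Rint_iidS (P : probability (borel S) R) k (Phi : k.+1.-tuple (borel S) -> R) :
  bmeas Phi ->
  \int[iid P k.+1]_z Phi z = \int[P]_s \int[iid P k]_t Phi (cons_tuple s t) /\
  \int[iid P k.+1]_z Phi z = \int[iid P k]_t \int[P]_s Phi (cons_tuple s t).
Proof.
move=> bPhi.
have b : bmeas (fun p => Phi (tcons p)) by apply: bmeas_comp bPhi; exact: measurable_tcons.
have E p : Phi (tcons p) = Phi (cons_tuple p.1 p.2).
  by congr Phi; apply: val_inj.
have [E1 E2] := Rint_fubini P (iid P k) b.
have -> : \int[iid P k.+1]_z Phi z = \int[(P \x iid P k)%E]_p Phi (tcons p).
  exact: (Rint_image (@measurable_tcons _ _ k)).
split; [rewrite E1|rewrite E2]; apply: eq_Rintegral => s _;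
  by apply: eq_Rintegral => t _; rewrite E.
Qed.

(** Fubini, and the uniformity over the bounded Lipschitz ball, which is kept by
    the partial integrals, give the induction on the number of factors. *)
Lemma iid_near (X : Type) (F : set_system X) {FF : Filter F}
    (nu : X -> M1 R S) (mu : M1 R S) k (C L e : R) :
  nu y @[y --> F] --> mu -> 0 <= C -> 0 <= L -> 0 < e ->
  \forall y \near F, forall Phi, BL (@dist_tuple k) C L Phi ->
    `|\int[iid (nu y) k]_z Phi z - \int[iid mu k]_z Phi z| <= e.
Proof.
move=> c C0 L0; elim: k e => [|k IH] e e0.
  by apply: nearW => y Phi _; rewrite subrr normr0 ltW.
have e2 : 0 < e / 2 by rewrite divr_gt0.
apply: filterS2 (IH _ e2) (BL_near dS x_dense c C0 L0 e2) => y {}IH yBL Phi PhiBL.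
have bPhi := BL_tuple_bmeas PhiBL; have [PC PL] := PhiBL.
have tailBL s : BL (@dist_tuple k) C L (fun t => Phi (cons_tuple s t)).
  by split=> [t|t t']; [exact: PC|rewrite -(dist_tuple_cons s); exact: PL].
have headBL t : BL d C L (fun s => Phi (cons_tuple s t)).
  by split=> [s|s s']; [exact: PC|rewrite -(dist_tuple_head s s' t); exact: PL].
have btail s := BL_tuple_bmeas (tailBL s).
have intBL (Q : probability (k.-tuple (borel S)) R) :
    BL d C L (fun s => \int[Q]_t Phi (cons_tuple s t)).
  split=> [s|s s']; first exact: norm_Rint_le.
  rewrite -RintB//; apply: norm_Rint_le; first exact: bmeasB.
  by move=> t; have [_] := headBL t; apply.
have bint Q := BL_bmeas dS (intBL Q).
rewrite (Rint_iidS (nu y) bPhi).1 (Rint_iidS mu bPhi).1.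
have h2 := yBL _ (intBL (iid mu k)).
have h1 : `|\int[nu y]_s \int[iid (nu y) k]_t Phi (cons_tuple s t) -
    \int[nu y]_s \int[iid mu k]_t Phi (cons_tuple s t)| <= e / 2.
  rewrite -RintB; [|exact: bint|exact: bint].
  apply: norm_Rint_le => [|s]; first by apply: bmeasB; exact: bint.
  exact: IH.
by rewrite [e]splitr; apply: le_trans (lerD h1 h2); exact: ler_distD.
Qed.

Lemma iid_cvg (X : Type) (F : set_system X) {FF : Filter F}
    (nu : X -> M1 R S) (mu : M1 R S) k C L (Phi : k.-tuple S -> R) :
  nu y @[y --> F] --> mu -> BL (@dist_tuple k) C L Phi ->
  \int[iid (nu y) k]_z Phi z @[y --> F] --> \int[iid mu k]_z Phi z.
Proof.
move=> c PhiBL; apply/cvgrPdist_le => e e0.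
have near_BL := @iid_near X F FF nu mu k _ _ e c (normr_ge0 C) (normr_ge0 L) e0.
apply: filterS near_BL => y; rewrite distrC; apply.
have [PC PL] := PhiBL; split=> [z|z z']; first by apply: le_trans (PC z) (ler_norm _).
apply: le_trans (PL z z') _; rewrite ler_wpM2r ?ler_norm//.
by apply: sumr_ge0 => i _; exact: metric_ge0.
Qed.

(** Integrating the first of the two variables alone already gives the bound; the
    induction brings it to the front. *)
Lemma iid_pair_le (P : probability (borel S) R) k (h : S -> S -> R) c (i j : 'I_k) :
  (i < j)%N -> (forall (k' : nat) (i' j' : 'I_k'),
    bmeas (fun z : k'.-tuple (borel S) => h (tnth z i') (tnth z j'))) ->
  (forall t, \int[P]_s h s t <= c) ->
  \int[iid P k]_z h (tnth z i) (tnth z j) <= c.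
Proof.
move=> + bh hc; elim: k i j => [[]//|k IH i j ij].
have [E1 E2] := Rint_iidS P (bh _ i j).
case: (unliftP ord0 i) (E1) (E2) ij => [i' ->|->]; case: (unliftP ord0 j) => [j' ->|->] //.
- move=> -> _; rewrite ltnS => ij.
  under eq_Rintegral do under eq_Rintegral do rewrite !tnthS.
  by rewrite Rint_cst; exact: IH.
- move=> _ -> _.
  under eq_Rintegral do under eq_Rintegral do rewrite tnthS tnth0.
  apply: Rint_le_cst => //.
  have bswap : bmeas (fun p : k.-tuple (borel S) * borel S => h p.2 (tnth p.1 j')).
    have mswap : measurable_fun setT (fun p : k.-tuple (borel S) * borel S =>
        tcons (p.2, p.1)).
      by apply: measurableT_comp; [exact: measurable_tcons|exact: measurable_swap].
    have := bmeas_comp mswap (bh _ ord0 (lift ord0 j')).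
    congr bmeas; apply/funext => p.
    have -> : tcons (p.2, p.1) = cons_tuple p.2 p.1 by exact: val_inj.
    by rewrite tnth0 tnthS.
  exact: (bmeas_fubini P bswap).
Qed.

End iid_convergence.

(** * Sampling and sorting *)

Section ios_continuity.
Context (R : realType) (A : polishType R) (d : A -> A -> R).
Hypothesis dA : metrizes d.
Local Notation S := (A * R)%type.
Local Notation dtup k := (@dist_tuple R S (dist_pos d) k).

Lemma Rint_IOS k (rho : M1 R S) (F : 'rV[A]_k -> R) :
  bmeas (F : borel 'rV[A]_k -> R) ->
  \int[IOS k rho]_v F v = \int[iid rho k]_z F (@ios_tuple R A k z).
Proof.
move=> bF; apply: (Rint_image (@measurable_ios R A k)) => // B mB.
by rewrite mkM1E.
Qed.

Section cutoff.
Variables (k : nat) (delta : R).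
Hypothesis delta0 : 0 < delta.

(** [1] if the positions are within [delta], and [0] from [2 * delta] on *)
Definition close (p q : S) : R := clamp (2 - delta^-1 * `|p.2 - q.2|).

Definition close_pairs (z : k.-tuple S) : R :=
  \sum_(i < k) \sum_(j < k | (i < j)%N) close (tnth z i) (tnth z j).

(** a Lipschitz cutoff, which vanishes on the samples with two positions within
    [delta] *)
Definition spread (z : k.-tuple S) : R := clamp (1 - close_pairs z).

Lemma close_dist (p q p' q' : S) :
  `|close p q - close p' q'| <= delta^-1 * (`|p.2 - p'.2| + `|q.2 - q'.2|).
Proof.
apply: le_trans (norm_clampB _ _) _.
have -> : 2 - delta^-1 * `|p.2 - q.2| - (2 - delta^-1 * `|p'.2 - q'.2|) =
  delta^-1 * (`|p'.2 - q'.2| - `|p.2 - q.2|) by ring.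
rewrite normrM gtr0_norm ?invr_gt0// ler_pM2l ?invr_gt0//.
apply: le_trans (ler_dist_dist _ _) _.
have -> : p'.2 - q'.2 - (p.2 - q.2) = (p'.2 - p.2) - (q'.2 - q.2) by ring.
by apply: le_trans (ler_normB _ _) _; rewrite lerD// distrC.
Qed.

Lemma close_BL q : BL (dist_pos d) 1 delta^-1 (fun p => close p q).
Proof.
split=> [p|p p']; first exact: norm_clamp.
apply: le_trans (close_dist _ _ _ _) _; rewrite subrr normr0 addr0.
by rewrite ler_pM2l ?invr_gt0// /dist_pos lerDr; exact: metric_ge0 dA _ _.
Qed.

Lemma le_dist_tuple_snd (z z' : k.-tuple S) i :
  `|(tnth z i).2 - (tnth z' i).2| <= dtup k z z'.
Proof.
rewrite /dist_tuple (bigD1 i)//= -[leLHS]addr0 lerD//; last first.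
  by apply: sumr_ge0 => j _; exact: metric_ge0 (metrizes_pos dA) _ _.
by rewrite lerDr; exact: metric_ge0 dA _ _.
Qed.

Lemma le_dist_tuple_snd2 (z z' : k.-tuple S) i j : i != j ->
  `|(tnth z i).2 - (tnth z' i).2| + `|(tnth z j).2 - (tnth z' j).2| <= dtup k z z'.
Proof.
move=> ij; rewrite /dist_tuple (bigD1 i)//= (bigD1 j) 1?eq_sym//= addrA.
rewrite -[leLHS]addr0 lerD//; last first.
  by apply: sumr_ge0 => l _; exact: metric_ge0 (metrizes_pos dA) _ _.
by rewrite lerD// lerDr; exact: metric_ge0 dA _ _.
Qed.

Let D0 (z z' : k.-tuple S) : 0 <= dtup k z z'.
Proof. by apply: sumr_ge0 => l _; exact: metric_ge0 (metrizes_pos dA) _ _. Qed.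

Lemma close_pairs_dist (z z' : k.-tuple S) :
  `|close_pairs z - close_pairs z'| <= (k * k)%:R * (2 / delta) * dtup k z z'.
Proof.
rewrite /close_pairs -sumrB; apply: le_trans (ler_norm_sum _ _ _) _.
apply: (@le_trans _ _ (\sum_(i < k) k%:R * ((2 / delta) * dtup k z z'))).
  apply: ler_sum => i _; rewrite -sumrB; apply: le_trans (ler_norm_sum _ _ _) _.
  apply: (@le_trans _ _ (\sum_(j < k) ((2 / delta) * dtup k z z'))).
    rewrite big_mkcond/=; apply: ler_sum => j _; case: ifP => _.
      apply: le_trans (close_dist _ _ _ _) _.
      rewrite mulrC -mulrA [X in _ <= _ * X]mulrC mulrA ler_pM2r ?invr_gt0//.
      have := le_dist_tuple_snd z z' i; have := le_dist_tuple_snd z z' j; lra.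
    by rewrite mulr_ge0// divr_ge0// ltW.
  by rewrite sumr_const card_ord -[leLHS]mulr_natl.
by rewrite sumr_const card_ord -[leLHS]mulr_natl natrM !mulrA.
Qed.

Lemma close_pairs_ge1 (z : k.-tuple S) (i j : 'I_k) : i != j ->
  `|(tnth z i).2 - (tnth z j).2| <= delta -> 1 <= close_pairs z.
Proof.
wlog ij : i j / (i < j)%N.
  move=> H; rewrite neq_ltn => /orP[ij|ji].
    by apply: H => //; rewrite neq_ltn ij.
  by rewrite distrC; apply: H => //; rewrite neq_ltn ji.
move=> _ zij; have cij : close (tnth z i) (tnth z j) = 1.
  apply: clamp_ge1; rewrite lerBrDr -lerBrDl mulrC ler_pdivrMr//; lra.
rewrite /close_pairs (bigD1 i)//= (bigD1 j)//= cij.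
rewrite -[leLHS]addr0 lerD//; last first.
  by apply: sumr_ge0 => *; apply: sumr_ge0 => *; exact: clamp_ge0.
by rewrite lerDl; apply: sumr_ge0 => *; exact: clamp_ge0.
Qed.

Lemma spread_dist (z z' : k.-tuple S) :
  `|spread z - spread z'| <= (k * k)%:R * (2 / delta) * dtup k z z'.
Proof.
apply: le_trans (norm_clampB _ _) _; apply: le_trans (close_pairs_dist z z').
have -> : 1 - close_pairs z - (1 - close_pairs z') = - (close_pairs z - close_pairs z').
  by ring.
by rewrite normrN.
Qed.

Lemma spread_BL : BL (dtup k) 1 ((k * k)%:R * (2 / delta)) spread.
Proof. by split=> [z|z z']; [exact: norm_clamp|exact: spread_dist]. Qed.

(** Two samples closer to each other than [delta] either are sorted by the same
    permutation or both have two positions within [delta]. *)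
Lemma cut_ios_BL C L (F : 'rV[A]_k -> R) : 0 <= L -> BL (@dist_row _ _ d k) C L F ->
  BL (dtup k) C (2 * C / delta + (L + C * ((k * k)%:R * (2 / delta))))
    (fun z => F (@ios_tuple R A k z) * spread z).
Proof.
move=> L0 [FC FL]; have C0 : 0 <= C by apply: le_trans (FC (const_mx point)).
split=> [z|z z'].
  by rewrite normrM -[leRHS]mulr1 ler_pM// norm_clamp.
have kd0 : 0 <= (k * k)%:R * (2 / delta) by rewrite mulr_ge0// divr_ge0// ltW.
have [far|near] := leP delta (dtup k z z').
  have : 2 * C <= 2 * C / delta * dtup k z z'.
    by rewrite mulrAC ler_pdivlMr// ler_wpM2l// mulr_ge0.
  have : 0 <= (L + C * ((k * k)%:R * (2 / delta))) * dtup k z z'.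
    by rewrite mulr_ge0// addr_ge0// mulr_ge0.
  have bnd t : `|F (@ios_tuple R A k t) * spread t| <= C.
    by rewrite normrM -[leRHS]mulr1 ler_pM// norm_clamp.
  have := ler_normB (F (@ios_tuple R A k z) * spread z) (F (@ios_tuple R A k z') * spread z').
  by rewrite mulrDl; have := bnd z; have := bnd z'; lra.
have [same|[i [j diff]]] : (forall i j, ((tnth z i).2 <= (tnth z j).2) =
      ((tnth z' i).2 <= (tnth z' j).2)) \/
    exists i j, ((tnth z i).2 <= (tnth z j).2) != ((tnth z' i).2 <= (tnth z' j).2).
  have [|] := pselect (exists i j,
    ((tnth z i).2 <= (tnth z j).2) != ((tnth z' i).2 <= (tnth z' j).2)); first by right.
  by move=> H; left=> i j; apply/eqP/negPn/negP => ij; apply: H; exists i, j.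
- have psE : ps (fun i => (tnth z i).2) = ps (fun i => (tnth z' i).2).
    by congr sort_perm; apply/funext => i; apply/funext => j; exact: same.
  have FD : `|F (@ios_tuple R A k z) - F (@ios_tuple R A k z')| <= L * dtup k z z'.
    apply: le_trans (FL _ _) _; rewrite ler_wpM2l//.
    rewrite /dist_row [leRHS](reindex_inj (@perm_inj _ (ps (fun i => (tnth z' i).2))))/=.
    by apply: ler_sum => i _; rewrite !mxE psE lerDl.
  have -> : F (@ios_tuple R A k z) * spread z - F (@ios_tuple R A k z') * spread z' =
      (F (@ios_tuple R A k z) - F (@ios_tuple R A k z')) * spread z +
      F (@ios_tuple R A k z') * (spread z - spread z') by ring.
  apply: le_trans (ler_normD _ _) _; rewrite !normrM.
  have h1 : `|F (@ios_tuple R A k z) - F (@ios_tuple R A k z')| * `|spread z| <=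
      L * dtup k z z' * 1 by rewrite ler_pM// norm_clamp.
  have h2 : `|F (@ios_tuple R A k z')| * `|spread z - spread z'| <=
      C * ((k * k)%:R * (2 / delta) * dtup k z z') by rewrite ler_pM// spread_dist.
  have : 0 <= 2 * C / delta * dtup k z z'.
    by rewrite mulr_ge0// divr_ge0 ?mulr_ge0// ltW.
  by rewrite !mulrDl; lra.
- have ij : i != j by apply: contraNneq diff => ->; rewrite !lexx.
  have two := le_dist_tuple_snd2 z z' ij.
  have zz : `|(tnth z i).2 - (tnth z j).2| <= dtup k z z' /\
      `|(tnth z' i).2 - (tnth z' j).2| <= dtup k z z'.
    move: two diff; set a := (tnth z i).2; set b := (tnth z j).2.
    set a' := (tnth z' i).2; set b' := (tnth z' j).2 => two.
    have a1 := ler_norm (a - a'); have b1 := ler_norm (b - b').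
    have a2 : a' - a <= `|a - a'| by rewrite distrC ler_norm.
    have b2 : b' - b <= `|b - b'| by rewrite distrC ler_norm.
    rewrite !ler_norml; case: (leP a b) => h; case: (leP a' b') => h' // _;
      by split; apply/andP; split; lra.
  have s0 t : `|(tnth t i).2 - (tnth t j).2| <= dtup k z z' -> spread t = 0.
    move=> h; apply: clamp_le0; rewrite subr_le0; apply: (close_pairs_ge1 ij).
    by apply: le_trans h (ltW near).
  rewrite (s0 z zz.1) (s0 z' zz.2) !mulr0 subrr normr0 mulr_ge0//.
  have : 0 <= 2 * C / delta by rewrite divr_ge0 ?mulr_ge0// ltW.
  by have := mulr_ge0 C0 kd0; lra.
Qed.

End cutoff.

Definition lower (t : R) : set (borel S) := [set: A] `*` `[0, t]%classic.

Lemma measurable_lower t : measurable (lower t).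
Proof.
have msnd : measurable_fun setT (snd : borel S -> borel R).
  by apply: continuous_borel_measurable => p; exact: cvg_snd.
rewrite (_ : lower t = snd @^-1` `[0, t]%classic); last first.
  by apply/seteqP; split=> [p []//|p]; split.
rewrite -[X in measurable X]setTI; apply: msnd => //.
rewrite -[X in measurable X]setCK; apply: measurableC; apply: sub_sigma_algebra.
by apply: closed_openC; exact: interval_closed.
Qed.

Lemma indic_lower t p : \1_(lower t) p = ((0 <= p.2 <= t)%R : bool)%:R :> R.
Proof.
rewrite indicE; congr (_%:R : R); congr nat_of_bool.
apply/idP/idP; first by rewrite inE => -[_ /=]; rewrite in_itv.
by move=> h; rewrite inE; split=> //=; rewrite in_itv.
Qed.

Lemma Rint_lower rho t : C_space R A rho -> 0 <= t <= 1 ->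
  \int[rho]_p \1_(lower t) p = t.
Proof.
by move=> rhoC t01; rewrite Rint_indic ?rhoC//; exact: measurable_lower.
Qed.

(** The position of a sample point has no atoms, so that two independent
    positions are rarely close to each other. *)
Lemma C_space_close rho delta q : C_space R A rho -> 0 < delta ->
  \int[rho]_p close delta p q <= 5 * delta.
Proof.
move=> rhoC delta0.
have bJ t := bmeas_indic R (measurable_lower t).
have JE t : 0 <= t <= 1 -> \int[rho]_p \1_(lower t) p = t by exact: Rint_lower.
(* [close delta p q] vanishes unless the position of [p] lies in an interval of
   length [5 * delta] about that of [q]. The function [b] is the sum of the
   indicators of that interval cut at [0] and [1], of the position [0], and of the
   positions outside of the unit interval; the last two have no mass. *)
pose hi := clamp (q.2 + 2 * delta); pose lo := clamp (q.2 - 3 * delta).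
have hi01 : 0 <= hi <= 1 by rewrite clamp_ge0 clamp_le1.
have lo01 : 0 <= lo <= 1 by rewrite clamp_ge0 clamp_le1.
have lohi : lo <= hi by apply: le_clamp; lra.
have hilo : hi - lo <= 5 * delta.
  apply: le_trans (ler_norm _) _; apply: le_trans (norm_clampB _ _) _.
  by rewrite ger0_norm; lra.
apply: le_trans hilo.
pose b p : R := \1_(lower hi) p - \1_(lower lo) p + \1_(lower 0) p + (1 - \1_(lower 1) p).
have -> : hi - lo = \int[rho]_p b p.
  rewrite RintD; [|by apply: bmeasD => //; exact: bmeasB|by apply: bmeasB => //; exact: bmeas_cst].
  rewrite RintD//; last exact: bmeasB.
  rewrite !RintB//; last exact: bmeas_cst.
  rewrite Rint_cst !JE ?lexx ?ler01//; ring.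
apply: le_Rint.
- exact: (BL_bmeas (metrizes_pos dA) (close_BL delta0 q)).
- by apply: bmeasD; [by apply: bmeasD => //; exact: bmeasB|by apply: bmeasB => //; exact: bmeas_cst].
move=> p.
have c0 := clamp_ge0 (2 - delta^-1 * `|p.2 - q.2|).
have c1 := clamp_le1 (2 - delta^-1 * `|p.2 - q.2|).
have far : 2 * delta <= `|p.2 - q.2| -> close delta p q = 0.
  by move=> h; apply: clamp_le0; rewrite subr_le0 mulrC ler_pdivlMr.
rewrite /b !indic_lower; set x := p.2 in far *; set c := close delta p q in far *.
have {}c0 : 0 <= c by []. have {}c1 : c <= 1 by [].
have [x0|x0] := ltP x 0; first by rewrite /=; lra.
have hi1 : hi <= 1 by case/andP: hi01. have hi0 : 0 <= hi by case/andP: hi01.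
have lo0 : 0 <= lo by case/andP: lo01.
have [x1|x1] := leP x 1; last first.
  by rewrite /= !leNgt (le_lt_trans hi1 x1) (le_lt_trans (le_trans lohi hi1) x1)
    (lt_trans ltr01 x1)/=; lra.
have [x0'|{}x0] := leP x 0.
  by rewrite (le_trans x0' hi0) (le_trans x0' lo0)/=; lra.
have [xlo|lox] := leP x lo.
  rewrite (le_trans xlo lohi) far/=; first by lra.
  have yx : x <= q.2 - 3 * delta.
    have [y0|y0] := leP (q.2 - 3 * delta) 0; first by move: xlo; rewrite /lo clamp_le0//; lra.
    have [y1|y1] := leP (q.2 - 3 * delta) 1; last by lra.
    by move: xlo; rewrite /lo clamp_id; lra.
  by rewrite distrC; apply: le_trans (ler_norm _); lra.
have [xhi|hix] := leP x hi; first by rewrite /=; lra.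
rewrite far/=; first by lra.
have yx : q.2 + 2 * delta <= x.
  have [y0|y0] := leP (q.2 + 2 * delta) 0; first by lra.
  have [y1|y1] := leP (q.2 + 2 * delta) 1; last by move: hix; rewrite /hi clamp_ge1; lra.
  by move: hix; rewrite /hi clamp_id; lra.
by apply: le_trans (ler_norm _); lra.
Qed.

(** A union bound over the pairs. *)
Lemma spread_close k rho delta : C_space R A rho -> 0 < delta ->
  \int[iid rho k]_z (1 - spread delta z) <= 5 * (k * k)%:R * delta.
Proof.
move=> rhoC delta0; have [x x_dense] := dense_sequence_pos dA.
have dS := metrizes_pos dA.
have bpair k' (i j : 'I_k') : bmeas ((fun z => close delta (tnth z i) (tnth z j)) :
    k'.-tuple (borel S) -> R).
  apply: (BL_tuple_bmeas dS x_dense (C := 1) (L := 2 / delta)).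
  split=> [z|z z']; first exact: norm_clamp.
  apply: le_trans (close_dist delta0 _ _ _ _) _.
  rewrite mulrC -mulrA [X in _ <= _ * X]mulrC mulrA ler_pM2r ?invr_gt0//.
  by have := le_dist_tuple_snd z z' i; have := le_dist_tuple_snd z z' j; lra.
have bcp : bmeas (@close_pairs k delta : k.-tuple (borel S) -> R).
  by apply: bmeas_sum => i; exact: bmeas_sum.
have bsp : bmeas (@spread k delta : k.-tuple (borel S) -> R).
  exact: (BL_tuple_bmeas dS x_dense (spread_BL k delta0)).
apply: (@le_trans _ _ (\int[iid rho k]_z close_pairs delta z)).
  apply: le_Rint => //; first by apply: bmeasB => //; exact: bmeas_cst.
  move=> z; rewrite /spread; have := clamp_ge0 (1 - close_pairs delta z).
  have [h|h] := leP 1 (close_pairs delta z); first lra.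
  have h0 : 0 <= close_pairs delta z.
    by apply: sumr_ge0 => *; apply: sumr_ge0 => *; exact: clamp_ge0.
  by rewrite clamp_id; lra.
rewrite /close_pairs Rint_sum; last by move=> i; apply: bmeas_sum => j; exact: bpair.
have -> : 5 * (k * k)%:R * delta = \sum_(i < k) \sum_(j < k) (5 * delta).
  by rewrite !sumr_const card_ord -mulrnA -[RHS]mulr_natl natrM; ring.
apply: ler_sum => i _; rewrite Rint_sum; last by move=> j; exact: bpair.
rewrite big_mkcond/=; apply: ler_sum => j _; case: ifP => ij; last by lra.
apply: iid_pair_le => // t; exact: C_space_close.
Qed.

Let three_terms (C e s s' I I' J J' : R) : 0 <= C -> C * (1 - s') <= e / 5 ->
  `|s' - s| <= e / (5 * (C + 1)) -> `|I - J| <= C * (1 - s) ->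
  `|I' - J'| <= C * (1 - s') -> `|J' - J| <= e / 5 -> `|I' - I| <= e.
Proof.
move=> C0 Cs' ss h1 h2 h3; have C1 : 0 < 5 * (C + 1) by lra.
have e0 : 0 <= e by move: (le_trans (normr_ge0 _) ss); rewrite pmulr_lge0 ?invr_gt0.
have : C * (s' - s) <= e / 5.
  have /(le_trans (ler_norm _)) := ss.
  rewrite ler_pdivlMr//; have [x0|/ltW x0] := leP 0 (s' - s); first by lra.
  by have := mulr_ge0_le0 C0 x0; lra.
have := ler_distD J' I' I; have := ler_distD J J' I; rewrite (distrC J I); lra.
Qed.

(** Sorting is continuous away from ties, and ties are negligible under product
    laws with uniform positions. *)
Lemma IOS_cvg (X : Type) (F : set_system X) {FF : Filter F}
    (nu : X -> M1 R S) (rho : M1 R S) k :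
  C_space R A rho -> nu y @[y --> F] --> rho -> IOS k (nu y) @[y --> F] --> IOS k rho.
Proof.
move=> rhoC c; have [x x_dense] := dense_sequence_pos dA.
have dS := metrizes_pos dA.
apply: (BL_cvg_M1 (metrizes_row dA k)) => C L G GBL.
have C0 : 0 <= C by apply: le_trans (proj1 GBL (const_mx point)).
have {}GBL : BL (@dist_row _ _ d k) C `|L| G.
  split=> [v|v w]; first by case: GBL.
  apply: le_trans (proj2 GBL v w) _; rewrite ler_wpM2r ?ler_norm//.
  by apply: sumr_ge0 => i _; exact: metric_ge0 dA _ _.
have bG := BL_bmeas (metrizes_row dA k) GBL.
under eq_fun do rewrite Rint_IOS//.
rewrite Rint_IOS//; apply/cvgrPdist_le => e e0.
(* With this [delta], cutting off costs at most [e / 5] under [rho]. *)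
pose K : R := C * (5 * (k * k)%:R) + 1.
have K0 : 0 < K by have := mulr_ge0 C0 (ler0n R (5 * (k * k))); rewrite natrM /K; lra.
pose delta := e / (5 * K).
have delta0 : 0 < delta by rewrite divr_gt0// mulr_gt0.
pose cut z := G (@ios_tuple R A k z) * spread delta z.
have cutBL := cut_ios_BL delta0 (normr_ge0 L) GBL.
have spBL := @spread_BL k delta delta0.
have bios : bmeas ((fun z => G (@ios_tuple R A k z)) : k.-tuple (borel S) -> R).
  exact: (bmeas_comp (@measurable_ios R A k) bG).
have bcut : bmeas (cut : k.-tuple (borel S) -> R) by exact: (BL_tuple_bmeas dS x_dense cutBL).
have bsp : bmeas (@spread k delta : k.-tuple (borel S) -> R).
  exact: (BL_tuple_bmeas dS x_dense spBL).
have b1sp : bmeas ((fun z => 1 - @spread k delta z) : k.-tuple (borel S) -> R).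
  by apply: bmeasB => //; exact: bmeas_cst.
have cut_close (P : M1 R S) : `|\int[iid P k]_z G (@ios_tuple R A k z) -
    \int[iid P k]_z cut z| <= C * \int[iid P k]_z (1 - spread delta z).
  rewrite -RintB// -RintZ//; apply: le_trans (norm_Rint _ (bmeasB bios bcut)) _.
  apply: le_Rint; [by apply: bmeas_norm; exact: bmeasB|exact: bmeasZ|move=> z].
  rewrite -[X in X - _]mulr1 -mulrBr normrM [X in _ * X]ger0_norm; last first.
    by rewrite subr_ge0 clamp_le1.
  by rewrite ler_wpM2r ?(proj1 GBL)// subr_ge0 clamp_le1.
have c1 : \int[iid (nu y) k]_z cut z @[y --> F] --> \int[iid rho k]_z cut z.
  exact: (iid_cvg dS x_dense c cutBL).
have c2 : \int[iid (nu y) k]_z spread delta z @[y --> F] -->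
    \int[iid rho k]_z spread delta z.
  exact: (iid_cvg dS x_dense c spBL).
have sp_rho := @spread_close k rho delta rhoC delta0.
have Kd : C * (5 * (k * k)%:R * delta) <= e / 5.
  have -> : e / 5 = K * delta by rewrite /delta; field; rewrite gt_eqF.
  by rewrite /K; lra.
have e5' : 0 < e / 5 by rewrite divr_gt0.
have e5 : 0 < e / (5 * (C + 1)) by rewrite divr_gt0// mulr_gt0// ltr_wpDl.
move/cvgrPdist_le : c1 => /(_ _ e5') c1; move/cvgrPdist_le : c2 => /(_ _ e5) c2.
apply: filterS2 c1 c2 => y.
have := cut_close rho; have := cut_close (nu y); move: sp_rho.
have b1 : bmeas ((fun=> 1) : k.-tuple (borel S) -> R) by exact: bmeas_cst.
have E (P : M1 R S) : \int[iid P k]_z (1 - spread delta z) =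
    1 - \int[iid P k]_z spread delta z by rewrite RintB// Rint_cst.
rewrite (E rho) (E (nu y)) => sp h1 h2 h3 h4.
apply: (three_terms C0 _ h4 h1 h2 h3).
by apply: le_trans Kd; rewrite ler_wpM2l.
Qed.

(** * Sampling from a word *)

Lemma Rint_iid_rho n (w : 'rV[A]_n.+1) k (Phi : k.-tuple (borel S) -> R) :
  bmeas Phi ->
  \int[iid (rho_ R w) k]_z Phi z =
    all_avg (fun t : k.-tuple 'I_n.+1 => Phi (map_tuple (position R w) t)).
Proof.
move=> bPhi; have [x x_dense] := dense_sequence_pos dA.
have dS := metrizes_pos dA.
elim: k Phi bPhi => [|k IH] Phi bPhi.
  rewrite /all_avg expn0 invr1 mul1r (big_pred1 [tuple]); last first.
    by move=> t; apply/esym/eqP; exact: tuple0.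
  rewrite /Rintegral integral_dirac//; last by apply/measurable_EFinP; case: bPhi.
  by rewrite diracT mul1e /= (tuple0 (map_tuple _ _)).
have btail s : bmeas (fun t : k.-tuple (borel S) => Phi (cons_tuple s t)).
  have m : measurable_fun setT (fun t : k.-tuple (borel S) => tcons (s, t)).
    by apply: measurableT_comp; [exact: measurable_tcons|exact: measurable_pair1].
  exact: (bmeas_comp m bPhi).
have bhead t : bmeas (fun s : borel S => Phi (cons_tuple s t)).
  have m : measurable_fun setT (fun s : borel S => tcons (s, t)).
    by apply: measurableT_comp; [exact: measurable_tcons|exact: measurable_pair2].
  exact: (bmeas_comp m bPhi).
rewrite (Rint_iidS _ bPhi).2.
under eq_Rintegral do rewrite Rint_rho//.
rewrite RintZ; last exact: bmeas_sum.
rewrite Rint_sum// /all_avg expnS natrM invfM -mulrA; congr (_ * _).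
rewrite sum_tuple_cons mulr_sumr; apply: eq_bigr => j _.
rewrite IH// /all_avg; congr (_ * _); apply: eq_bigr => t _.
by congr Phi; exact: val_inj.
Qed.

(** Positions increase with the indices of the letters, and distinct indices make
    no ties. *)
Lemma ios_subword n (w : 'rV[A]_n.+1) k (t : k.-tuple 'I_n.+1) : uniq t ->
  @ios_tuple R A k (map_tuple (position R w) t) = subword w (tsort t).
Proof.
move=> ut; pose xt i := (tnth (map_tuple (position R w) t) i).2.
have xtE i : xt i = (tnth t i).+1%:R / n.+1%:R by rewrite /xt tnth_map.
pose s := [tuple tnth t (ps xt i) | i < k].
have -> : tsort t = s.
  apply: tsortE; first by rewrite perm_sym; apply/tuple_permP; exists (ps xt).
  rewrite sorted_map; apply/(sortedP ord0) => i; rewrite size_tuple => ik.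
  have i'k : (i < k)%N by exact: ltnW.
  rewrite -(tnth_nth _ s (Ordinal i'k)) -(tnth_nth _ s (Ordinal ik)) !tnth_mktuple.
  have := @ps_stable R k xt (Ordinal i'k) (Ordinal ik) (ltnSn i).
  rewrite !xtE !ltr_pM2r ?invr_gt0// ltr_nat ltnS => -[//|[]].
  move=> /(mulIf _) e; have /eqP : (tnth t (ps xt (Ordinal i'k))).+1%:R =
      (tnth t (ps xt (Ordinal ik))).+1%:R :> R by apply: e; rewrite invr_eq0 pnatr_eq0.
  rewrite eqr_nat eqSS => /eqP/val_inj/(tuple_uniqP _ ut)/perm_inj/(congr1 val) /=.
  lia.
by apply/rowP => i; rewrite !mxE tnth_mktuple tnth_map.
Qed.

(** Sampling positions with and without replacement differ by the probability
    of a collision. *)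
Lemma RSS_IOS_rho n (w : 'rV[A]_n.+1) k C (F : 'rV[A]_k -> R) : (k <= n.+1)%N ->
  bmeas (F : borel 'rV[A]_k -> R) -> (forall v, `|F v| <= C) ->
  `|\int[RSS R w k]_v F v - \int[IOS k (rho_ R w)]_v F v| <= 2 * C * collision R n.+1 k.
Proof.
move=> kn bF FC; rewrite Rint_RSS// Rint_IOS// Rint_iid_rho; last first.
  exact: (bmeas_comp (@measurable_ios R A k) bF).
pose Phi (t : k.-tuple 'I_n.+1) := F (@ios_tuple R A k (map_tuple (position R w) t)).
have -> : incr_avg (fun t => F (subword w t)) = incr_avg Phi :> R.
  rewrite /incr_avg; congr (_ * _); apply: eq_bigr => t st.
  have ut : uniq t.
    by move: st; rewrite ltn_sorted_uniq_leq map_inj_uniq => [/andP[]//|]; exact: val_inj.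
  by rewrite /Phi ios_subword// (@tsortE _ _ t t).
apply: incr_avg_all_avg => // [t ut|t]; last exact: FC.
rewrite /Phi !ios_subword ?sort_uniq//; congr (F (subword w _)).
by apply/esym/tsortE => //; exact: sorted_tsort.
Qed.

End ios_continuity.

(** * Every law with uniform positions is a limit of words *)

Section greedy_words.
Context (R : realType) (A : polishType R) (d : A -> A -> R).
Hypothesis dA : metrizes d.
Local Notation S := (A * R)%type.
Let dS := metrizes_pos dA.

Section greedy.
Variables (rho : M1 R S) (N m : nat) (phi : 'I_N -> S -> R) (C L : R).
Hypotheses (rhoC : C_space R A rho) (m0 : (0 < m)%N) (C0 : 0 <= C) (L0 : 0 <= L)
  (phiBL : forall i, BL (dist_pos d) C L (phi i)).

Let t_ (j : nat) : R := j%:R / m%:R.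

Definition strip (j : nat) (p : S) : R := \1_(lower (t_ j.+1)) p - \1_(lower (t_ j)) p.

Let M0 : 0 < m%:R :> R. Proof. by rewrite ltr0n. Qed.

Let t_01 j : (j <= m)%N -> 0 <= t_ j <= 1.
Proof. by move=> jm; rewrite divr_ge0//= ler_pdivrMr// mul1r ler_nat. Qed.

Let t_homo j : t_ j <= t_ j.+1.
Proof. by rewrite ler_pM2r ?invr_gt0// ler_nat. Qed.

Let bmeas_strip j : bmeas (strip j : borel S -> R).
Proof. by apply: bmeasB; apply: bmeas_indic; exact: measurable_lower. Qed.

Let strip_ge0 j p : 0 <= strip j p.
Proof.
rewrite subr_ge0 !indic_lower ler_nat; case: (leP 0 p.2) => //= _.
by have [h|//] := leP p.2 (t_ j); rewrite (le_trans h (t_homo j)).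
Qed.

Let Rint_strip j : (j < m)%N -> \int[rho]_p strip j p = m%:R^-1.
Proof.
move=> jm; rewrite RintB; [|by apply: bmeas_indic; exact: measurable_lower..].
rewrite !Rint_lower ?t_01//; last exact: ltnW.
by rewrite /t_ -mulrBl -natrB// subSnn mul1r.
Qed.

Let strip_pos j p : strip j p != 0 -> `|p.2 - t_ j.+1| <= m%:R^-1.
Proof.
rewrite /strip !indic_lower; case: (leP 0 p.2) => //= p0; last by rewrite subrr eqxx.
have [h1|h1] := leP p.2 (t_ j.+1); have [h2|h2] := leP p.2 (t_ j); rewrite ?subrr ?eqxx//=.
  move=> _; rewrite distrC ger0_norm ?subr_ge0//.
  have -> : m%:R^-1 = t_ j.+1 - t_ j by rewrite /t_ -mulrBl -natrB// subSnn mul1r.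
  by rewrite lerB// ltW.
by have := le_trans h2 (t_homo j); rewrite leNgt h1.
Qed.

(** mean of [g] over the part of [rho] placed in the [j]-th strip *)
Let strip_mean j (g : S -> R) := m%:R * \int[rho]_p (g p * strip j p).

Let bphi i : bmeas (phi i : borel S -> R).
Proof. exact: (BL_bmeas dS (phiBL i)). Qed.

Let letter i j (a : A) := phi i (a, t_ j.+1).

Let bletter i j : bmeas ((fun p => letter i j p.1) : borel S -> R).
Proof.
have BLl : BL (dist_pos d) C L (fun p => letter i j p.1).
  split=> [p|p q]; first exact: (proj1 (phiBL i)).
  apply: le_trans (proj2 (phiBL i) _ _) _; rewrite ler_wpM2l// /dist_pos /=.
  by rewrite subrr normr0 addr0 lerDl.
exact: (BL_bmeas dS BLl).
Qed.

Let target i j := strip_mean j (fun p => letter i j p.1).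

Let deviation (a : nat -> A) l i := \sum_(j < l) (letter i j (a j) - target i j).

(** If every letter made the sum of squares larger, so would the mean over the
    letters of the strip; but [target] is the mean of [letter], so that the cross
    terms vanish in that mean and only the variances, at most [C ^+ 2], remain. *)
Let good_letter j (D : 'I_N -> R) : (j < m)%N -> exists a : A,
  \sum_i (D i + (letter i j a - target i j)) ^+ 2 <=
    \sum_i D i ^+ 2 + N%:R * C ^+ 2 + 1.
Proof.
move=> jm; apply: contrapT => /forallNP H.
pose B := \sum_i D i ^+ 2 + N%:R * C ^+ 2 + 1.
pose h (p : S) := \sum_i (D i + (letter i j p.1 - target i j)) ^+ 2.
have hB p : B <= h p by apply/ltW; rewrite ltNge; apply/negP; exact: H.
have bl2 i : bmeas ((fun p => letter i j p.1 ^+ 2) : borel S -> R).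
  by have := bmeasM (bletter i j) (bletter i j); congr bmeas; apply/funext => p; rewrite expr2.
have mean_cst c : strip_mean j (fun=> c) = c.
  by rewrite /strip_mean RintZ// Rint_strip// mulrCA mulfV ?mulr1// gt_eqF.
have meanD f g : bmeas (f : borel S -> R) -> bmeas (g : borel S -> R) ->
    strip_mean j (fun p => f p + g p) = strip_mean j f + strip_mean j g.
  move=> bf bg; rewrite /strip_mean -mulrDr -RintD; [|exact: bmeasM|exact: bmeasM].
  by congr (_ * _); apply: eq_Rintegral => p _; rewrite mulrDl.
have meanZ c f : bmeas (f : borel S -> R) ->
    strip_mean j (fun p => c * f p) = c * strip_mean j f.
  move=> bf; rewrite /strip_mean mulrCA -[in RHS]RintZ; last exact: bmeasM.
  by congr (_ * _); apply: eq_Rintegral => p _; rewrite mulrA.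
have le_mean f g : bmeas (f : borel S -> R) -> bmeas (g : borel S -> R) ->
    (forall p, f p <= g p) -> strip_mean j f <= strip_mean j g.
  move=> bf bg fg; rewrite ler_pM2l//; apply: le_Rint; [exact: bmeasM|exact: bmeasM|].
  by move=> p; rewrite ler_wpM2r.
pose G i (p : S) := (D i - target i j) ^+ 2 +
  ((2 * (D i - target i j)) * letter i j p.1 + letter i j p.1 ^+ 2).
have bG i : bmeas (G i : borel S -> R).
  by apply: bmeasD; [exact: bmeas_cst|apply: bmeasD => //; exact: bmeasZ].
have hE : h = fun p => \sum_i G i p.
  by apply/funext => p; apply: eq_bigr => i _; rewrite /G; ring.
have meanG i : strip_mean j (G i) <= D i ^+ 2 + C ^+ 2.
  rewrite /G meanD; [|exact: bmeas_cst|by apply: bmeasD => //; exact: bmeasZ].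
  rewrite meanD//; last exact: bmeasZ.
  rewrite mean_cst meanZ// -/(target i j).
  have : strip_mean j (fun p => letter i j p.1 ^+ 2) <= C ^+ 2.
    rewrite -[leRHS]mean_cst; apply: le_mean => // [|p]; first exact: bmeas_cst.
    rewrite -[leLHS]real_normK ?num_real// lerXn2r ?nnegrE//.
    exact: (proj1 (phiBL i)).
  by have := sqr_ge0 (target i j); rewrite !expr2; lra.
have mean_sum (r : seq 'I_N) : strip_mean j (fun p => \sum_(i <- r) G i p) =
    \sum_(i <- r) strip_mean j (G i).
  elim: r => [|i r IH].
    rewrite big_nil -[RHS]mean_cst; congr (_ * _).
    by apply: eq_Rintegral => p _; rewrite big_nil.
  rewrite big_cons -IH -meanD//; last exact: bmeas_sum.
  by congr (_ * _); apply: eq_Rintegral => p _; rewrite big_cons.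
have : B <= B - 1.
  rewrite -[leLHS](mean_cst B); apply: (@le_trans _ _ (strip_mean j h)).
    by apply: le_mean => //; [exact: bmeas_cst|rewrite hE; exact: bmeas_sum].
  rewrite hE mean_sum /B addrK.
  apply: (@le_trans _ _ (\sum_i (D i ^+ 2 + C ^+ 2))); first exact: ler_sum.
  by rewrite big_split/= sumr_const card_ord -[C ^+ 2 *+ N]mulr_natl.
by rewrite lerDl lerNr oppr0 ler10.
Qed.

(** The letters are chosen one after the other: the squared deviations of all the
    test functions together grow by a constant at each letter, hence linearly,
    whereas deviations of order [m] would matter. *)
Let good_word : exists a : nat -> A, forall l, (l <= m)%N ->
  \sum_i deviation a l i ^+ 2 <= l%:R * (N%:R * C ^+ 2 + 1).
Proof.
suff H l : (l <= m)%N -> exists a : nat -> A, forall l', (l' <= l)%N ->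
    \sum_i deviation a l' i ^+ 2 <= l'%:R * (N%:R * C ^+ 2 + 1).
  have [a Ha] := H m (leqnn m); by exists a.
elim: l => [_|l IH lm].
  exists (fun=> point) => l'; rewrite leqn0 => /eqP ->.
  by rewrite mul0r big1// => i _; rewrite /deviation big_ord0 expr0n.
have [a Ha] := IH (ltnW lm).
have [b Hb] := good_letter (deviation a l) lm.
pose a' j := if (j < l)%N then a j else b.
have dev l' i : (l' <= l)%N -> deviation a' l' i = deviation a l' i.
  by move=> l'l; apply: eq_bigr => j _; rewrite /a' (leq_trans (ltn_ord j) l'l).
exists a' => l'; rewrite leq_eqVlt => /predU1P[->|]; last first.
  rewrite ltnS => l'l; under eq_bigr do rewrite dev//.
  exact: Ha.
rewrite {1}/deviation; under eq_bigr do rewrite big_ord_recr/= -/(deviation a' l _) dev//.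
rewrite /a' ltnn; apply: le_trans Hb _; have := Ha l (leqnn l).
by rewrite -natr1; lra.
Qed.

(** The strips have mass [1 / m] each and exhaust [rho], and moving a position to
    the end of its strip costs [L / m]. *)
Let target_rho i : `|m%:R^-1 * \sum_(j < m) target i j - \int[rho]_p phi i p| <= L / m%:R.
Proof.
have bs (f : S -> R) j : bmeas (f : borel S -> R) ->
  bmeas ((fun p => f p * strip j p) : borel S -> R) by move=> bf; exact: bmeasM.
pose rest p := 1 - \sum_(j < m) strip j p.
have brest : bmeas (rest : borel S -> R).
  by apply: bmeasB; [exact: bmeas_cst|exact: bmeas_sum].
have restE p : rest p = 1 - \1_(lower 1) p + \1_(lower 0) p.
  rewrite /rest -(big_mkord xpredT (fun j => strip j p)).
  rewrite (telescope_sumr (fun j => \1_(lower (t_ j)) p))//.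
  by rewrite /t_ mulfV ?gt_eqF// mul0r opprB addrA addrAC.
have rest0 p : 0 <= rest p.
  by rewrite restE !indic_lower; case: (_ && _); case: (_ && _); rewrite /=; lra.
have Rint_rest : \int[rho]_p rest p = 0.
  rewrite RintB; [|exact: bmeas_cst|exact: bmeas_sum].
  rewrite Rint_cst Rint_sum// (eq_bigr (fun=> m%:R^-1)) => [|j _]; last exact: Rint_strip.
  by rewrite sumr_const card_ord -[m%:R^-1 *+ m]mulr_natl mulfV ?subrr// gt_eqF.
have E : \int[rho]_p phi i p =
    \sum_(j < m) \int[rho]_p (phi i p * strip j p) + \int[rho]_p (phi i p * rest p).
  rewrite -Rint_sum; last by move=> j; exact: bs.
  rewrite -RintD; [|by apply: bmeas_sum => j; exact: bs|exact: bmeasM].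
  by apply: eq_Rintegral => p _; rewrite -mulr_sumr -mulrDr /rest addrC subrK mulr1.
have small : \int[rho]_p (phi i p * rest p) = 0.
  apply/eqP; rewrite -normr_le0; apply: le_trans (norm_Rint _ _) _; first exact: bmeasM.
  rewrite -[leRHS](mulr0 C) -Rint_rest -RintZ//.
  apply: le_Rint; [by apply: bmeas_norm; exact: bmeasM|exact: bmeasZ|move=> p].
  rewrite normrM [X in _ * X]ger0_norm// ler_wpM2r//.
  exact: (proj1 (phiBL i)).
rewrite E small addr0 mulr_sumr -sumrB; apply: le_trans (ler_norm_sum _ _ _) _.
apply: (@le_trans _ _ (\sum_(j < m) (L / m%:R) * m%:R^-1)); last first.
  by rewrite sumr_const card_ord -[L / m%:R / m%:R *+ m]mulr_natl mulrCA mulfV ?mulr1// gt_eqF.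
apply: ler_sum => j _; rewrite /target /strip_mean mulKf ?gt_eqF//.
rewrite -RintB; [|exact: bs|exact: bs].
have bd : bmeas ((fun p => letter i j p.1 * strip j p - phi i p * strip j p) : borel S -> R).
  by apply: bmeasB; exact: bs.
apply: le_trans (norm_Rint _ bd) _.
rewrite -[X in _ <= _ * X](Rint_strip (ltn_ord j)) -RintZ//.
apply: le_Rint; [exact: bmeas_norm|exact: bmeasZ|move=> p].
rewrite -mulrBl normrM [X in _ * X]ger0_norm//.
have [->|sp] := eqVneq (strip j p) 0; first by rewrite !mulr0.
rewrite ler_wpM2r//; apply: le_trans (proj2 (phiBL i) _ _) _.
rewrite ler_wpM2l// /dist_pos /= metric_refl// add0r distrC.
exact: strip_pos.
Qed.

Lemma greedy_approx eps : 0 < eps -> N%:R * C ^+ 2 + 1 <= m%:R * eps ^+ 2 ->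
  exists w : 'rV[A]_m, forall i,
    `|m%:R^-1 * \sum_(j < m) phi i (w 0 j, j.+1%:R / m%:R) - \int[rho]_p phi i p|
      <= eps + L / m%:R.
Proof.
move=> eps0 meps; have [a Ha] := good_word.
exists (\row_j a j) => i.
have dev : `|deviation a m i| <= m%:R * eps.
  have me0 : 0 <= m%:R * eps by exact: mulr_ge0 (ltW M0) (ltW eps0).
  rewrite -(@ler_pXn2r _ 2) ?nnegrE// real_normK ?num_real//.
  apply: (@le_trans _ _ (\sum_i deviation a m i ^+ 2)).
    by rewrite (bigD1 i)//= lerDl sumr_ge0// => *; exact: sqr_ge0.
  apply: le_trans (Ha m (leqnn m)) _.
  by rewrite exprMn expr2 -mulrA ler_wpM2l.
have E : m%:R^-1 * \sum_(j < m) phi i ((\row_j a j) 0 j, j.+1%:R / m%:R) =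
    m%:R^-1 * deviation a m i + m%:R^-1 * \sum_(j < m) target i j.
  rewrite -mulrDr /deviation sumrB subrK; congr (_ * _).
  by apply: eq_bigr => j _; rewrite mxE.
rewrite E -addrA; apply: le_trans (ler_normD _ _) _; apply: lerD; last exact: target_rho.
by rewrite normrM normfV normr_nat ler_pdivrMl.
Qed.

End greedy.

(** For each [p], finitely many test functions control the bounded Lipschitz ball
    of size [p] around [rho], and a greedy word does well on all of them. *)
Lemma C_space_words (rho : M1 R S) : C_space R A rho ->
  exists w : nat -> word A, word_length (w n) @[n --> \oo] --> \oo /\
    rho_ R (tagged (w n)) @[n --> \oo] --> rho.
Proof.
move=> rhoC; have [x x_dense] := dense_sequence_pos dA.
have approx p : exists w : word A, (p <= tag w)%N /\ forall g, BL (dist_pos d) p%:R p%:R g ->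
    `|\int[rho_ R (tagged w)]_s g s - \int[rho]_s g s| <= p.+1%:R^-1.
  have p0 : 0 < p.+1%:R^-1 :> R by rewrite invr_gt0.
  have [N [phi [eta [eta0 phiBL H]]]] :=
    BL_finite_test dS x_dense rho (ler0n R p) (ler0n R p) p0.
  have /choice[K phiK] : forall i, exists K : R, BL (dist_pos d) K K (phi i).
    move=> i; have [C' [L' [pC pL]]] := phiBL i; exists (Num.max `|C'| `|L'|).
    split=> [s|s t].
      by apply: le_trans (pC s) _; rewrite le_max ler_norm.
    apply: le_trans (pL s t) _; rewrite ler_wpM2r ?metric_ge0//.
    by rewrite le_max [X in _ || X](ler_norm L') orbT.
  pose C := \sum_i `|K i|.
  have KC i : K i <= C.
    apply: le_trans (ler_norm _) _; rewrite /C (bigD1 i)//= lerDl.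
    exact: sumr_ge0.
  have C0 : 0 <= C by exact: sumr_ge0.
  have {}phiK i : BL (dist_pos d) C C (phi i).
    have [pC pL] := phiK i; split=> [s|s t]; first by apply: le_trans (pC s) (KC i).
    by apply: le_trans (pL s t) _; rewrite ler_wpM2r ?metric_ge0.
  pose eps := eta / 3; have eps0 : 0 < eps by rewrite divr_gt0.
  have [n [pn n1 n2]] : exists n, [/\ (p <= n)%N,
      N%:R * C ^+ 2 + 1 <= n.+1%:R * eps ^+ 2 & C / n.+1%:R <= eps].
    near \oo => n; exists n; split.
    - by near: n; exact: nbhs_infty_ge.
    - rewrite -ler_pdivrMr ?exprn_gt0//; apply: (@le_trans _ _ n%:R); last by rewrite ler_nat.
      by near: n; exact: nbhs_infty_ger.
    - rewrite ler_pdivrMr// mulrC -ler_pdivrMr//.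
      apply: (@le_trans _ _ n%:R); last by rewrite ler_nat.
      by near: n; exact: nbhs_infty_ger.
  have [w wP] := greedy_approx rhoC (ltn0Sn n) C0 C0 phiK eps0 n1.
  have close i : `|\int[rho_ R w]_s phi i s - \int[rho]_s phi i s| < eta.
    rewrite Rint_rho; last exact: (BL_bmeas dS (phiK i)).
    apply: le_lt_trans (wP i) _.
    by move: eta0 n2; rewrite /eps; set q := C / _; lra.
  exists (Tagged (fun n => 'rV[A]_n.+1) w); split; first exact: pn.
  by move=> g gBL; exact: (H _ close g gBL).
have /choice[w wP] := approx; exists w; split.
  move=> U [B _ BU]; exists B => // n /= Bn; apply: BU => /=.
  by rewrite /word_length; apply: leq_trans Bn (leqW (wP n).1).
apply: (BL_cvg_M1 dS) => C L f [fC fL]; apply/cvgrPdist_le => e e0; near=> n.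
have nBL : BL (dist_pos d) n%:R n%:R f.
  split=> [s|s t]; [apply: le_trans (fC s) _|apply: le_trans (fL s t) _].
    by near: n; exact: nbhs_infty_ger.
  rewrite ler_wpM2r ?metric_ge0//.
  by near: n; exact: nbhs_infty_ger.
rewrite distrC; apply: le_trans ((wP n).2 f nBL) _.
by apply: ltW; near: n; exact: (near_infty_natSinv_lt (PosNum e0)).
Unshelve. all: by end_near. Qed.

End greedy_words.

(** * Limits of words *)

Section limits.
Context (R : realType) (A : polishType R) (d : A -> A -> R).
Hypothesis dA : metrizes d.
Local Notation S := (A * R)%type.
Let dS := metrizes_pos dA.

Lemma BL_pos_lip (f : S -> R) C L : BL (dist_pos d) C L f -> pos_lip f C L.
Proof.
move=> [fC fL]; split=> // a x x'; apply: le_trans (fL _ _) _.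
by rewrite /dist_pos /= metric_refl// add0r.
Qed.

Lemma mean_position_BL k (f : S -> R) C L : BL (dist_pos d) C L f ->
  BL (@dist_row _ _ d k.+1) C L
    (fun v => k.+1%:R^-1 * \sum_(j < k.+1) f (position R v j)).
Proof.
move=> [fC fL].
have L0 : 0 <= L.
  have := le_trans (normr_ge0 _) (fL (point, 0) (point, 1)).
  by rewrite /dist_pos /= metric_refl// add0r sub0r normrN normr1 mulr1.
split=> [v|v w]; first rewrite normrM normfV normr_nat ler_pdivrMl//.
  apply: le_trans (ler_norm_sum _ _ _) _.
  apply: (@le_trans _ _ (\sum_(j < k.+1) C)); first exact: ler_sum.
  by rewrite sumr_const card_ord -[leLHS]mulr_natl.
rewrite -mulrBr -sumrB normrM normfV normr_nat ler_pdivrMl//.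
apply: le_trans (ler_norm_sum _ _ _) _.
apply: (@le_trans _ _ (\sum_(j < k.+1) L * dist_row d v w)); last first.
  by rewrite sumr_const card_ord -[leLHS]mulr_natl.
apply: ler_sum => j _; apply: le_trans (fL _ _) _; rewrite ler_wpM2l//.
by rewrite /dist_pos /= subrr normr0 addr0; exact: le_dist_row.
Qed.

Lemma PosSam_cvg_BL (X : Type) (F : set_system X) {FF : Filter F} k
    (nu : X -> M1 R 'rV[A]_k.+1) (mu : M1 R 'rV[A]_k.+1) (f : S -> R) C L :
  BL (dist_pos d) C L f -> nu y @[y --> F] --> mu ->
  \int[PosSam (nu y)]_z f z @[y --> F] --> \int[PosSam mu]_z f z.
Proof.
move=> fBL c; have bf := BL_bmeas dS fBL.
under eq_fun do rewrite Rint_PosSam//.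
rewrite Rint_PosSam//.
exact: (M1_cvg_BL (metrizes_row dA k.+1) (mean_position_BL k fBL) c).
Qed.

(** the part of the bound of [rho_PosSam_RSS] that long words do not remove; it is
    at most [3 * L * e] as soon as [k] is at least [e ^- 2] *)
Definition rate (L e : R) k : R := L * (e + 2 / (k.+1%:R * e)).

Lemma rate_near0 (L e : R) : 0 < e ->
  exists2 eta, 0 < eta & \forall k \near \oo, rate L eta k <= e.
Proof.
move=> e0; pose eta := e / (3 * (`|L| + 1)).
have L1 : 0 < `|L| + 1 by rewrite ltr_wpDl.
have eta0 : 0 < eta by rewrite divr_gt0// mulr_gt0.
exists eta => //; near=> k.
have k2 : 2 / (k.+1%:R * eta) <= 2 * eta.
  rewrite ler_pdivrMr ?mulr_gt0//.
  rewrite [leRHS](_ : _ = 2 * ((eta ^+ 2) * k.+1%:R)); last by ring.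
  rewrite ler_peMr// -ler_pdivrMl ?exprn_gt0// mulr1.
  apply: (@le_trans _ _ k%:R); last by rewrite ler_nat.
  by near: k; exact: nbhs_infty_ger.
have eE : e = (`|L| + 1) * (eta + 2 * eta) by rewrite /eta; field; rewrite gt_eqF.
have h : 0 <= eta + 2 / (k.+1%:R * eta) by rewrite addr_ge0 ?divr_ge0 ?mulr_ge0// ltW.
apply: (@le_trans _ _ ((`|L| + 1) * (eta + 2 / (k.+1%:R * eta)))).
  by rewrite ler_wpM2r//; apply: le_trans (ler_norm L) _; rewrite lerDl.
by rewrite [leRHS]eE ler_pM2l// lerD2l.
Unshelve. all: by end_near. Qed.

Section RSS_limit.
Variables (w : nat -> word A) (mu : law_family R A).
Hypothesis wmu : RSS_converges w mu.

Let u (f : S -> R) n := \int[rho_ R (tagged (w n))]_z f z.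
Let P (f : S -> R) k := \int[PosSam (mu k)]_z f z.

Let u_near_P (f : S -> R) C K L k eta e : BL (dist_pos d) C K f -> pos_lip f C L ->
  0 <= L -> 0 < eta -> 0 < e ->
  \forall n \near \oo, `|u f n - P f k| <= rate L eta k + e.
Proof.
move=> fBL fL L0 eta0 e0; have bf := BL_bmeas dS fBL.
have C0 : 0 <= C by apply: le_trans (proj1 fBL point).
have [wlen wcvg] := wmu.
have e2 : 0 < e / 2 by rewrite divr_gt0.
have e4 : 0 < e / (4 * (C + 1)) by rewrite divr_gt0// mulr_gt0// ltr_wpDl.
have Pcvg : \int[PosSam (RSS R (tagged (w n)) k.+1)]_z f z @[n --> \oo] --> P f k.
  exact: (PosSam_cvg_BL fBL (wcvg k)).
move/cvgrPdist_le : Pcvg => /(_ _ e2) near1.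
have near2 : \forall n \near \oo, (k < word_length (w n))%N.
  exact: (wlen _ (nbhs_infty_gt k)).
have near3 : \forall n \near \oo, collision R (word_length (w n)) k.+1 < e / (4 * (C + 1)).
  have c0 := collision_near0 k.+1 e4; exact: (wlen _ c0).
apply: filterS3 near1 near2 near3 => n h1 kn h2.
have := rho_PosSam_RSS (tagged (w n)) bf fL L0 kn eta0.
move: h1; set q := \int[PosSam _]_z f z => h1 h.
have h3 : 2 * C * collision R (tag (w n)).+1 k.+1 <= e / 2.
  have c0 := collision_ge0 R k.+1 (ltn0Sn (tag (w n))).
  apply: (@le_trans _ _ (2 * (C + 1) * (e / (4 * (C + 1))))).
    by apply: ler_pM; rewrite ?mulr_ge0 ?ler_pM2l ?lerDl// ltW.
  have -> // : 2 * (C + 1) * (e / (4 * (C + 1))) = e / 2.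
  by field; rewrite gt_eqF// ltr_wpDl.
apply: le_trans (ler_distD q _ _) _; rewrite [e]splitr addrA lerD//.
  by apply: le_trans h _; rewrite lerD2l.
by rewrite distrC.
Qed.

Let BL_weaken (f : S -> R) C L : BL (dist_pos d) C L f -> BL (dist_pos d) C `|L| f.
Proof.
move=> [fC fL]; split=> // s t; apply: le_trans (fL s t) _.
by rewrite ler_wpM2r ?ler_norm// metric_ge0.
Qed.

(** The sequence is Cauchy: all of its late terms are close to the same [P f k]. *)
Let u_cvg (f : S -> R) : isBL (dist_pos d) f -> cvgn (u f).
Proof.
move=> [C [L /BL_weaken fBL]]; apply/cauchy_cvgP/cauchy_exP => e e0.
have e2 : 0 < e / 2 by rewrite divr_gt0.
have e4 : 0 < e / 4 by rewrite divr_gt0.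
have [eta eta0 [k _ /(_ k (leqnn k)) rk]] := rate_near0 `|L| e2.
exists (P f k); have := u_near_P k fBL (BL_pos_lip fBL) (normr_ge0 L) eta0 e4.
apply: filterS => n h; rewrite /ball/= distrC; apply: le_lt_trans h _.
by lra.
Qed.

(** The rate is governed by the Lipschitz constant in the position alone; for a
    function of the letter alone it is [0], and the equality is exact. *)
Lemma lim_PosSam (f : S -> R) C K L k eta l : BL (dist_pos d) C K f -> pos_lip f C L ->
  0 <= L -> 0 < eta -> u f n @[n --> \oo] --> l -> `|l - P f k| <= rate L eta k.
Proof.
move=> fBL fL L0 eta0 ul; apply/ler_addgt0Pr => e e0.
have cl : `|u f n - P f k| @[n --> \oo] --> `|l - P f k|.
  by apply: cvg_norm; apply: cvgB => //; exact: cvg_cst.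
apply: (closed_cvg (fun y => y <= rate L eta k + e) (@closed_le _ _)) cl.
exact: u_near_P fBL fL L0 eta0 e0.
Qed.

Let Lim f := limn (u f).

Let LimP f : isBL (dist_pos d) f -> u f n @[n --> \oo] --> Lim f.
Proof. by move=> /u_cvg. Qed.

Let bm f : isBL (dist_pos d) f -> bmeas (f : borel S -> R).
Proof. by move=> [C [K fBL]]; exact: (BL_bmeas dS fBL). Qed.

Let LimE f l : isBL (dist_pos d) f -> u f n @[n --> \oo] --> l -> Lim f = l.
Proof. by move=> fBL ul; exact: cvg_lim. Qed.

Section decreasing.
Variables (v : nat -> S -> R).
Hypotheses (bv : forall n, isBL (dist_pos d) (v n))
  (vdec : forall n z, v n.+1 z <= v n z)
  (v0 : forall z, v n z @[n --> \oo] --> (0 : R)).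

Let v_homo m n z : (m <= n)%N -> v n z <= v m z.
Proof.
by move=> /subnK <-; elim: (n - m)%N => //= k IH; apply: le_trans (vdec _ _) IH.
Qed.

Let v_ge0 n z : 0 <= v n z.
Proof.
apply: (closed_cvg (fun y => y <= v n z) (@closed_le _ _)) (v0 z).
by exists n => // m /= nm; exact: v_homo.
Qed.

(** the supremum over the unit interval, which contains the positions of words *)
Let vsup n (a : A) := sup [set v n (a, x) | x in `[0, 1]%classic].

Let vsup_has n a : has_sup [set v n (a, x) | x in `[(0 : R), 1]%classic].
Proof.
split; first by exists (v n (a, 0)), 0 => //=; rewrite in_itv/= lexx ler01.
have [C [K [vC _]]] := bv n; exists C => _ [x _ <-].
by apply: le_trans (ler_norm _) (vC _).
Qed.

Let vsup_ge n a x : 0 <= x <= 1 -> v n (a, x) <= vsup n a.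
Proof.
by move=> x01; apply: ub_le_sup; [case: (vsup_has n a)|exists x => //=; rewrite in_itv].
Qed.

Let vsup_ge0 n a : 0 <= vsup n a.
Proof.
have h01 : 0 <= (0 : R) <= 1 by rewrite lexx ler01.
exact: le_trans (v_ge0 n (a, 0)) (vsup_ge n a h01).
Qed.

Let vsup_le n a c : (forall x, 0 <= x <= 1 -> v n (a, x) <= c) -> vsup n a <= c.
Proof.
move=> h; apply: ge_sup; first by case: (vsup_has n a).
by move=> y [x /= x01 <-]; apply: h; rewrite in_itv in x01.
Qed.

Let vsup_BL n : exists C K, BL (dist_pos d) C K (fun z => vsup n z.1).
Proof.
have [C [K /BL_weaken [vC vK]]] := bv n; exists C, `|K|.
apply: (BLP dS) => [z|z z'].
  by rewrite ger0_norm//; apply: vsup_le => x _; apply: le_trans (ler_norm _) (vC _).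
rewrite lerBlDr; apply: vsup_le => x x01.
have := vsup_ge n z'.1 x01; have := vK (z.1, x) (z'.1, x).
rewrite /dist_pos /= subrr normr0 addr0 => /(le_trans (ler_norm _)).
have : `|K| * d z.1 z'.1 <= `|K| * (d z.1 z'.1 + `|z.2 - z'.2|).
  by rewrite ler_wpM2l// lerDl.
lra.
Qed.

(** Dini: the unit interval is compact. *)
Let vsup_cvg a : vsup n a @[n --> \oo] --> (0 : R).
Proof.
apply/cvgrPdist_le => e e0; apply: contrapT => nh.
have big n : exists x, 0 <= x <= 1 /\ e / 2 <= v n (a, x).
  apply: contrapT => /forallNP h; apply: nh; exists n => // m /= nm.
  rewrite sub0r normrN ger0_norm//; apply: vsup_le => x x01.
  have /not_andP[//|/negP] := h x; rewrite -ltNge => h'.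
  by apply: le_trans (v_homo _ nm) _; lra.
have /choice[xs xsP] := big.
have [x [x01 xc]] : `[(0 : R), 1]%classic `&` cluster (xs n @[n --> \oo]) !=set0.
  apply: segment_compact; exists 0%N => // n _ /=.
  by rewrite in_itv; have [] := xsP n.
have e4 : 0 < e / 4 by rewrite divr_gt0.
have /cvgrPdist_lt/(_ _ e4)[p _ /(_ p (leqnn p))] := v0 (a, x).
rewrite sub0r normrN => /(le_lt_trans (ler_norm _)) vp.
have [C [K /BL_weaken[_ vK]]] := bv p.
pose r := e / 4 / (`|K| + 1).
have r0 : 0 < r by rewrite divr_gt0// ltr_wpDl.
have [y [[n pn <-] xy]] : [set xs n | n in [set n | (p <= n)%N]] `&` ball x r !=set0.
  apply: xc; last exact: nbhsx_ballx.
  by exists p => // n /= pn; exists n.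
have [_ +] := xsP n; apply/negP; rewrite -ltNge.
apply: le_lt_trans (v_homo _ pn) _.
have := vK (a, xs n) (a, x); rewrite /dist_pos /= metric_refl// add0r.
move=> /(le_trans (ler_norm _)).
have Kr : `|K| * `|xs n - x| <= e / 4.
  apply: (@le_trans _ _ (`|K| * r)).
    by rewrite ler_wpM2l// distrC ltW.
  rewrite /r mulrA ler_pdivrMr ?ltr_wpDl// mulrC ler_wpM2l ?lerDl// ltW//.
lra.
Qed.

(** Since positions stay in the unit interval, [v n] is dominated by a function of
    the letter alone, whose limiting integral is an integral against the fixed law
    of one random letter, where dominated convergence applies. *)
Lemma Lim_dec : Lim (v n) @[n --> \oo] --> (0 : R).
Proof.
pose I n := \int[PosSam (mu 0%N)]_z vsup n z.1.
have Icvg : I n @[n --> \oo] --> (0 : R).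
  rewrite -[X in _ --> X](Rint_cst (PosSam (mu 0%N))).
  have [C [K [vC _]]] := vsup_BL 0.
  apply: (cvg_Rint (C := C)).
  - by move=> n; have [C' [K' vBL]] := vsup_BL n; have [] := BL_bmeas dS vBL.
  - exact: measurable_cst.
  - move=> n z; apply: le_trans (vC z).
    rewrite [leLHS]ger0_norm//; apply: le_trans (ler_norm _).
    apply: vsup_le => x x01; apply: le_trans (v_homo _ (leq0n n)) _.
    exact: vsup_ge.
  - by move=> z; exact: vsup_cvg.
apply: (squeeze_cvgr _ (cvg_cst 0) Icvg); apply: nearW => n.
have [C [K vBL]] := vsup_BL n.
have bvn := BL_bmeas dS vBL.
have bn := bm (bv n).
apply/andP; split.
  apply: (limr_ge (u_cvg (bv n))).
  by apply: nearW => m; exact: Rint_ge0.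
have vs_lip : pos_lip (fun z => vsup n z.1) C 0.
  by split=> [z|a x x']; [case: vBL|rewrite subrr normr0 mul0r].
have isv : isBL (dist_pos d) (fun z => vsup n z.1) by exists C, K.
have := @lim_PosSam _ C K 0 0%N 1 _ vBL vs_lip (lexx _) ltr01 (LimP isv).
rewrite /rate mul0r normr_le0 subr_eq0 => /eqP IE.
rewrite -[leRHS]/(P (fun z => vsup n z.1) 0%N) -IE.
apply: (ler_cvg_to (LimP (bv n)) (LimP isv)); apply: nearW => m.
rewrite /u !Rint_rho// ler_pM2l ?invr_gt0//; apply: ler_sum => j _.
by apply: vsup_ge; rewrite divr_ge0//= ler_pdivrMr// mul1r ler_nat.
Qed.

End decreasing.

Let Lim_daniell : daniell (dist_pos d) Lim.
Proof.
split.
- move=> f g fBL gBL; apply: LimE; first exact: isBLD.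
  rewrite /u; under eq_fun do rewrite (RintD _ (bm fBL) (bm gBL)).
  by apply: cvgD; exact: LimP.
- move=> c f fBL; apply: LimE; first exact: isBLZ.
  rewrite /u; under eq_fun do rewrite (RintZ _ _ (bm fBL)).
  by apply: cvgM; [exact: cvg_cst|exact: LimP].
- move=> f fBL f0; apply: (limr_ge (u_cvg fBL)).
  by apply: nearW => n; exact: Rint_ge0.
- apply: LimE; first exact: isBL_cst.
  by rewrite /u; under eq_fun do rewrite Rint_cst; exact: cvg_cst.
- by move=> v bv vdec v0; exact: Lim_dec.
Qed.

Lemma RSS_rho_cvg : exists rho : M1 R S, rho_ R (tagged (w n)) @[n --> \oo] --> rho.
Proof.
have [rho rhoE] := daniell_representation dS Lim_daniell.
exists rho; apply: (BL_cvg_M1 dS) => C L f fBL.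
by rewrite (rhoE _ _ _ fBL); apply: LimP; exists C, L.
Qed.

Lemma RSS_rho_PosSam (rho : M1 R S) (f : S -> R) C L k eta :
  rho_ R (tagged (w n)) @[n --> \oo] --> rho -> BL (dist_pos d) C L f -> 0 < eta ->
  `|\int[rho]_z f z - \int[PosSam (mu k)]_z f z| <= rate `|L| eta k.
Proof.
move=> c /BL_weaken fBL eta0.
apply: (lim_PosSam k fBL (BL_pos_lip fBL) (normr_ge0 L) eta0).
exact: (M1_cvg_BL dS fBL c).
Qed.

Lemma PosSam_cvg (rho : M1 R S) :
  rho_ R (tagged (w n)) @[n --> \oo] --> rho -> PosSam (mu k) @[k --> \oo] --> rho.
Proof.
move=> c; apply: (BL_cvg_M1 dS) => C L f fBL; apply/cvgrPdist_le => e e0.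
have [eta eta0 near_rate] := rate_near0 `|L| e0.
move: near_rate; apply: filterS => k; apply: le_trans.
exact: RSS_rho_PosSam c fBL eta0.
Qed.

End RSS_limit.

(** The passage from a point of the boundary to the limiting empirical measure
    is a uniform limit of continuous maps, by [RSS_rho_PosSam]. *)
Lemma rho_limit_cvg (X : Type) (F : set_system X) {FF : Filter F}
    (nu : X -> law_family R A) (g : X -> M1 R S) (mu : law_family R A) (rho : M1 R S) :
  (forall y, exists2 w, RSS_converges w (nu y) &
    rho_ R (tagged (w n)) @[n --> \oo] --> g y) ->
  (exists2 w, RSS_converges w mu & rho_ R (tagged (w n)) @[n --> \oo] --> rho) ->
  (forall k, nu y k @[y --> F] --> mu k) -> g y @[y --> F] --> rho.
Proof.
move=> gP [w0 wmu c0] nucvg.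
apply: (BL_cvg_M1 dS) => C L h hBL; apply/cvgrPdist_le => e e0.
have e3 : 0 < e / 3 by rewrite divr_gt0.
have [eta eta0 [k _ /(_ k (leqnn k)) rk]] := rate_near0 `|L| e3.
have close y : `|\int[g y]_z h z - \int[PosSam (nu y k)]_z h z| <= e / 3.
  apply: le_trans rk; have [w wnu c] := gP y.
  exact: (RSS_rho_PosSam wnu k c hBL eta0).
have close_rho : `|\int[rho]_z h z - \int[PosSam (mu k)]_z h z| <= e / 3.
  by apply: le_trans rk; exact: (RSS_rho_PosSam wmu k c0 hBL eta0).
have near_mu : \int[PosSam (nu y k)]_z h z @[y --> F] --> \int[PosSam (mu k)]_z h z.
  exact: (PosSam_cvg_BL hBL (nucvg k)).
move/cvgrPdist_le : near_mu => /(_ _ e3); apply: filterS => y hk.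
have := close y; rewrite distrC => close_y.
have -> : e = e / 3 + (e / 3 + e / 3) by field.
apply: le_trans (ler_distD (\int[PosSam (mu k)]_z h z) _ _) _; apply: lerD => //.
by apply: le_trans (ler_distD (\int[PosSam (nu y k)]_z h z) _ _) _; exact: lerD.
Qed.

(** Subsequences are samples of positions without replacement, up to a collision;
    samples with replacement are the product laws to which [IOS_cvg] applies. *)
Lemma RSS_cvg_IOS (w : nat -> word A) (rho : M1 R S) k :
  word_length (w n) @[n --> \oo] --> \oo -> C_space R A rho ->
  rho_ R (tagged (w n)) @[n --> \oo] --> rho ->
  RSS R (tagged (w n)) k @[n --> \oo] --> IOS k rho.
Proof.
move=> wlen rhoC c; have dR := metrizes_row dA k.
apply: (BL_cvg_M1 dR) => C L F FBL; apply/cvgrPdist_le => e e0.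
have bF := BL_bmeas dR FBL; have FC := proj1 FBL.
have C0 : 0 <= C by apply: le_trans (FC (const_mx point)).
have e2 : 0 < e / 2 by rewrite divr_gt0.
have e4 : 0 < e / (4 * (C + 1)) by rewrite divr_gt0// mulr_gt0// ltr_wpDl.
have near1 : \int[IOS k (rho_ R (tagged (w n)))]_v F v @[n --> \oo] --> \int[IOS k rho]_v F v.
  have ci : IOS k (rho_ R (tagged (w n))) @[n --> \oo] --> IOS k rho.
    exact: (IOS_cvg dA rhoC c).
  exact: (M1_cvg_BL dR FBL ci).
move/cvgrPdist_le : near1 => /(_ _ e2) near1.
have near2 : \forall n \near \oo, (k < word_length (w n))%N.
  exact: (wlen _ (nbhs_infty_gt k)).
have near3 : \forall n \near \oo, collision R (word_length (w n)) k < e / (4 * (C + 1)).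
  have c0 := collision_near0 k e4; exact: (wlen _ c0).
apply: filterS3 near1 near2 near3 => n h1 kn h2.
have h3 := RSS_IOS_rho dA (tagged (w n)) (ltnW kn) bF FC.
rewrite [e]splitr; apply: le_trans (ler_distD _ _ _) (lerD h1 _).
rewrite distrC; apply: le_trans h3 _.
have -> : e / 2 = 2 * (C + 1) * (e / (4 * (C + 1))) by field; rewrite gt_eqF// ltr_wpDl.
apply: ler_pM; rewrite ?mulr_ge0 ?ler_pM2l ?lerDl//; first exact: collision_ge0.
exact: ltW.
Qed.

(** * Positions in the limit are uniform *)

Lemma count_le (y : R) m : 0 <= y ->
  Num.min (y - 1) m%:R <= \sum_(j < m) ((j.+1%:R <= y)%R : bool)%:R <= Num.min y m%:R.
Proof.
move=> y0; elim: m => [|m /andP[IH1 IH2]].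
  by rewrite big_ord0 ge_min lexx orbT /= le_min y0 lexx.
rewrite big_ord_recr /= -natr1; case: (boolP (m%:R + 1 <= y)) => h /=.
  rewrite (min_r (_ : m%:R <= y - 1)) in IH1; last by lra.
  rewrite (min_r (_ : m%:R <= y)) in IH2; last by lra.
  by rewrite (min_r h) lerD2r IH2 andbT ge_min lerD2r IH1 orbT.
rewrite -ltNge in h; rewrite addr0 (min_l (ltW h)); apply/andP; split; last first.
  by apply: le_trans IH2 _; rewrite ge_min lexx.
apply: le_trans IH1; rewrite le_min ge_min lexx/= ge_min.
by apply/orP; left; lra.
Qed.

Lemma ramp_BL (al be : R) : BL (dist_pos d) 1 `|be| (fun z : S => clamp (al + be * z.2)).
Proof.
split=> [z|z z']; first exact: norm_clamp.
apply: le_trans (norm_clampB _ _) _.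
have -> : al + be * z.2 - (al + be * z'.2) = be * (z.2 - z'.2) by ring.
by rewrite normrM ler_wpM2l// /dist_pos lerDr; exact: metric_ge0 dA _ _.
Qed.

(** The empirical measures give mass [y] to the positions up to [y], within the
    inverse of the length. Only Lipschitz functions pass to the limit, so that the
    indicator of [0, t] is squeezed between ramps of width [del]; the lower one
    rises from [0], as the limit must be shown not to charge negative positions. *)
Lemma rho_limit_C_space (w : nat -> word A) (rho : M1 R S) :
  word_length (w n) @[n --> \oo] --> \oo ->
  rho_ R (tagged (w n)) @[n --> \oo] --> rho -> C_space R A rho.
Proof.
move=> wlen c t /andP[t0 t1].
have mt := @measurable_lower R A t.
have bt := bmeas_indic R mt.
suff E : \int[rho]_p \1_(@lower R A t) p = t.
  rewrite Rint_indic// in E.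
  by rewrite -[RHS](congr1 EFin E) fineK// fin_num_measure.
pose F := \int[rho]_p \1_(@lower R A t) p.
pose len n : R := (word_length (w n))%:R.
have len0 n : 0 < len n by rewrite ltr0n.
pose freq n y := (len n)^-1 * \sum_(j < word_length (w n)) (((position R (tagged (w n)) j).2 <= y)%R : bool)%:R.
have freqE n y : freq n y = (len n)^-1 *
    \sum_(j < word_length (w n)) ((j.+1%:R <= y * len n)%R : bool)%:R.
  by congr (_ * _); apply: eq_bigr => j _; rewrite /position /= ler_pdivrMr.
have freq_le n y : 0 <= y -> freq n y <= y.
  move=> y0; rewrite freqE ler_pdivrMl// [leRHS]mulrC.
  have y0' : 0 <= y * len n by exact: mulr_ge0 y0 (ltW (len0 n)).
  have /andP[_] := count_le (word_length (w n)) y0'.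
  by move=> /le_trans; apply; rewrite ge_min lexx.
have freq_ge n y : 0 <= y <= 1 -> y - (len n)^-1 <= freq n y.
  move=> /andP[y0 y1]; rewrite freqE ler_pdivlMl//.
  have y0' : 0 <= y * len n by exact: mulr_ge0 y0 (ltW (len0 n)).
  have /andP[+ _] := count_le (word_length (w n)) y0'.
  apply: le_trans; rewrite le_min mulrBr mulfV ?gt_eqF// [y * _]mulrC lexx/=.
  have : len n * y <= len n * 1 by rewrite ler_pM2l.
  by rewrite -/(len n) mulr1; lra.
have pos01 n j : 0 < (position R (tagged (w n)) j).2 <= 1.
  by rewrite divr_gt0//= ler_pdivrMr// mul1r ler_nat.
have bmr al be : bmeas ((fun z => clamp (al + be * z.2)) : borel S -> R).
  exact: (BL_bmeas dS (ramp_BL al be)).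
suff H del : 0 < del < 1 -> t - 3 * del <= F <= t + del.
  apply/eqP; rewrite eq_le; apply/andP; split; apply/ler_addgt0Pr => e e0.
    have [e1|e1] := ltP e 1; first by have /andP[] := H e (ltac:(by rewrite e0)).
    apply: (@le_trans _ _ 1); last by rewrite (le_trans e1)// lerDr.
    by apply: Rint_le_cst => // p; rewrite indic_lower; case: (_ && _).
  have [e1|e1] := ltP (e / 3) 1; last first.
    have : 0 <= F by apply: Rint_ge0 => p; rewrite indic_lower; case: (_ && _).
    by rewrite -/F; lra.
  have /andP[+ _] := H (e / 3) (ltac:(by rewrite e1 divr_gt0)).
  by rewrite -/F; lra.
move=> /andP[d0 d1]; apply/andP; split; last first.
  pose f (z : S) := clamp ((1 + t / del) + (- del^-1) * z.2 : R) : R.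
  have fBL := ramp_BL (1 + t / del) (- del^-1).
  have fc : \int[rho_ R (tagged (w n))]_z f z @[n --> \oo] --> \int[rho]_z f z.
    exact: (M1_cvg_BL dS fBL c).
  have fE (z : S) : 1 + t / del + - del^-1 * z.2 = 1 + (t - z.2) / del by field; rewrite gt_eqF.
  apply: (@le_trans _ _ (\int[rho]_z f z)).
    apply: le_Rint; [exact: bt|exact: bmr|move=> p].
    rewrite indic_lower /f; case: andP => [[p0 pt]|_] /=; last exact: clamp_ge0.
    by rewrite clamp_ge1// fE lerDl divr_ge0 ?subr_ge0// ltW.
  apply: (closed_cvg (fun y => y <= t + del) (@closed_le _ _)) fc.
  apply: nearW => n; rewrite Rint_rho; last exact: bmr.
  apply: le_trans (freq_le n (t + del) _); last by rewrite addr_ge0// ltW.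
  rewrite ler_pM2l ?invr_gt0//; apply: ler_sum => j _.
  set p := position _ _ _; have [h|h] := leP p.2 (t + del); first exact: clamp_le1.
  rewrite /f clamp_le0// fE -lerBrDl sub0r ler_pdivrMr// mulN1r.
  by move: h; lra.
pose f1 (z : S) := clamp (0 + del^-1 * z.2 : R) : R.
pose f2 (z : S) := clamp (t / del + (- del^-1) * z.2 : R) : R.
have fBL := BLM (ramp_BL 0 del^-1) (ramp_BL (t / del) (- del^-1)).
have fc : \int[rho_ R (tagged (w n))]_z (f1 z * f2 z) @[n --> \oo] --> \int[rho]_z (f1 z * f2 z).
  exact: (M1_cvg_BL dS fBL c).
have f2E (z : S) : t / del + - del^-1 * z.2 = (t - z.2) / del by field; rewrite gt_eqF.
have f1E (z : S) : 0 + del^-1 * z.2 = z.2 / del by rewrite add0r mulrC.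
have f0 z : 0 <= f1 z * f2 z by rewrite mulr_ge0// clamp_ge0.
have bf : bmeas ((fun z => f1 z * f2 z) : borel S -> R) by apply: bmeasM; exact: bmr.
apply: (@le_trans _ _ (\int[rho]_z (f1 z * f2 z))); last first.
  apply: le_Rint; [exact: bf|exact: bt|move=> p].
  rewrite indic_lower; have [p0|p0] := leP 0 p.2; last first.
    by rewrite /f1 clamp_le0 ?mul0r// f1E ler_pdivrMr// mul0r ltW.
  have [pt|pt] := leP p.2 t; last first.
    by rewrite /f2 clamp_le0 ?mulr0// f2E ler_pdivrMr// mul0r subr_le0 ltW.
  by rewrite /= -[leRHS]mulr1 ler_pM ?clamp_ge0 ?clamp_le1.
have [td|td] := leP t del.
  by apply: (@le_trans _ _ 0); [lra|exact: Rint_ge0].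
have near_len : \forall n \near \oo, (len n)^-1 <= del.
  have h : \forall m \near \oo, del^-1 <= m%:R :> R by exact: nbhs_infty_ger.
  have h' : \forall n \near \oo, del^-1 <= len n by exact: (wlen _ h).
  move: h'; apply: filterS => n hn.
  by rewrite -[leRHS]invrK lef_pV2 ?posrE ?invr_gt0.
apply: (closed_cvg (fun y => t - 3 * del <= y) (@closed_ge _ _)) fc.
apply: filterS near_len => n ln; rewrite Rint_rho//.
apply: (@le_trans _ _ (freq n (t - del) - freq n del)).
  have h1 := @freq_ge n (t - del) (ltac:(by apply/andP; split; lra)).
  by have h2 := @freq_le n del (ltW d0); lra.
rewrite -mulrBr ler_pM2l ?invr_gt0// -sumrB; apply: ler_sum => j _.
set p := position _ _ _; have [h1|h1] := leP p.2 del.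
  by apply: le_trans (f0 p); case: (p.2 <= t - del); rewrite /=; lra.
have [h2|h2] := leP p.2 (t - del); last by rewrite subr0; exact: f0.
rewrite /= subr0 /f1 /f2 f1E f2E !clamp_ge1 ?mulr1// ler_pdivlMr// mul1r.
  by move: h2; lra.
exact: ltW.
Qed.

End limits.

Theorem theorem2 (R : realType) (A : polishType R) :
  (forall w : nat -> word A,
     word_length (w n) @[n --> \oo] --> \oo ->
     ((exists2 mu : law_family R A,
         martin_boundary R A mu & RSS_converges w mu) <->
      (exists2 rho : M1 R (A * R)%type,
         C_space R A rho & rho_ R (tagged (w n)) @[n --> \oo] --> rho)) /\
     (forall (mu : law_family R A) (rho : M1 R (A * R)%type),
         martin_boundary R A mu -> RSS_converges w mu ->
         C_space R A rho -> rho_ R (tagged (w n)) @[n --> \oo] --> rho ->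
         PosSam (mu k) @[k --> \oo] --> rho /\
         forall k, mu k = IOS k.+1 rho)) /\
  (exists (f : C_space R A -> martin_boundary R A)
          (g : martin_boundary R A -> C_space R A),
     [/\ cancel f g, cancel g f, continuous f & continuous g] /\
     (forall (rho : C_space R A) (k : nat), val (f rho) k = IOS k.+1 (val rho)) /\
     (forall mu : martin_boundary R A,
        PosSam (val mu k) @[k --> \oo] --> val (g mu))).
Proof.
have [d dA] := polish_metric A; have dS := metrizes_pos dA.
have rho_of (w : nat -> word A) (mu : law_family R A) : RSS_converges w mu ->
    exists2 rho : M1 R (A * R)%type, C_space R A rho &
      rho_ R (tagged (w n)) @[n --> \oo] --> rho.
  move=> wmu; have [rho c] := RSS_rho_cvg dA wmu.
  by exists rho => //; exact: (rho_limit_C_space dA wmu.1 c).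
have mu_of (w : nat -> word A) (rho : M1 R (A * R)%type) :
    word_length (w n) @[n --> \oo] --> \oo -> C_space R A rho ->
    rho_ R (tagged (w n)) @[n --> \oo] --> rho ->
    RSS_converges w (fun k => IOS k.+1 rho).
  by move=> wlen rhoC c; split=> // k; exact: (RSS_cvg_IOS dA wlen rhoC c).
have mu_unique (w : nat -> word A) (mu : law_family R A) (rho : M1 R (A * R)%type) :
    RSS_converges w mu -> C_space R A rho ->
    rho_ R (tagged (w n)) @[n --> \oo] --> rho -> forall k, mu k = IOS k.+1 rho.
  move=> wmu rhoC c k; have [_ ck] := mu_of w rho wmu.1 rhoC c.
  exact: (M1_cvg_unique (metrizes_row dA k.+1) (wmu.2 k) (ck k)).
split.
  move=> w wlen; split.
    split=> [[mu _ wmu]|[rho rhoC c]]; first exact: rho_of wmu.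
    exists (fun k => IOS k.+1 rho); last exact: mu_of.
    by exists w; exact: mu_of.
  move=> mu rho _ wmu rhoC c; split; first exact: (PosSam_cvg dA wmu c).
  exact: (mu_unique w mu rho wmu rhoC c).
have IOS_boundary (rho : C_space R A) :
    martin_boundary R A (fun k => IOS k.+1 (val rho)).
  have rhoC := set_valP rho; have [w [wlen c]] := C_space_words dA rhoC.
  by exists w; exact: mu_of.
have /choice[gv gvP] : forall mu : martin_boundary R A, exists rho : M1 R (A * R)%type,
    C_space R A rho /\ exists2 w, RSS_converges w (val mu) &
      rho_ R (tagged (w n)) @[n --> \oo] --> rho.
  move=> mu; have [w wmu] := set_valP mu; have [rho rhoC c] := rho_of w _ wmu.
  by exists rho; split=> //; exists w.
(* The boundary point determines the limiting law by [PosSam_cvg], so that the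
   choice made in [gv] is of no consequence. *)
pose f (rho : C_space R A) : martin_boundary R A := SigSub (mem_set (IOS_boundary rho)).
pose g (mu : martin_boundary R A) : C_space R A := SigSub (mem_set (gvP mu).1).
have fK mu k : val mu k = IOS k.+1 (gv mu).
  have [gC [w wmu c]] := gvP mu; exact: (mu_unique w _ _ wmu gC c).
have PosSam_g (mu : martin_boundary R A) : PosSam (val mu k) @[k --> \oo] --> gv mu.
  have [gC [w wmu c]] := gvP mu; exact: (PosSam_cvg dA wmu c).
exists f, g; split; last by split.
split.
- move=> rho; apply: val_inj => /=.
  apply: (M1_cvg_unique dS (PosSam_g (f rho))).
  have rhoC := set_valP rho; have [w [wlen c]] := C_space_words dA rhoC.
  exact: (PosSam_cvg dA (mu_of w _ wlen rhoC c) c).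
- by move=> mu; apply: val_inj; apply: functional_extensionality_dep => k; rewrite /= -fK.
- apply: continuous_comp_initial => rho.
  apply: (@prod_cvg nat (fun k => M1 R 'rV[A]_k.+1) _ (nbhs rho)) => k /=.
  apply: (IOS_cvg dA (set_valP rho)); exact: initial_continuous.
- apply: continuous_comp_initial => mu.
  suff cg : gv nu @[nu --> mu] --> gv mu by exact: cg.
  have cval k : val nu k @[nu --> mu] --> val mu k.
    have c1 : {for mu, continuous (set_val : martin_boundary R A -> law_family R A)}.
      exact: initial_continuous.
    have c2 : {for set_val mu, continuous (fun h : law_family R A => h k)}.
      exact: (@proj_continuous nat (fun k => M1 R 'rV[A]_k.+1) k).
    exact: (continuous_comp c1 c2).
  apply: (@rho_limit_cvg R A d dA _ (nbhs mu) (nbhs_filter mu) (fun nu => val nu)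
    gv (val mu) (gv mu)) => // [nu|].
    by have [_ [w wnu c]] := gvP nu; exists w.
  by have [_ [w wmu c]] := gvP mu; exists w.
Qed.
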